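(* Let $n,k\geq 1$. For any permutation $\tau$, the set-valued statistic $\mathrm{Peak}$ is equidistributed over $\mathcal{I}_n(I_k\oplus\tau)$ and $\mathcal{I}_n(J_k\oplus\tau)$, that is, $$\sum_{\pi \in \mathcal{I}_n(I_k\oplus\tau)}t^{\mathrm{Peak}(\pi)} = \sum_{\pi\in \mathcal{I}_n(J_k\oplus\tau)}t^{\mathrm{Peak}(\pi)}.$$
   Context: $\mathcal{S}_n$ is the set of permutations of $\{1,\ldots,n\}$, written as words $\pi=\pi_1\pi_2\cdots\pi_n$, and $\mathcal{I}_n\subseteq\mathcal{S}_n$ is the set of involutions ($\pi=\pi^{-1}$). An index $i$ with $2\le i\le n-1$ is a peak of $\pi$ if $\pi_{i-1}<\pi_i>\pi_{i+1}$; $\mathrm{Peak}(\pi)$ is the set of peaks of $\pi$. A permutation $\pi$ contains a pattern $\sigma\in\mathcal{S}_m$ if some subsequence of $\pi$ of length $m$ is order isomorphic to $\sigma$; otherwise $\pi$ avoids $\sigma$. $\mathcal{I}_n(\sigma)$ is the set of $\sigma$-avoiding elements of $\mathcal{I}_n$. $I_k=12\cdots k$ and $J_k=k\cdots 21$. For $\pi\in\mathcal{S}_a$ and $\sigma\in\mathcal{S}_b$, the direct sum is $\pi\oplus\sigma=\pi_1\cdots\pi_a(\sigma_1+a)\cdots(\sigma_b+a)$; for the empty permutation $\epsilon$, $\pi\oplus\epsilon=\pi$. For a finite set $A$ of positive integers, $t^A=\prod_{i\in A}t_i$ with $t_1,t_2,\ldots$ commuting indeterminates, and $t^{\emptyset}=1$.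 *)

(* Defs.v *)
From HB Require Import structures.
From mathcomp Require Import all_boot all_order all_algebra all_fingroup.
From mathcomp Require Import mpoly.

Set Implicit Arguments.
Unset Strict Implicit.
Unset Printing Implicit Defensive.

(* A permutation of {1, ..., n} is an element of 'S_n: positions and values
   are numbered from 0, so the letter pi_i of the word is s (i - 1) + 1.
   The empty permutation is the unique element of 'S_0. *)

Definition Idp (k : nat) : 'S_k := 1%g.

Definition Jdp (k : nat) : 'S_k := perm (@rev_ord_inj k).

Section DirectSum.
Variables (a b : nat) (s : 'S_a) (t : 'S_b).

Definition dsum_fun (i : 'I_(a + b)) : 'I_(a + b) :=
  match split i with
  | inl j => lshift b (s j)
  | inr j => rshift a (t j)
  end.

Lemma dsum_fun_inj : injective dsum_fun.
Proof.
move=> i j; rewrite -[i]splitK -[j]splitK /dsum_fun !unsplitK.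
case: (split i) => u; case: (split j) => v /=.
- by move=> /lshift_inj/perm_inj ->.
- by move/eqP; rewrite eq_lrshift.
- by move/eqP; rewrite eq_rlshift.
- by move=> /rshift_inj/perm_inj ->.
Qed.

Definition dsum : 'S_(a + b) := perm dsum_fun_inj.

End DirectSum.

(* f lists the positions, in increasing order, of the letters of an
   occurrence of the pattern. *)
Definition contains (m n : nat) (p : 'S_m) (s : 'S_n) : bool :=
  [exists f : {ffun 'I_m -> 'I_n},
    [forall i : 'I_m, forall j : 'I_m, (i < j) ==> (f i < f j)] &&
    [forall i : 'I_m, forall j : 'I_m, (p i < p j) == (s (f i) < s (f j))]].

Definition avoids (m n : nat) (p : 'S_m) (s : 'S_n) : bool :=
  ~~ contains p s.

Definition involutive_perm (n : nat) (s : 'S_n) : bool := s == (s^-1)%g.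

Definition Inv_avoiding (n m : nat) (p : 'S_m) : {set 'S_n} :=
  [set s : 'S_n | involutive_perm s && avoids p s].

(* The existence of both neighbours i - 1 and i + 1 in 'I_n excludes the first
   and the last position. *)
Definition Peak (n : nat) (s : 'S_n) : {set 'I_n} :=
  [set i : 'I_n | [exists h : 'I_n, exists j : 'I_n,
    [&& h.+1 == i :> nat, j == i.+1 :> nat, s h < s i & s j < s i]]].

(* As A is a subset of the n positions, only n indeterminates are needed: the
   one attached to the 0-based position i, 'X_i, is t_{i+1}. *)
Definition tmon (n : nat) (A : {set 'I_n}) : {mpoly int[n]} :=
  (\prod_(i in A) 'X_i)%R.

(* Main.v *)
Require Import Defs.
From mathcomp Require Import all_boot all_order all_algebra all_fingroup.
From mathcomp Require Import mpoly.
From mathcomp Require Import zify.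
From Stdlib Require Import FunctionalExtensionality.

Set Implicit Arguments.
Unset Strict Implicit.
Unset Printing Implicit Defensive.

(** Why the two sums agree.

    Peak sets.  It is enough to count, for every set [S] of positions, the
    involutions whose peaks all lie in [S] or just before an element of [S]
    ([near_equal]).  Indeed a peak set has no two consecutive elements, and
    among the sets of this kind near a given one, [L], all but [L] have a
    smaller sum; so the numbers of involutions with a given peak set follow by
    induction ([exact_equal]).

    The board.  For an involution [s], take the cells (i, j) below and to the
    left of an occurrence of [tau], and their reflections in the diagonal.
    They form a symmetric Young diagram, [board].  As [s], the identity and the
    reversal are involutions, [s] contains the direct sum of one of the latter
    with [tau] if and only if it has a monotone chain of length [k] inside a
    rectangle whose upper right cell is on the board ([contains_chain]).  The board only depends on the letters
    outside of it ([board_grey]), so the involutions split into classes, each of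
    which consists of the symmetric fillings of a fixed board with fixed
    nonempty columns.  Next to a letter outside of the board, ascents and
    descents are forced; hence the only peaks that vary within a class are
    those in the middle of three letters on the board, and the columns of these
    have equal heights ([white_col], [white_grey], [grey_white]).

    Growth diagrams.  Fomin's local rules transform a symmetric filling into a
    walk in the lattice of partitions along one half of the boundary of the
    board, which adds a box at each horizontal step and removes one at each
    vertical step.  All walks from the empty partition arise, each once
    ([fill_inj], [fill_surj]).  The first row of the partition at a vertex is
    the length of the longest increasing chain below it ([inc_chain]), the
    number of its rows that of the longest decreasing chain ([row_chain]), and
    two adjacent columns of equal height form an ascent if and only if the
    second one adds its box weakly above the first one ([asc_label]).  It
    remains to compare the walks with fewer than [k] rows to those with fewer
    than [k] columns, where in both cases no block of consecutive steps may contain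
    an ascent followed by a descent.

    Walks.  Transposing all partitions exchanges rows and columns, but ascents
    and descents as well ([transpose]).  So the claim is that, for any skew
    shape, the standard fillings without ascent-descent and those without
    descent-ascent are equally many ([strips_equal], [exchange]).  A filling of
    the first kind, if it is not empty, consists of descents followed by ascents.  It can be cut on
    either side of the turning point, so twice their number is the number of
    ways to dissect the shape into a vertical strip followed by a horizontal
    strip.  For the second kind the strips come in the other order.  Both
    numbers are products over the rows, which agree after telescoping
    ([prod_splittings]); this is the commutation of elementary and complete
    symmetric functions. *)

(** * Words and shapes *)

Fixpoint words (N s : nat) : seq (seq nat) :=
  if s is s'.+1 then [seq x :: w | x <- iota 0 N, w <- words N s']
  else [:: [::]].

Lemma mem_words N s w :
  (w \in words N s) = (size w == s) && all (fun x => x < N) w.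
Proof.
elim: s w => [|s IHs] [|x w] //=.
  by apply/negP => /allpairsP[[y u] /= [_ _]].
rewrite eqSS; apply/allpairsP/and3P => [[[y u] /= [yN uN [-> ->]]]|[sw xN aw]].
  by move: yN uN; rewrite mem_iota IHs /= => yN /andP[-> ->].
by exists (x, w); rewrite mem_iota xN IHs sw aw.
Qed.

Lemma words_uniq N s : uniq (words N s).
Proof.
elim: s => [//|s IHs] /=; apply: allpairs_uniq; rewrite ?iota_uniq //.
by move=> [x u] [y v] _ _ /= [-> ->].
Qed.

Lemma big_words_cat N a b (F : seq nat -> nat) :
  \sum_(w <- words N (a + b)) F w =
  \sum_(u <- words N a) \sum_(v <- words N b) F (u ++ v).
Proof.
elim: a F => [|a IHa] F; first by rewrite big_seq1.
rewrite addSn /= !big_allpairs_dep /=; apply: eq_bigr => x _.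
by rewrite (IHa (fun w => F (x :: w))).
Qed.

Lemma big_words_rev N s (F : seq nat -> nat) :
  \sum_(w <- words N s) F (rev w) = \sum_(w <- words N s) F w.
Proof.
rewrite -[LHS](big_map rev xpredT F); apply/perm_big/uniq_perm.
- by rewrite (map_inj_uniq (can_inj revK)) words_uniq.
- exact: words_uniq.
move=> w; rewrite -[w]revK (mem_map (can_inj revK)) !mem_words.
by rewrite !size_rev !all_rev.
Qed.

Definition add_box (l : nat -> nat) (r : nat) : nat -> nat := fun x => l x + (x == r).
Definition remove_box (l : nat -> nat) (r : nat) : nat -> nat := fun x => l x - (x == r).
Definition is_part (l : nat -> nat) := forall r, l r.+1 <= l r.
Definition can_add (l : nat -> nat) r := (r == 0) || (l r < l r.-1).
Definition can_remove (l : nat -> nat) r := l r.+1 < l r.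
Definition add_word (l : nat -> nat) (w : seq nat) : nat -> nat :=
  fun x => l x + count_mem x w.

Lemma can_addP l r : is_part l -> (can_add l r <-> is_part (add_box l r)).
Proof.
move=> pl; rewrite /can_add /add_box; split=> [H x|H].
- move: (pl x) H; case: (eqVneq x.+1 r) => [<-|_] /=; last by case: eqVneq; lia.
  by rewrite eqn_leq ltnn andbF; lia.
- by case: r H => [//|r] /(_ r) /=; rewrite eqxx eqn_leq ltnn andbF; lia.
Qed.

Lemma can_removeP l r : is_part l -> (can_remove l r <-> 0 < l r /\ is_part (remove_box l r)).
Proof.
move=> pl; rewrite /can_remove /remove_box; split=> [H|[H0 /(_ r)]].
- split; first lia.
  move=> x; move: (pl x) H.
  case: (eqVneq x r) => [->|_]; last by case: eqVneq; lia.
  by rewrite eqn_leq ltnn; lia.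
- by rewrite eqxx eqn_leq ltnn; lia.
Qed.

Lemma part_le l i j : is_part l -> i <= j -> l j <= l i.
Proof.
move=> pl /subnK <-; elim: (j - i) => [//|d IH].
by apply: leq_trans (pl _) IH.
Qed.

Fixpoint addable (l : nat -> nat) (w : seq nat) : bool :=
  if w is r :: w' then can_add l r && addable (add_box l r) w' else true.
Fixpoint removable (l : nat -> nat) (w : seq nat) : bool :=
  if w is r :: w' then can_remove l r && removable (remove_box l r) w' else true.

Lemma add_word_nil l : add_word l [::] = l.
Proof. by apply: functional_extensionality => x; rewrite /add_word addn0. Qed.

Lemma add_word_cons l r w : add_word l (r :: w) = add_word (add_box l r) w.
Proof.
by apply: functional_extensionality => x; rewrite /add_word /add_box /= addnA (eq_sym r).
Qed.

Lemma add_word_cat l u v : add_word l (u ++ v) = add_word (add_word l u) v.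
Proof.
by apply: functional_extensionality => x; rewrite /add_word count_cat addnA.
Qed.

Lemma addable_cat l u v : addable l (u ++ v) = addable l u && addable (add_word l u) v.
Proof.
by elim: u l => [|r u IH] l /=; rewrite ?add_word_nil // add_word_cons IH andbA.
Qed.

Lemma addable_part l w : is_part l -> addable l w -> is_part (add_word l w).
Proof.
elim: w l => [|r w IH] l pl /=; first by rewrite add_word_nil.
by case/andP=> /(can_addP _ pl) pl' /(IH _ pl'); rewrite add_word_cons.
Qed.

Lemma count_notin (x : nat) (w : seq nat) : x \notin w -> count_mem x w = 0.
Proof. by move=> H; apply/count_memPn. Qed.

(** A strictly increasing word adds its boxes from top to bottom, so a row
    never has to wait for the one above it: only the final shape matters, and
    such words are vertical strips. *)
Lemma addable_ltn l u : is_part l -> sorted ltn u -> (addable l u <-> is_part (add_word l u)).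
Proof.
elim: u l => [|r u IH] l pl; first by rewrite add_word_nil.
rewrite [sorted _ _]/= (path_sortedE ltn_trans) => /andP[/allP ru su].
rewrite add_word_cons [addable _ _]/=; split=> [/andP[/(can_addP _ pl) pl' V]|H].
  exact: addable_part.
suff pl' : is_part (add_box l r).
  by apply/andP; split; [exact/can_addP|exact/IH].
have lt_c x : x <= r -> count_mem x u = 0.
  by move=> xr; apply/count_notin/negP => /ru /=; lia.
apply/can_addP => //; rewrite /can_add; case: r H {IH ru} lt_c => [//|r] H lt_c /=.
by move: (H r); rewrite /add_word /add_box !lt_c // eqxx; case: eqVneq; lia.
Qed.

(** A weakly decreasing word fills the rows from bottom to top, so a new row
    is compared with the original length of the row above: such words are
    horizontal strips. *)
Lemma addable_geq l v : is_part l -> sorted geq v ->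
  (addable l v <-> forall r, add_word l v r.+1 <= l r).
Proof.
have geq_tr : transitive geq by move=> y x z /= yx zy; apply: leq_trans zy yx.
elim: v l => [|r v IH] l pl; first by rewrite add_word_nil.
rewrite [sorted _ _]/= (path_sortedE geq_tr) => /andP[/allP rv sv].
rewrite add_word_cons [addable _ _]/=.
have lt_c x : r < x -> count_mem x v = 0.
  by move=> xr; apply/count_notin/negP => /rv /=; lia.
split=> [/andP[ok]|H].
  have pl' := (can_addP r pl).1 ok.
  move/(IH _ pl' sv) => H x; move: (H x).
  rewrite {2}/add_box; case: (eqVneq x r) => [->|_]; last by rewrite addn0.
  by rewrite /add_word lt_c // /add_box gtn_eqF // !addn0 => _; apply: pl.
have pl' : is_part (add_box l r).
  apply/can_addP => //; rewrite /can_add; case: r H {lt_c rv} => [//|r] /(_ r) /=.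
  by rewrite /add_word /add_box eqxx; lia.
apply/andP; split; first exact/can_addP.
by apply/IH => // x; apply: leq_trans (H x) _; rewrite /add_box leq_addr.
Qed.

Fixpoint no_turn (e : rel nat) (w : seq nat) : bool :=
  if w is a :: ((b :: w'') as w') then
    (if w'' is c :: _ then ~~ (e a b && ~~ e b c) else true) && no_turn e w'
  else true.

(** The turning letter of a nonempty word of this shape may be put on either
    side of the cut, hence the factor two. *)
Lemma sum_splits_no_turn (e : rel nat) w : 0 < size w ->
  \sum_(j < (size w).+1)
     (sorted (fun a b => ~~ e a b) (take j w) && sorted e (drop j w)) =
  (no_turn e w).*2.
Proof.
pose A (u : seq nat) (j : nat) : nat :=
  sorted (fun a b => ~~ e a b) (take j u) && sorted e (drop j u).
case: w => // a w _; rewrite -[LHS]/(\sum_(j < (size w).+2) A (a :: w) j).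
elim: w a => [|b w IH] a; first by rewrite !big_ord_recl big_ord0.
pose X := \sum_(j < (size w).+1) A (b :: w) j.+1.
have {IH}: A (b :: w) 0 + X = (no_turn e (b :: w)).*2 by rewrite -IH big_ord_recl.
have -> : \sum_(j < (size [:: b & w]).+2) A [:: a, b & w] j =
    A [:: a, b & w] 0 + (A [:: a, b & w] 1 + ~~ e a b * X).
  rewrite big_ord_recl big_ord_recl big_distrr /=; congr (_ + (_ + _)).
  apply: eq_bigr => j _; rewrite /A /= add0n.
  by case: (e a b); rewrite /= ?mul1n.
rewrite /A /= ?take0 ?drop0 /=.
case eab: (e a b) => /=.
  rewrite mul0n addn0 addnn => _; congr (_ : bool).*2.
  elim: w b {A X eab} => [|c w IH] b //=.
  by rewrite IH; case: w {IH} => [|d w]; case: (e b c).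
by rewrite mul1n => ->; case: (w).
Qed.

(** * Words with a marked cut *)

Lemma big_seq_one (T : eqType) (r : seq T) (x : T) (F : T -> nat) :
  uniq r -> x \in r -> (forall y, y \in r -> y != x -> F y = 0) ->
  \sum_(y <- r) F y = F x.
Proof.
move=> ur xr F0; rewrite (bigD1_seq x) //= big_seq_cond big1 ?addn0 //.
by move=> y /andP[] /F0.
Qed.

(** Contents are represented by their weakly increasing words. *)
Lemma sum_by_content N s (f1 f2 : pred (seq nat)) (G : seq nat -> nat) :
  (forall u v, perm_eq u v -> G u = G v) ->
  (forall z, z \in words N s ->
     \sum_(w <- words N s) (perm_eq z w && f1 w) =
     \sum_(w <- words N s) (perm_eq z w && f2 w)) ->
  \sum_(w <- words N s) f1 w * G w = \sum_(w <- words N s) f2 w * G w.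
Proof.
move=> GP H.
have grp (f : pred (seq nat)) : \sum_(w <- words N s) f w * G w =
    \sum_(z <- words N s) sorted leq z * G z *
       \sum_(w <- words N s) (perm_eq z w && f w).
  under [RHS]eq_bigr => z _ do rewrite big_distrr /=.
  rewrite exchange_big /= big_seq [RHS]big_seq; apply: eq_bigr => w wW.
  have sW : sort leq w \in words N s.
    by rewrite mem_words size_sort all_sort -mem_words.
  rewrite (big_seq_one (x := sort leq w)) ?words_uniq //=.
    rewrite (sort_sorted leq_total) perm_sort perm_refl mul1n mulnC.
    by congr (_ * _); apply: GP; rewrite perm_sym perm_sort.
  move=> z zW /eqP nz; case sz: (sorted leq z); rewrite ?mul0n //.
  case pz: (perm_eq z w); rewrite ?muln0 //; case: nz.
  apply: (sorted_eq leq_trans anti_leq) => //; first exact: (sort_sorted leq_total).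
  by rewrite perm_sym perm_sort perm_sym.
rewrite !grp big_seq [RHS]big_seq; apply: eq_bigr => z zW.
by rewrite H.
Qed.

(** Used with the two parametrizations of dissected skew shapes by sets of
    rows. *)
Lemma sum_cuts N s (X : finType) (adm : pred X) (a b : X -> seq nat)
    (P : seq nat -> seq nat -> bool) (K : seq nat -> nat) :
  (forall x, adm x -> (a x ++ b x \in words N s) && P (a x) (b x)) ->
  (forall u v, u ++ v \in words N s -> P u v ->
     exists2 x, adm x & u = a x /\ v = b x) ->
  (forall x y, adm x -> adm y -> a x = a y -> b x = b y -> x = y) ->
  \sum_(w <- words N s) (\sum_(j < s.+1) P (take j w) (drop j w)) * K w =
  \sum_(x | adm x) K (a x ++ b x).
Proof.
move=> H1 H2 H3.
have -> : \sum_(x | adm x) K (a x ++ b x) =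
    \sum_(x | adm x) \sum_(w <- words N s) (w == a x ++ b x) * K w.
  apply: eq_bigr => x /H1 /andP[xW _].
  rewrite (big_seq_one (x := a x ++ b x)) ?words_uniq ?eqxx ?mul1n //.
  by move=> y _ /negPf ->.
rewrite exchange_big /= big_seq [RHS]big_seq; apply: eq_bigr => w wW.
rewrite -big_distrl /=; congr (_ * _).
have sw : size w = s by move: wW; rewrite mem_words => /andP[/eqP].
rewrite [RHS](partition_big (fun x => inord (size (a x)) : 'I_s.+1) xpredT) //=.
apply: eq_bigr => j _; rewrite big_mkcondr -big_mkcondr /=.
case Pj: (P _ _).
  have [|x ax [ux vx]] := H2 _ _ _ Pj; first by rewrite cat_take_drop.
  have sx : size (a x) = j by rewrite -ux size_takel // sw -ltnS.
  rewrite (bigD1 x) /=; last by rewrite ax sx inord_val eqxx.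
  rewrite -ux -vx cat_take_drop eqxx big1 ?addn0 // => y /andP[/andP[ay /eqP jy] /eqP ny].
  case: eqP => // wE; case: ny; apply: H3 => //.
  - rewrite -ux wE -jy inordK ?take_size_cat //.
    by rewrite ltnS -sw wE size_cat leq_addr.
  - rewrite -vx wE -jy inordK ?drop_size_cat //.
    by rewrite ltnS -sw wE size_cat leq_addr.
rewrite big1 // => x /andP[ax /eqP jx]; case: eqP => // wE.
move: Pj; rewrite wE -jx inordK; last by rewrite ltnS -sw wE size_cat leq_addr.
by rewrite take_size_cat // drop_size_cat //; have /andP[_ ->] := H1 _ ax.
Qed.

Fixpoint desc_word (c : nat -> nat) (N : nat) : seq nat :=
  if N is N'.+1 then nseq (c N') N' ++ desc_word c N' else [::].

Lemma count_desc_word c N x : count_mem x (desc_word c N) = (x < N) * c x.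
Proof.
elim: N => [//|N IH] /=; rewrite count_cat IH count_nseq /= ltnS [x <= N]leq_eqVlt.
by rewrite eq_sym; case: (eqVneq x N) => [->|_] //=; rewrite ltnn mul0n addn0.
Qed.

Lemma geq_trans : transitive geq.
Proof. by move=> y x z /= yx zy; apply: leq_trans zy yx. Qed.
Lemma geq_anti : antisymmetric geq.
Proof. by move=> x y /=; rewrite andbC => /anti_leq. Qed.

Lemma desc_word_sorted c N : sorted geq (desc_word c N).
Proof.
have lt_d M : all (gtn M) (desc_word c M).
  elim: M => [//|M IH] /=; rewrite all_cat all_nseq /= ltnSn orbT /=.
  by apply: sub_all IH => x /= /ltnW.
rewrite (sorted_pairwise geq_trans); elim: N => [//|N IH] /=.
rewrite pairwise_cat IH andbT; apply/andP; split.
  apply/allrelP => x y /nseqP[-> _] /(allP (lt_d N)) /=; exact: ltnW.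
by elim: (c N) => [//|k IHk] /=; rewrite IHk all_nseq /= leqnn orbT.
Qed.

Lemma desc_word_uniq c N v : sorted geq v -> all (fun x => x < N) v ->
  (forall x, x < N -> count_mem x v = c x) -> v = desc_word c N.
Proof.
move=> sv vN ct; apply: (sorted_eq geq_trans geq_anti) => //.
  exact: desc_word_sorted.
apply/allP => x _ /=; rewrite count_desc_word; case: (ltnP x N) => [xN|Nx].
  by rewrite ct // mul1n.
by apply/eqP/count_notin/negP => /(allP vN); rewrite ltnNge Nx.
Qed.

Section Rows.
Variable N : nat.
Implicit Type e : {ffun 'I_N -> bool}.
Definition rowin e (r : nat) : bool := oapp (fun i : 'I_N => e i) false (insub r).
Definition asc_word e : seq nat := [seq r <- iota 0 N | rowin e r].

Lemma rowin_ord e (i : 'I_N) : rowin e i = e i.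
Proof. by rewrite /rowin valK. Qed.

Lemma rowin_lt e r : rowin e r -> r < N.
Proof. by rewrite /rowin; case: insubP. Qed.

Lemma count_asc_word e x : count_mem x (asc_word e) = rowin e x.
Proof.
rewrite count_uniq_mem ?filter_uniq ?iota_uniq // mem_filter mem_iota /=.
by rewrite andb_idr // => /rowin_lt.
Qed.

Lemma asc_word_sorted e : sorted ltn (asc_word e).
Proof. by apply: sorted_filter; [exact: ltn_trans|exact: iota_ltn_sorted]. Qed.

Lemma asc_word_surj u : sorted ltn u -> all (fun x => x < N) u ->
  u = asc_word [ffun i : 'I_N => val i \in u].
Proof.
move=> su uN; apply: (irr_sorted_eq ltn_trans ltnn) => //; first exact: asc_word_sorted.
move=> x; rewrite mem_filter mem_iota /= /rowin; case: insubP => [i iN vi|xN] /=.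
  by rewrite ffunE vi iN andbT.
by apply/negP => /(allP uN) xN'; rewrite xN' in xN.
Qed.
End Rows.

(** On both sides, row [r] contributes according to [d], the excess of a new
    row over the old row above it; on the left it is the excess of the
    following row that matters. As there is no excess before the first row nor
    after the last one, the products agree. *)
Lemma prod_splittings N (l m : nat -> nat) :
  (forall r, N <= r -> m r = 0) -> is_part l -> is_part (fun r => l r + m r) ->
  \prod_(r < N) \sum_(e : bool) ((e <= m r) && (l r.+1 + m r.+1 <= l r + e)) =
  \prod_(r < N) \sum_(e : bool)
      ((e <= m r) && ((val r == 0) || (l r + m r <= l r.-1 + e))).
Proof.
move=> m0 pl pm.
pose d r := if r is r'.+1 then l r + m r - l r' else 0.
have shift (f : nat -> nat) : \prod_(r < N) f (d r.+1) = \prod_(r < N) f (d r).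
  case: N m0 => [|N] m0; first by rewrite !big_ord0.
  rewrite big_ord_recr [RHS]big_ord_recl /= mulnC; congr (_ * _).
  by rewrite /d m0 // addn0 (eqP (pl N)).
(* With this factor, each row contributes [a r] if the excess is at most one,
   and zero otherwise. *)
pose al k := if k == 1 then 2 else 1.
have al_gt0 : 0 < \prod_(r < N) al (d r.+1).
  by apply: prodn_gt0 => r; rewrite /al; case: eqP.
pose a (r : nat) := (0 < m r).+1.
apply/eqP; rewrite -(eqn_pmul2r al_gt0) [X in _ == _ * X]shift -!big_split /=.
have -> : \prod_(r < N) ((\sum_(e : bool)
    ((e <= m r) && (l r.+1 + m r.+1 <= l r + e))) * al (d r.+1)) =
    \prod_(r < N) (a r * (d r.+1 <= 1)).
  apply: eq_bigr => r _; rewrite big_bool /d /al /a; move: (pm r) => /=.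
  by case: eqP => ?; case: leqP => ?; rewrite ?muln0 ?muln1 ?muln2; lia.
rewrite big_split /= (shift (fun k => k <= 1 : nat)) -big_split /=.
apply/eqP/eq_bigr => r _; rewrite big_bool /d /al /a.
case: (nat_of_ord r) => [|q] /=; first by rewrite !muln1; lia.
move: (pl q) => /=.
by case: eqP => ?; case: leqP => ?; rewrite ?muln0 ?muln1 ?muln2; lia.
Qed.

(** * Strips of a given content *)

Lemma prod_bool (I : finType) (b : pred I) :
  \prod_(i : I) (b i : nat) = [forall i, b i].
Proof.
case: (boolP [forall i, b i]) => [/forallP H|]; first by rewrite big1 // => i _; rewrite H.
by rewrite negb_forall => /existsP[i /negPf Hi]; rewrite (bigD1 i) //= Hi mul0n.
Qed.

Section Class.
Variables (N s : nat) (l : nat -> nat) (z : seq nat).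
Hypotheses (zW : z \in words N s) (s_gt0 : 0 < s) (pl : is_part l).
Let m r := count_mem r z.
Implicit Type e : {ffun 'I_N -> bool}.
Let adm e := [forall i : 'I_N, e i <= m i].
Let hstrip_word e := desc_word (fun r => m r - rowin e r) N.

Let m0 r : N <= r -> m r = 0.
Proof.
move=> Nr; apply/count_notin/negP; move: zW; rewrite mem_words => /andP[_ /allP H].
by move/H; rewrite ltnNge Nr.
Qed.

Lemma words_perm w : perm_eq z w -> w \in words N s.
Proof.
by move=> zw; move: zW; rewrite !mem_words (perm_size zw) (perm_all _ zw).
Qed.

Lemma adm_row e r : adm e -> rowin e r <= m r.
Proof.
move/forallP => ae; case re: (rowin e r) => //; have rN := rowin_lt re.
by have := ae (Ordinal rN); rewrite -(rowin_ord e (Ordinal rN)) re.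
Qed.

Lemma perm_asc_hstrip e : adm e -> perm_eq z (asc_word e ++ hstrip_word e).
Proof.
move=> ae; apply/allP => x _ /=; rewrite count_cat count_asc_word count_desc_word -/(m x).
have := adm_row x ae; case: (ltnP x N) => [xN|Nx]; first by rewrite mul1n => /subnKC ->.
by rewrite mul0n m0 //; case: rowin.
Qed.

Lemma adm_surj u v : sorted ltn u -> sorted geq v -> perm_eq z (u ++ v) ->
  exists2 e, adm e & u = asc_word e /\ v = hstrip_word e.
Proof.
move=> su sv zp; have := words_perm zp; rewrite mem_words all_cat => /and3P[_ uN vN].
have ct x : m x = count_mem x u + count_mem x v.
  by rewrite -count_cat /m; move/seq.permP: zp => ->.
have Eu := asc_word_surj su uN; exists [ffun i : 'I_N => val i \in u].
  by apply/forallP => i; rewrite -(rowin_ord _ i) -count_asc_word -Eu ct leq_addr.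
split=> //; apply: desc_word_uniq => // x _.
by rewrite -count_asc_word -Eu ct addKn.
Qed.

Lemma asc_word_inj e e' : asc_word e = asc_word e' -> e = e'.
Proof.
move=> E; apply/ffunP => i; have := count_asc_word e i.
by rewrite E count_asc_word !rowin_ord; case: (e i); case: (e' i).
Qed.

Lemma add_word_perm w : perm_eq z w -> add_word l w = fun r => l r + m r.
Proof.
move=> /seq.permP zw; apply: functional_extensionality => x.
by rewrite /add_word /m zw.
Qed.

Lemma add_asc_word e : add_word l (asc_word e) = fun r => l r + rowin e r.
Proof. by apply: functional_extensionality => x; rewrite /add_word count_asc_word. Qed.

Lemma addable_vh e : adm e -> addable l (asc_word e ++ hstrip_word e) =
  [forall r : 'I_N, l r.+1 + m r.+1 <= l r + e r].
Proof.
move=> ae; rewrite addable_cat; have zp := perm_asc_hstrip ae.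
have E : add_word (add_word l (asc_word e)) (hstrip_word e) = fun r => l r + m r.
  by rewrite -add_word_cat add_word_perm.
apply/andP/forallP => [[V1 V2] r|H].
  have pu := addable_part pl V1.
  have /(_ r) := (addable_geq pu (desc_word_sorted _ _)).1 V2.
  by rewrite E add_asc_word rowin_ord.
have H' r : l r.+1 + m r.+1 <= l r + rowin e r.
  case: (ltnP r N) => [rN|Nr]; first by have := H (Ordinal rN); rewrite -rowin_ord.
  by rewrite m0 ?addn0; [apply: leq_trans (pl r) (leq_addr _ _)|apply: ltnW].
have pu : is_part (add_word l (asc_word e)).
  move=> r; rewrite add_asc_word; apply: leq_trans (H' r).
  by rewrite leq_add2l adm_row.
split; first by apply/addable_ltn => //; exact: asc_word_sorted.
by apply/addable_geq; rewrite ?desc_word_sorted // E => r; rewrite add_asc_word.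
Qed.

Lemma addable_hv e : is_part (fun r => l r + m r) -> adm e -> addable l (hstrip_word e ++ asc_word e) =
  [forall r : 'I_N, (val r == 0) || (l r + m r <= l r.-1 + e r)].
Proof.
move=> pm ae; rewrite addable_cat.
have E : add_word (add_word l (hstrip_word e)) (asc_word e) = fun r => l r + m r.
  by rewrite -add_word_cat add_word_perm // perm_sym perm_catC perm_sym perm_asc_hstrip.
have Eh r : add_word l (hstrip_word e) r + rowin e r = l r + m r.
  by have := congr1 (fun f => f r) E; rewrite /add_word count_asc_word.
apply/andP/forallP => [[V1 V2] r|H].
  case: r => [[|r] rN] //=.
  have /(_ r) := (addable_geq pl (desc_word_sorted _ _)).1 V1.
  by rewrite -(leq_add2r (rowin e r.+1)) Eh (rowin_ord e (Ordinal rN)).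
have H' r : add_word l (hstrip_word e) r.+1 <= l r.
  rewrite -(leq_add2r (rowin e r.+1)) Eh.
  case: (ltnP r.+1 N) => [rN|Nr]; first by have := H (Ordinal rN); rewrite -rowin_ord.
  by rewrite m0 // addn0; apply: leq_trans (pl r) (leq_addr _ _).
have V1 : addable l (hstrip_word e) by apply/addable_geq; rewrite ?desc_word_sorted.
split=> //; apply/addable_ltn; first exact: addable_part.
  exact: asc_word_sorted.
by rewrite E.
Qed.

(** Both sides are doubled in order to count words with a marked cut. Such a
    word is determined by the set [e] of rows used by its strictly increasing
    factor, and the conditions on the intermediate shapes decouple into one
    condition for each row. *)
Lemma strips_equal :
  \sum_(w <- words N s) (perm_eq z w && (addable l w && no_turn geq w)) =
  \sum_(w <- words N s) (perm_eq z w && (addable l w && no_turn (fun a b => ~~ geq a b) w)).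
Proof.
case: (boolP [forall r : 'I_N, l r.+1 + m r.+1 <= l r + m r]); last first.
  move=> no_turn; rewrite !big1 // => w _.
    case zw: (perm_eq z w) => //; case V: (addable l w) => //; case/negP: no_turn.
    by apply/forallP => r; have := addable_part pl V; rewrite add_word_perm //; apply.
  case zw: (perm_eq z w) => //; case V: (addable l w) => //; case/negP: no_turn.
  by apply/forallP => r; have := addable_part pl V; rewrite add_word_perm //; apply.
move/forallP => pm'.
have pm : is_part (fun r => l r + m r).
  move=> r; case: (ltnP r N) => [rN|Nr]; first exact: (pm' (Ordinal rN)).
  by rewrite !m0 ?addn0; [exact: pl| |apply: ltnW].
pose ngeq a b := ~~ geq a b.
have nE u : sorted ngeq u = sorted ltn u.
  by apply: eq_sorted => a b; rewrite /ngeq /= -ltnNge.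
have nnE u : sorted (fun a b => ~~ ngeq a b) u = sorted geq u.
  by apply: eq_sorted => a b; rewrite /ngeq negbK.
have dbl (e : rel nat) :
  (\sum_(w <- words N s) (perm_eq z w && (addable l w && no_turn e w))).*2 =
  \sum_(w <- words N s) (\sum_(j < s.+1)
     [&& sorted (fun a b => ~~ e a b) (take j w), sorted e (drop j w) &
         perm_eq z (take j w ++ drop j w)]) * addable l w.
  rewrite -mul2n big_distrr /= big_seq [RHS]big_seq; apply: eq_bigr => w wW.
  have sw : size w = s by move: wW; rewrite mem_words => /andP[/eqP].
  under [in RHS]eq_bigr => j _ do rewrite cat_take_drop andbA -mulnb.
  rewrite -big_distrl /= -sw sum_splits_no_turn ?sw //.
  by case: perm_eq; case: addable; case: no_turn; rewrite ?muln1 ?muln0 ?mul0n.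
apply: double_inj; rewrite !dbl.
have sc e : adm e -> asc_word e ++ hstrip_word e \in words N s.
  by move=> ae; apply/words_perm/perm_asc_hstrip.
rewrite (@sum_cuts N s _ adm (@asc_word N) hstrip_word
  (fun u v => [&& sorted ngeq u, sorted geq v & perm_eq z (u ++ v)])); first last.
- by move=> x y _ _ /asc_word_inj.
- by move=> u v _ /and3P[]; rewrite nE; apply: adm_surj.
- move=> e ae; rewrite sc // nE asc_word_sorted desc_word_sorted.
  exact: perm_asc_hstrip.
rewrite (@sum_cuts N s _ adm hstrip_word (@asc_word N)
  (fun u v => [&& sorted (fun a b => ~~ ngeq a b) u, sorted ngeq v & perm_eq z (u ++ v)]));
  first last.
- by move=> x y _ _ _ /asc_word_inj.
- move=> u v _ /and3P[]; rewrite nE nnE => su sv; rewrite perm_sym perm_catC perm_sym.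
  by move=> /(adm_surj sv su)[e ae [-> ->]]; exists e.
- move=> e ae; have pe := perm_asc_hstrip ae.
  have pe' : perm_eq z (hstrip_word e ++ asc_word e) by rewrite perm_sym perm_catC perm_sym.
  by rewrite nE nnE asc_word_sorted desc_word_sorted pe' words_perm.
have toprod (F : 'I_N -> bool -> bool) (K : {ffun 'I_N -> bool} -> bool) :
    (forall e, adm e -> K e = [forall r, F r (e r)]) ->
    \sum_(e | adm e) K e =
    \prod_(r < N) \sum_(b : bool) ((b <= m r) && F r b).
  move=> H; rewrite bigA_distr_bigA /= big_mkcond /=; apply: eq_bigr => e _.
  rewrite prod_bool; case ae: (adm e).
    rewrite H //; congr nat_of_bool.
    by apply: eq_forallb => r; rewrite (forallP ae).
  case: (boolP [forall r, _]) => // /forallP ae'; case/negP: (negbT ae).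
  by apply/forallP => i; case/andP: (ae' i).
rewrite (toprod (fun r b => l r.+1 + m r.+1 <= l r + b) _ addable_vh).
rewrite (toprod (fun r b => (val r == 0) || (l r + m r <= l r.-1 + b)) (fun e => addable l (hstrip_word e ++ asc_word e))).
  exact: prod_splittings.
by move=> e ae; rewrite addable_hv.
Qed.
End Class.

(** * Walks in the lattice of partitions *)

(** Reversing a word reverses both the order and the sense of its turns, so
    that a forbidden turn remains forbidden. *)
Lemma no_turn_rev e w : no_turn e (rev w) = no_turn (fun a b => ~~ e b a) w.
Proof.
case: (posnP (size w)) => [/size0nil -> //|w_gt0].
suff : (no_turn e (rev w)).*2 = (no_turn (fun a b => ~~ e b a) w).*2.
  by case: no_turn; case: no_turn.
rewrite -!sum_splits_no_turn ?size_rev // (reindex_inj rev_ord_inj) /=.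
apply: eq_bigr => j _; rewrite subSS take_rev drop_rev !rev_sorted.
rewrite subKn; last by rewrite -ltnS.
rewrite andbC; congr (nat_of_bool (_ && _)).
by apply: eq_sorted => a b; rewrite negbK.
Qed.

Lemma eq_no_turn e e' w : (forall a b, e a b = e' a b) -> no_turn e w = no_turn e' w.
Proof.
move=> E; elim: w => [//|a [//|b [//|c w]] IH].
by rewrite -[LHS]/(_ && no_turn e [:: b, c & w]) -[RHS]/(_ && no_turn e' [:: b, c & w]) IH !E.
Qed.

Lemma addable_rev (l : nat -> nat) w :
  is_part l -> is_part (add_word l w) -> addable l (rev w) = removable (add_word l w) w.
Proof.
move=> pl; elim: w => [//|r w IH] pa.
have E : remove_box (add_word l (r :: w)) r = add_word l w.
  apply: functional_extensionality => x; rewrite /remove_box /add_word /= (eq_sym r).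
  by rewrite addnCA addKn.
have E' : add_box (add_word l w) r = add_word l (r :: w).
  apply: functional_extensionality => x; rewrite /add_box /add_word /= (eq_sym r).
  by rewrite addnAC addnA addnAC.
have Er : add_word l (rev w) = add_word l w.
  by apply: functional_extensionality => x; rewrite /add_word count_rev.
rewrite rev_cons -cats1 addable_cat /= andbT Er E.
apply/andP/andP => [[V ok]|[ok V]].
  have pw : is_part (add_word l w) by rewrite -Er; apply: addable_part.
  rewrite -IH //; split=> //; apply/(can_removeP r pa).
  by rewrite E {1}/add_word /= eqxx; split=> //; lia.
have pw : is_part (add_word l w) by rewrite -E; apply: ((can_removeP r pa).1 ok).2.
by rewrite IH //; split=> //; apply/(can_addP r pw); rewrite E'.
Qed.

Lemma removable_sub (l : nat -> nat) w : is_part l -> removable l w ->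
  exists2 l', is_part l' & l = add_word l' w.
Proof.
elim: w l => [|r w IH] l pl /=; first by exists l; rewrite ?add_word_nil.
case/andP=> /(can_removeP r pl)[l_gt0 /IH H /H[l' pl' El]].
exists l' => //; apply: functional_extensionality => x.
have := congr1 (fun f => f x) El; rewrite /add_word /remove_box /= (eq_sym r).
by case: (eqVneq x r) => [->|_]; lia.
Qed.

(** Read backwards, the removals are additions to the smaller shape [l']. *)
Lemma strips_equal_rem N s (l : nat -> nat) z : z \in words N s -> 0 < s -> is_part l ->
  \sum_(w <- words N s) (perm_eq z w && (removable l w && no_turn (fun a b => b < a) w)) =
  \sum_(w <- words N s)
     (perm_eq z w && (removable l w && no_turn (fun a b => ~~ (b < a)) w)).
Proof.
move=> zW s_gt0 pl.
case: (boolP (has (fun w => perm_eq z w && removable l w) (words N s))); last first.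
  move/hasPn => H; rewrite !big_seq !big1 // => w wW;
    by case: (perm_eq z w) (H w wW) => //= /negPf ->.
case/hasP => w0 _ /andP[zw0 /(removable_sub pl)[l' pl' El]].
have Ez w : perm_eq z w -> add_word l' w = l.
  move=> zw; rewrite El; apply: functional_extensionality => x; rewrite /add_word.
  by congr (_ + _); apply/seq.permP; rewrite perm_sym in zw; apply: perm_trans zw zw0.
have key (e : rel nat) :
    \sum_(w <- words N s) (perm_eq z w && (removable l w && no_turn e w)) =
    \sum_(w <- words N s) (perm_eq z w && (addable l' w && no_turn (fun a b => ~~ e b a) w)).
  rewrite -[RHS]big_words_rev; apply: eq_bigr => w _.
  have -> : perm_eq z (rev w) = perm_eq z w by rewrite perm_sym perm_rev perm_sym.
  rewrite no_turn_rev; case zw: (perm_eq z w) => //=.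
  rewrite addable_rev ?Ez //.
  by congr (nat_of_bool (_ && _)); apply: eq_no_turn => a b; rewrite negbK.
rewrite !key -[RHS]/(_) (eq_bigr (fun w => perm_eq z w && (addable l' w && no_turn geq w) : nat)).
  rewrite strips_equal //; apply: eq_bigr => w _; congr (nat_of_bool (_ && (_ && _))).
  by apply: eq_no_turn => a b /=; rewrite -leqNgt.
move=> w _; congr (nat_of_bool (_ && (_ && _))).
by apply: eq_no_turn => a b /=; rewrite -leqNgt.
Qed.

(** A step adds a box ([Some true]), removes one ([Some false]) or stays in
    place ([None]); the second component tells whether it is linked to the
    preceding step, that is, continues a block. *)
Definition step := (option bool * bool)%type.

(** The relation [q] restricts the row and the column of the boxes that may be
    added. *)
Definition step_ok (q : rel nat) (k : option bool) (l : nat -> nat) (r : nat) :=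
  match k with
  | None => r == 0
  | Some true => can_add l r && q r (l r)
  | Some false => can_remove l r
  end.

Definition step_shape (k : option bool) (l : nat -> nat) (r : nat) :=
  match k with
  | None => l
  | Some true => add_box l r
  | Some false => remove_box l r
  end.

Fixpoint valid (q : rel nat) (l : nat -> nat) (st : seq step) (w : seq nat) :=
  match st, w with
  | [::], [::] => true
  | s :: st', r :: w' => step_ok q s.1 l r && valid q (step_shape s.1 l r) st' w'
  | _, _ => false
  end.

Fixpoint end_shape (l : nat -> nat) (st : seq step) (w : seq nat) :=
  match st, w with
  | s :: st', r :: w' => end_shape (step_shape s.1 l r) st' w'
  | _, _ => l
  end.

(** For two linked steps this will be an ascent of the filling in the case of
    additions, and a descent in the case of removals, which meet the columns
    from right to left. *)
Definition bit (k : option bool) (a b : nat) :=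
  if k is Some false then b < a else b <= a.

(** Inside a block, the bit [p] must not be followed by its negation. As the
    bit of removals has the opposite meaning and they are met in the opposite
    order, [p = true] forbids peaks of the filling in either kind of block. *)
Fixpoint no_linked_turn (p : bool) (st : seq step) (w : seq nat) :=
  match st, w with
  | s0 :: st', r0 :: w' =>
      (match st', w' with
       | s1 :: s2 :: _, r1 :: r2 :: _ =>
           ~~ [&& s1.2, s2.2, bit s1.1 r0 r1 == p & bit s2.1 r1 r2 == ~~ p]
       | _, _ => true
       end) && no_linked_turn p st' w'
  | _, _ => true
  end.

Fixpoint links_ok (st : seq step) :=
  if st is s0 :: ((s1 :: _) as st') then
    (s1.2 ==> ((s1.1 == s0.1) && isSome s0.1)) && links_ok st'
  else true.

Definition unlinked (st : seq step) := if st is s :: _ then ~~ s.2 else true.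

Lemma step_shape_part q k l r : is_part l -> step_ok q k l r -> is_part (step_shape k l r).
Proof.
move=> pl; case: k => [[]|] //=; first by case/andP=> /(can_addP r pl).
by move/(can_removeP r pl) => [].
Qed.

Lemma end_shape_part q l st w : is_part l -> valid q l st w -> is_part (end_shape l st w).
Proof.
elim: st l w => [|s st IH] l [|r w] //= pl /andP[/(step_shape_part pl) ps].
exact: IH.
Qed.

Lemma valid_cat q l st1 st2 u v : size u = size st1 ->
  valid q l (st1 ++ st2) (u ++ v) = valid q l st1 u && valid q (end_shape l st1 u) st2 v.
Proof.
by elim: st1 l u => [|s st1 IH] l [|r u] //= [su]; rewrite IH // andbA.
Qed.

Lemma no_linked_turn_cat p st1 st2 u v : size u = size st1 -> unlinked st2 ->
  no_linked_turn p (st1 ++ st2) (u ++ v) = no_linked_turn p st1 u && no_linked_turn p st2 v.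
Proof.
move=> su ul; elim: st1 u su => [|s0 st1 IH] [|r0 u] //= [su].
rewrite IH // andbA; congr (_ && _ && _).
case: st1 u su {IH} => [|s1 [|s2 st1]] [|r1 [|r2 u]] //= _.
  by case: st2 v ul => [|s1 [|s2 st2]] [|r1 [|r2 v]] //= /negPf ->.
by case: st2 v ul => [|s2 st2] [|r2 v] //= /negPf ->; rewrite andbF.
Qed.

Lemma links_ok_split k lk st : links_ok ((k, lk) :: st) ->
  exists a rest, [/\ st = nseq a (k, true) ++ rest, (a == 0) || isSome k,
                     unlinked rest & links_ok rest].
Proof.
elim: st lk => [|[k1 [|]] st IH] lk.
- by exists 0, [::].
- rewrite [links_ok _]/= => /andP[/andP[/eqP -> k_ok]].
  move/(IH true) => [a [rest [-> _ ul wr]]].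
  by exists a.+1, rest; rewrite k_ok orbT.
- by rewrite [links_ok _]/= => wr; exists 0, ((k1, false) :: st).
Qed.

Lemma no_linked_turn_block p k lk a u : size u = a.+1 ->
  no_linked_turn p ((k, lk) :: nseq a (k, true)) u = no_turn (fun x y => bit k x y == p) u.
Proof.
elim: a lk u => [|a IH] lk [|r0 [|r1 u]] // [su].
rewrite -[LHS]/(_ && no_linked_turn p ((k, true) :: nseq a (k, true)) (r1 :: u)).
rewrite -[RHS]/(_ && no_turn _ (r1 :: u)); congr (_ && _); last first.
  by apply: (IH true); rewrite /= su.
case: a u su {IH} => [|a] [|r2 u] //= _.
by congr (~~ (_ && _)); case: bit; case: (p).
Qed.

(** All steps of a block are of the same kind, so their order does not matter. *)
Lemma end_shape_perm k lk a l u v : size u = a.+1 -> perm_eq u v ->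
  (a == 0) || isSome k ->
  end_shape l ((k, lk) :: nseq a (k, true)) u = end_shape l ((k, lk) :: nseq a (k, true)) v.
Proof.
move=> su uv; have sv : size v = a.+1 by rewrite -(perm_size uv).
case: k => [[]|]; last first.
- rewrite orbF => /eqP a0; move: su sv; rewrite a0.
  by case: u {uv} => [|x [|y u]] // _; case: v => [|x' [|y' v]].
- move=> _; have E : forall b l0 w, size w = b.+1 ->
    end_shape l0 ((Some false, lk) :: nseq b (Some false, true)) w =
    (fun x => l0 x - count_mem x w).
    move=> b l0 w; elim: b l0 w {su sv} => [|b IH] l0 [|r w] // [sw] /=.
      case: w sw => // _; apply: functional_extensionality => x.
      by rewrite /remove_box /= addn0 eq_sym.
    have := IH (remove_box l0 r) w sw; case: w sw => // r' w sw /= ->.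
    by apply: functional_extensionality => x; rewrite /remove_box [RHS]subnDA (eq_sym r).
  by rewrite !E //; apply: functional_extensionality => x; rewrite (seq.permP uv).
- move=> _; have E : forall b l0 w, size w = b.+1 ->
    end_shape l0 ((Some true, lk) :: nseq b (Some true, true)) w = add_word l0 w.
    move=> b l0 w; elim: b l0 w {su sv} => [|b IH] l0 [|r w] // [sw] /=.
      by case: w sw => // _; rewrite add_word_cons add_word_nil.
    by have := IH (add_box l0 r) w sw; case: w sw => // r' w sw /= ->; rewrite [RHS]add_word_cons.
  rewrite !E //; apply: functional_extensionality => x.
  by rewrite /add_word (seq.permP uv).
Qed.

(** Both the restriction [q] and the rest [G] of the walk only depend on the
    content of the word of the block. *)
Lemma block_exchange N (q : pred nat) k lk a l (G : seq nat -> nat) :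
  is_part l -> (a == 0) || isSome k ->
  (forall u v, perm_eq u v -> size u = a.+1 -> G u = G v) ->
  let blk := (k, lk) :: nseq a (k, true) in
  \sum_(u <- words N a.+1) (valid (fun r _ => q r) l blk u && no_linked_turn true blk u) * G u =
  \sum_(u <- words N a.+1) (valid (fun r _ => q r) l blk u && no_linked_turn false blk u) * G u.
Proof.
move=> pl ka GP blk.
pose G' u := if size u == a.+1 then all q u * G u else 0.
pose G2 u := if size u == a.+1 then G u else 0.
have G'P u v : perm_eq u v -> G' u = G' v.
  move=> uv; rewrite /G' -(perm_size uv); case: eqP => // su.
  by rewrite (GP _ _ uv su) (perm_all _ uv).
have G2P u v : perm_eq u v -> G2 u = G2 v.
  by move=> uv; rewrite /G2 -(perm_size uv); case: eqP => // su; rewrite (GP _ _ uv su).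
have szw u : u \in words N a.+1 -> size u = a.+1.
  by rewrite mem_words => /andP[/eqP].
case: k @blk ka => [[]|] blk ka.
- have V l0 lk0 b u : size u = b.+1 ->
    valid (fun r _ => q r) l0 ((Some true, lk0) :: nseq b (Some true, true)) u =
    addable l0 u && all q u.
    elim: b l0 lk0 u => [|b IH] l0 lk0 [|r u] // [su].
      by case: u su => //= _; rewrite !andbT.
    rewrite -[LHS]/((can_add l0 r && q r) && valid (fun r _ => q r) (add_box l0 r)
      ((Some true, true) :: nseq b (Some true, true)) u).
    by rewrite (IH (add_box l0 r) true u su) andbACA.
  have E p : \sum_(u <- words N a.+1)
      (valid (fun r _ => q r) l blk u && no_linked_turn p blk u) * G u =
      \sum_(u <- words N a.+1) (addable l u && no_turn (fun x y => bit (Some true) x y == p) u) * G' u.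
    rewrite big_seq [RHS]big_seq; apply: eq_bigr => u /szw su.
    rewrite V // no_linked_turn_block // /G' su eqxx; case: addable => //.
    by case: all; rewrite /= ?mul1n ?mul0n ?muln0.
  rewrite !E; apply: sum_by_content => // z zW.
  rewrite (eq_bigr (fun w => perm_eq z w && (addable l w && no_turn geq w) : nat)).
    rewrite strips_equal //; apply: eq_bigr => w _; congr (nat_of_bool (_ && (_ && _))).
    by apply: eq_no_turn => x y /=; rewrite eqbF_neg.
  move=> w _; congr (nat_of_bool (_ && (_ && _))).
  by apply: eq_no_turn => x y /=; rewrite eqb_id.
- have V l0 lk0 b u : size u = b.+1 ->
    valid (fun r _ => q r) l0 ((Some false, lk0) :: nseq b (Some false, true)) u = removable l0 u.
    elim: b l0 lk0 u => [|b IH] l0 lk0 [|r u] // [su].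
      by case: u su => //= _; rewrite !andbT.
    rewrite -[LHS]/(can_remove l0 r && valid (fun r _ => q r) (remove_box l0 r)
      ((Some false, true) :: nseq b (Some false, true)) u).
    by rewrite (IH (remove_box l0 r) true u su).
  have E p : \sum_(u <- words N a.+1)
      (valid (fun r _ => q r) l blk u && no_linked_turn p blk u) * G u =
      \sum_(u <- words N a.+1) (removable l u && no_turn (fun x y => bit (Some false) x y == p) u) * G2 u.
    rewrite big_seq [RHS]big_seq; apply: eq_bigr => u /szw su.
    by rewrite V // no_linked_turn_block // /G2 su eqxx.
  rewrite !E; apply: sum_by_content => // z zW.
  rewrite (eq_bigr (fun w => perm_eq z w && (removable l w && no_turn (fun a b => b < a) w) : nat)).
    rewrite strips_equal_rem //; apply: eq_bigr => w _; congr (nat_of_bool (_ && (_ && _))).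
    by apply: eq_no_turn => x y /=; rewrite eqbF_neg.
  move=> w _; congr (nat_of_bool (_ && (_ && _))).
  by apply: eq_no_turn => x y /=; rewrite eqb_id.
- rewrite orbF in ka; rewrite /blk (eqP ka); apply: eq_big_seq => u.
  by rewrite mem_words => /andP[]; case: u => [|x [|y u]].
Qed.

(** Blocks can be treated one at a time, because the rest of a walk only sees
    the shape at the end of its first block. *)
Lemma exchange N (q : pred nat) st l : is_part l -> links_ok st ->
  \sum_(w <- words N (size st)) (valid (fun r _ => q r) l st w && no_linked_turn true st w) =
  \sum_(w <- words N (size st)) (valid (fun r _ => q r) l st w && no_linked_turn false st w).
Proof.
have [m] := ubnP (size st); elim: m st l => [//|m IH] [|[k lk] st] l sm pl wst.
  by rewrite !big_seq1.
have [a [rest [Est ka ul wr]]] := links_ok_split wst; rewrite {wst st}Est in sm *.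
rewrite -cat_cons; set blk := (k, lk) :: _.
have sblk : size blk = a.+1 by rewrite /= size_nseq.
rewrite size_cat sblk !big_words_cat.
have split p u v : u \in words N a.+1 ->
    (valid (fun r _ => q r) l (blk ++ rest) (u ++ v) && no_linked_turn p (blk ++ rest) (u ++ v) : nat) =
    (valid (fun r _ => q r) l blk u && no_linked_turn p blk u) *
    (valid (fun r _ => q r) (end_shape l blk u) rest v && no_linked_turn p rest v).
  rewrite mem_words => /andP[/eqP su _]; rewrite valid_cat ?sblk // no_linked_turn_cat ?sblk //.
  by rewrite mulnb; congr nat_of_bool; rewrite -!andbA; do !bool_congr.
have sumE p : \sum_(u <- words N a.+1) \sum_(v <- words N (size rest))
    (valid (fun r _ => q r) l (blk ++ rest) (u ++ v) && no_linked_turn p (blk ++ rest) (u ++ v)) =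
    \sum_(u <- words N a.+1) (valid (fun r _ => q r) l blk u && no_linked_turn p blk u) *
     \sum_(v <- words N (size rest))
      (valid (fun r _ => q r) (end_shape l blk u) rest v && no_linked_turn false rest v).
  rewrite big_seq [RHS]big_seq; apply: eq_bigr => u uW; rewrite big_distrr /=.
  case V: (valid (fun r _ => q r) l blk u && no_linked_turn p blk u); last first.
    rewrite [RHS]big1 => [|v _]; last by rewrite mul0n.
    by rewrite big1 // => v _; rewrite split // V.
  rewrite -big_distrr /= mul1n.
  have -> : \sum_(v <- words N (size rest))
    (valid (fun r _ => q r) l (blk ++ rest) (u ++ v) && no_linked_turn p (blk ++ rest) (u ++ v)) =
     \sum_(v <- words N (size rest))
      (valid (fun r _ => q r) (end_shape l blk u) rest v && no_linked_turn p rest v).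
    by apply: eq_bigr => v _; rewrite split // V mul1n.
  case: p V => [|//] /andP[V _]; apply: IH => //; last exact: end_shape_part V.
  by move: sm; rewrite /= size_cat; lia.
rewrite !sumE; apply: block_exchange => // u v uv su.
by rewrite (end_shape_perm _ _ su uv).
Qed.

(** * Transposing walks *)

Definition conjugate (l l' : nat -> nat) := forall r c, (c < l r) = (r < l' c).

Lemma conj_part l l' : conjugate l l' -> is_part l.
Proof.
move=> H r; rewrite leqNgt; apply/negP; rewrite H => lt1.
by have := ltnW lt1; rewrite -H ltnn.
Qed.

Lemma ltn_ext a b : (forall x, (x < a) = (x < b)) -> a = b.
Proof.
move=> H; apply/eqP; rewrite eqn_leq.
by rewrite leqNgt H ltnn leqNgt -H ltnn.
Qed.

Definition box_col (k : option bool) (l : nat -> nat) (r : nat) :=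
  match k with None => 0 | Some true => l r | Some false => (l r).-1 end.

(** A box at the end of row [r] of a shape is at the end of row [c] of the
    conjugate shape, where [c] is its column. *)
Lemma conj_step (q : rel nat) k l l' r : conjugate l l' -> step_ok q k l r ->
  let c := box_col k l r in
  [/\ step_ok (fun x y => q y x) k l' c, box_col k l' c = r &
      conjugate (step_shape k l r) (step_shape k l' c)].
Proof.
move=> H; have pl := conj_part H; case: k => [[]|] /=; last by move/eqP ->.
- case/andP=> ok qr; have El : l' (l r) = r.
    apply: ltn_ext => x; rewrite -H; case: (ltnP x r) => xr.
      move: ok xr; rewrite /can_add; case: r qr => [//|r] qr /= ok xr.
      by apply: leq_trans ok (part_le pl _).
    by rewrite ltnNge (part_le pl xr).
  rewrite El qr andbT; split=> //.
    rewrite /can_add El; case E: (l r) => [//|c] /=; by rewrite -H E.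
  move=> x y; rewrite /add_box; case: (eqVneq x r) => [->|nx]; case: (eqVneq y (l r)) => [->|ny].
  - by rewrite El; lia.
  - by rewrite addn0 -H; lia.
  - by rewrite El addn0 H El; lia.
  - by rewrite !addn0 H.
- move=> ok; have [lr pd] := (can_removeP r pl).1 ok.
  have El : l' (l r).-1 = r.+1.
    apply: ltn_ext => x; rewrite -H ltnS; case: (leqP x r) => xr.
      by have := part_le pl xr; lia.
    by have := part_le pl xr; move: ok; rewrite /can_remove; lia.
  rewrite El; split=> //.
    by rewrite /can_remove El ltnS leqNgt -H; lia.
  move=> x y; rewrite /remove_box; case: (eqVneq x r) => [->|nx]; case: (eqVneq y (l r).-1) => [->|ny].
  - by rewrite El; lia.
  - by rewrite subn0 -H; lia.
  - by rewrite El subn0 H El; lia.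
  - by rewrite !subn0 H.
Qed.

Fixpoint transpose_word (l : nat -> nat) (st : seq step) (w : seq nat) : seq nat :=
  match st, w with
  | s :: st', r :: w' => box_col s.1 l r :: transpose_word (step_shape s.1 l r) st' w'
  | _, _ => [::]
  end.

Lemma transpose_word_valid q l l' st w : conjugate l l' -> valid q l st w ->
  valid (fun x y => q y x) l' st (transpose_word l st w) /\ transpose_word l' st (transpose_word l st w) = w.
Proof.
elim: st l l' w => [|s st IH] l l' [|r w] //= H /andP[ok V].
have [ok' -> H'] := conj_step H ok.
by rewrite ok'; have [-> ->] := IH _ _ _ H' V.
Qed.

Lemma transpose_word_bound q l st w M : (forall r, l r <= M) -> valid q l st w ->
  (size (transpose_word l st w) == size st) && all (fun x => x < M + size st) (transpose_word l st w).
Proof.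
elim: st l w M => [|s st IH] l [|r w] M //= lM /andP[ok V].
have lM' x : step_shape s.1 l r x <= M.+1.
  by have := lM x; rewrite /step_shape /add_box /remove_box; case: s.1 => [[]|]; lia.
rewrite eqSS addnS -addSn; have /andP[-> ->] := IH _ _ _ lM' V.
rewrite !andbT; apply: leq_ltn_trans (_ : M < _); last lia.
by rewrite /box_col; case: s.1 => [[]|] //; have := lM r; lia.
Qed.

(** Of two consecutive additions, the second is weakly above the first one
    exactly when it is strictly to its right, and dually for removals:
    transposing negates the bits. *)
Lemma bit_transpose q q' k l a b : isSome k -> is_part l -> step_ok q k l a ->
  step_ok q' k (step_shape k l a) b ->
  bit k (box_col k l a) (box_col k (step_shape k l a) b) = ~~ bit k a b.
Proof.
case: k => [[]|] //= _ pl.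
- case/andP=> /(can_addP a pl) pa _ /andP[/(can_addP b pa) pb _].
  rewrite /add_box; case: (eqVneq b a) => [->|nb]; first lia.
  rewrite addn0 -ltnNge; case: (ltngtP a b) nb => // ab _.
    by rewrite (part_le pl (ltnW ab)).
  by have := part_le pa (ltnW ab); rewrite /add_box eqxx (ltn_eqF ab); lia.
- move=> oka okb; have [la pa] := (can_removeP a pl).1 oka.
  have [lb pb] := (can_removeP b pa).1 okb.
  move: lb; rewrite /remove_box; case: (eqVneq b a) => [->|nb]; first lia.
  rewrite subn0 -leqNgt; case: (ltngtP a b) nb => // ab _ lb.
    by have := part_le pl ab; move: oka; rewrite /can_remove; lia.
  by have := part_le pl (ltnW ab); lia.
Qed.

Lemma no_linked_turn_transpose q p l st w : is_part l -> links_ok st -> valid q l st w ->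
  no_linked_turn p st (transpose_word l st w) = no_linked_turn (~~ p) st w.
Proof.
elim: st l w => [|s0 st IH] l [|r0 w] // pl wst /andP[ok0 V].
have p1 := step_shape_part pl ok0.
rewrite -[LHS]/(_ && no_linked_turn p st (transpose_word (step_shape s0.1 l r0) st w)).
rewrite -[RHS]/(_ && no_linked_turn (~~ p) st w) IH //; last first.
  by case: st wst {IH V} => [//|s1 st] /andP[].
congr (_ && _); case: st wst V {IH} => [//|s1 [|s2 st]] /= wst.
  by case: w => // r1 w; case: w => [|r2 w]; rewrite /= ?andbF.
case: w => [//|r1 [|r2 w]]; first by rewrite /= andbF.
case/and3P=> ok1 ok2 _; have p2 := step_shape_part p1 ok1.
case/and3P: wst => w1 w2 _.
case l1: s1.2 w1 => //= /andP[/eqP E1 k0]; case l2: s2.2 w2 => //= /andP[/eqP E2 k1].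
rewrite E1 in E2 ok1 ok2; rewrite E2 in ok2; rewrite E1 E2.
by rewrite (bit_transpose k0 pl ok0 ok1) (bit_transpose k0 p1 ok1 ok2); case: bit; case: bit; case: (p).
Qed.

Definition empty_shape : nat -> nat := fun _ => 0.

Lemma leq_sum_words N s (A B : pred (seq nat)) (f g : seq nat -> seq nat) :
  (forall w, w \in words N s -> A w -> [/\ f w \in words N s, B (f w) & g (f w) = w]) ->
  \sum_(w <- words N s) A w <= \sum_(w <- words N s) B w.
Proof.
move=> H; have E (P : pred (seq nat)) :
    \sum_(w <- words N s) P w = size [seq w <- words N s | P w].
  by rewrite size_filter -sum1_count [RHS]big_mkcond; apply: eq_bigr => w _; case: (P w).
rewrite !E -(size_map f); apply: uniq_leq_size.
  rewrite map_inj_in_uniq ?filter_uniq ?words_uniq // => u v.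
  rewrite !mem_filter => /andP[Au uW] /andP[Av vW] Efuv.
  by have [_ _ <-] := H u uW Au; rewrite Efuv; have [_ _ ->] := H v vW Av.
move=> x /mapP[w]; rewrite mem_filter => /andP[Aw wW] ->.
by have [fW Bf _] := H w wW Aw; rewrite mem_filter Bf.
Qed.

Lemma transpose q p st : links_ok st ->
  \sum_(w <- words (size st) (size st)) (valid q empty_shape st w && no_linked_turn p st w) =
  \sum_(w <- words (size st) (size st))
    (valid (fun x y => q y x) empty_shape st w && no_linked_turn (~~ p) st w).
Proof.
have conj0 : conjugate empty_shape empty_shape by move=> r c.
move=> wst; have half q1 p1 :
    \sum_(w <- words (size st) (size st)) (valid q1 empty_shape st w && no_linked_turn p1 st w) <=
    \sum_(w <- words (size st) (size st))
      (valid (fun x y => q1 y x) empty_shape st w && no_linked_turn (~~ p1) st w).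
  apply: (@leq_sum_words _ _ _ _ (transpose_word empty_shape st) (transpose_word empty_shape st)) => w wW /andP[V nw].
  have [V' E] := transpose_word_valid conj0 V; split=> //; last first.
    by rewrite V' (no_linked_turn_transpose _ (conj_part conj0) wst V) negbK.
  by rewrite mem_words; have := @transpose_word_bound q1 empty_shape st w 0 (fun=> leqnn 0) V; rewrite add0n.
apply/eqP; rewrite eqn_leq half /=.
by have := half (fun x y => q y x) (~~ p); rewrite negbK.
Qed.

(** The exchange reverses the forbidden pattern of bits; transposing reverses
    it again and turns rows into columns. *)
Lemma walks_equinumerous K st : links_ok st ->
  \sum_(w <- words (size st) (size st))
    (valid (fun r _ => r != K) empty_shape st w && no_linked_turn true st w) =
  \sum_(w <- words (size st) (size st))
    (valid (fun _ c => c != K) empty_shape st w && no_linked_turn true st w).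
Proof.
move=> wst; rewrite (@exchange _ (fun r => r != K)) //.
exact: (transpose (fun r _ => r != K) false wst).
Qed.

(** * Local rules *)

Section Grid.
Variables (X Y : Type) (loc : nat -> nat -> X -> Y -> X * Y).
Variables (x0 : nat -> X) (y0 : nat -> Y).

Fixpoint grid_col (i : nat) (v : nat -> Y) (j : nat) : X :=
  if j is j'.+1 then (loc i j' (grid_col i v j') (v j')).1 else x0 i.

Fixpoint grid_v (i : nat) : nat -> Y :=
  if i is i'.+1 then fun j => (loc i' j (grid_col i' (grid_v i') j) (grid_v i' j)).2
  else y0.

Definition grid_h i j := grid_col i (grid_v i) j.

Lemma gridE i j : (grid_h i j.+1, grid_v i.+1 j) = loc i j (grid_h i j) (grid_v i j).
Proof. by rewrite /grid_h /=; case: loc. Qed.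
End Grid.

Lemma grid_uniq (X Y : Type) (loc : nat -> nat -> X -> Y -> X * Y) n
    (h h' : nat -> nat -> X) (v v' : nat -> nat -> Y) :
  (forall i, i < n -> h i 0 = h' i 0) -> (forall j, j < n -> v 0 j = v' 0 j) ->
  (forall i j, i < n -> j < n -> (h i j.+1, v i.+1 j) = loc i j (h i j) (v i j)) ->
  (forall i j, i < n -> j < n -> (h' i j.+1, v' i.+1 j) = loc i j (h' i j) (v' i j)) ->
  (forall i j, i < n -> j <= n -> h i j = h' i j) /\
  (forall i j, i <= n -> j < n -> v i j = v' i j).
Proof.
move=> h0 v0 E E'.
have col i : i < n -> (forall j, j < n -> v i j = v' i j) ->
    forall j, j <= n -> h i j = h' i j.
  move=> ltin Ev; elim=> [_|j IHj ltjn]; first exact: h0.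
  have := E i j ltin ltjn; have := E' i j ltin ltjn.
  by rewrite IHj ?(ltnW ltjn) // Ev // => <- [].
have row i : i <= n -> forall j, j < n -> v i j = v' i j.
  elim: i => [_|i IH ltin j ltjn]; first exact: v0.
  have Ev := IH (ltnW ltin).
  have := E i j ltin ltjn; have := E' i j ltin ltjn.
  by rewrite (col i ltin Ev j (ltnW ltjn)) Ev // => <- [].
split; last by move=> i j /row; apply.
by move=> i j ltin; apply: col => //; apply: row; apply: ltnW.
Qed.

(** Fomin's local rule, in terms of edges: a label is the row in which the
    shapes at the ends of the edge differ. The labels [x] and [y] of the
    bottom and the left edge of a cell determine those of the top and the
    right edge; [m] tells whether the cell holds a dot. Cells outside of the
    board, with [d = false], transmit the labels, so that the labels on the
    boundary of the board appear on the sides of the square. *)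
Definition local_rule (d m : bool) (x y : option nat) : option nat * option nat :=
  if ~~ d then (x, y) else
  if m then (Some 0, Some 0) else
  if x is Some r then if y == Some r then (Some r.+1, Some r.+1) else (x, y)
  else (x, y).

Definition inverse_rule (d : bool) (x y : option nat) : bool * (option nat * option nat) :=
  if ~~ d then (false, (x, y)) else
  if x is Some r then
    if y == Some r then
      if r is r'.+1 then (false, (Some r', Some r')) else (true, (None, None))
    else (false, (x, y))
  else (false, (x, y)).

Lemma local_ruleK (d m : bool) (x y : option nat) : (m -> [/\ d, x = None & y = None]) ->
  let xy := local_rule d m x y in inverse_rule d xy.1 xy.2 = (m, (x, y)).
Proof.
case: m => [[] // -> -> -> //|_].
rewrite /local_rule /inverse_rule; case: d => //=.
case: x y => [r|] [s|] //=; case: (Some s =P Some r) => [[->]|ns] /=; rewrite ?eqxx //.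
by case: eqP ns.
Qed.

Lemma inverse_ruleK d x y :
  let r := inverse_rule d x y in local_rule d r.1 r.2.1 r.2.2 = (x, y).
Proof.
rewrite /local_rule /inverse_rule; case: d => //=.
case: x y => [r|] [s|] //=; case: (Some s =P Some r) => [[->]|ns] /=; rewrite ?eqxx //.
  by case: r => [|r] //=; rewrite eqxx.
by case: eqP ns.
Qed.

Lemma inverse_rule_dot d x y : (inverse_rule d x y).1 ->
  [/\ d, (inverse_rule d x y).2.1 = None & (inverse_rule d x y).2.2 = None].
Proof.
rewrite /inverse_rule; case: d => //=; case: x y => [r|] [s|] //=.
by case: eqP => //= _; case: r.
Qed.

Lemma local_rule_swap d m x y : local_rule d m y x = ((local_rule d m x y).2, (local_rule d m x y).1).
Proof.
rewrite /local_rule; case: d m => [] [] //=; case: x y => [r|] [s|] //=.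
by rewrite eq_sym; case: eqP => //= [[->]].
Qed.

Lemma inverse_rule_swap d x y :
  inverse_rule d y x = ((inverse_rule d x y).1, ((inverse_rule d x y).2.2, (inverse_rule d x y).2.1)).
Proof.
rewrite /inverse_rule; case: d => //=; case: x y => [r|] [s|] //=.
by rewrite eq_sym; case: eqP => //= [[->]]; case: r.
Qed.

Definition add_label (al : nat -> nat) (x : option nat) : nat -> nat :=
  fun r => al r + (x == Some r).

(** The difference of [al] and [E] is a partition. When a diagram is built
    from its boundary, [E] is the content of the left side, which turns out to
    be zero only in the end. *)
Definition part_above (E al : nat -> nat) :=
  forall r, E r <= al r /\ al r.+1 + E r <= al r + E r.+1.

Lemma part_above_eq E al al' : al =1 al' -> part_above E al -> part_above E al'.
Proof. by move=> H ok r; rewrite -!H; apply: ok. Qed.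

(** Both ways around a cell add the same boxes. *)
Lemma flux (d m : bool) (x y : option nat) r : (m -> [/\ d, x = None & y = None]) ->
  ((local_rule d m x y).1 == Some r) + (y == Some r) = (x == Some r) + ((local_rule d m x y).2 == Some r).
Proof.
case: m => [[] // -> -> -> |_]; first by rewrite addnC.
rewrite /local_rule; case: d => //=.
by case: x => [s|] //=; case: (y =P Some s) => [->|_] //=; rewrite addnC.
Qed.

Lemma Some_eq (a b : nat) : (Some a == Some b :> option nat) = (a == b).
Proof. by []. Qed.

(** Inverting the local rule does not lead out of the lattice of partitions. *)
Lemma part_above_cell E al (m : bool) (x y : option nat) : (m -> [/\ true, x = None & y = None]) ->
  part_above E (add_label al x) -> part_above E (add_label al y) ->
  part_above E (add_label (add_label al y) (local_rule true m x y).1) -> part_above E al.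
Proof.
have none : part_above E (add_label al None) -> part_above E al.
  by apply: part_above_eq => r; rewrite /add_label addn0.
case: m => [[] // _ -> -> /none //|_].
case: x y => [r|] [s|]; try by move=> // *; apply: none.
rewrite /local_rule /= Some_eq; case: (eqVneq s r) => [->|nsr] /= okx oky okd t.
- by have := okx t; have := okx t.+1; have := okd t; rewrite /add_label !Some_eq; lia.
- by have := okx t; have := oky t; have := okd t; rewrite /add_label !Some_eq; lia.
Qed.

Lemma part_cell al (m : bool) (x y : option nat) : (m -> [/\ true, x = None & y = None]) ->
  is_part al -> is_part (add_label al x) -> is_part (add_label al y) ->
  is_part (add_label (add_label al y) (local_rule true m x y).1).
Proof.
have none b : is_part b -> is_part (add_label b None).
  by move=> pb r; rewrite /add_label !addn0; apply: pb.
case: m => [[] // _ -> -> pa _ _|_].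
  by move=> r; have := pa r; rewrite /add_label /local_rule /=; case: r => [|r]; rewrite /= !addn0; lia.
case: x y => [r|] [s|]; try by move=> // *; apply: none.
- rewrite /local_rule /= Some_eq; case: (eqVneq s r) => [->|nsr] /= pa okx oky t.
    by have := okx t; have := pa t; rewrite /add_label !Some_eq; lia.
  by have := okx t; have := oky t; have := pa t; rewrite /add_label !Some_eq; lia.
- by move=> pa px _; move=> r0; have := px r0; rewrite /add_label /local_rule /= !addn0.
Qed.

(** * Shapes on a board and its boundary path *)

Section Board.
Variables (n : nat) (D : nat -> nat -> bool).
Hypothesis Dn : forall i j, D i j -> i < n /\ j < n.
Hypothesis Dd : forall i j i' j', D i j -> i' <= i -> j' <= j -> D i' j'.

(** The corners of the cells of the board, and all points of the two axes. *)
Definition vertex i j := [|| i == 0, j == 0 | D i.-1 j.-1].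

Section Labels.
Variables (M : nat -> nat -> bool) (h v : nat -> nat -> option nat).
Hypothesis lab : forall i j, i < n -> j < n ->
  (h i j.+1, v i.+1 j) = local_rule (D i j) (M i j) (h i j) (v i j).
Hypothesis clean : forall i j, i < n -> j < n -> M i j ->
  [/\ D i j, h i j = None & v i j = None].

(** The partition at the point (i, j), provided that the left side carries no
    labels. *)
Definition shape_at i j r :=
  \sum_(0 <= i' < i) (h i' j == Some r) + \sum_(0 <= j' < j) (v 0 j' == Some r).

Lemma shape_right i j r : shape_at i.+1 j r = shape_at i j r + (h i j == Some r).
Proof. by rewrite /shape_at big_nat_recr //= addnAC. Qed.

Lemma lab_h i j : i < n -> j < n -> h i j.+1 = (local_rule (D i j) (M i j) (h i j) (v i j)).1.
Proof. by move=> lin ljn; rewrite -lab. Qed.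
Lemma lab_v i j : i < n -> j < n -> v i.+1 j = (local_rule (D i j) (M i j) (h i j) (v i j)).2.
Proof. by move=> lin ljn; rewrite -lab. Qed.

Lemma shape_up i j r : i <= n -> j < n -> shape_at i j.+1 r = shape_at i j r + (v i j == Some r).
Proof.
elim: i => [_ ljn|i IH lin ljn].
  by rewrite /shape_at ![\sum_(0 <= _ < 0) _]big_geq // big_nat_recr.
rewrite !shape_right IH ?(ltnW lin) // lab_h // lab_v // -addnA [X in _ + X]addnC.
by rewrite flux ?addnA //; apply: clean.
Qed.

Lemma shape_origin r : shape_at 0 0 r = 0.
Proof. by rewrite /shape_at !big_geq. Qed.

Lemma shape_cell i j r : i < n -> j < n -> D i j ->
  shape_at i.+1 j.+1 r = shape_at i j r + (v i j == Some r) +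
                  ((local_rule true (M i j) (h i j) (v i j)).1 == Some r).
Proof. by move=> lin ljn dij; rewrite shape_right shape_up ?(ltnW lin) // lab_h // dij. Qed.

Lemma clean' i j : i < n -> j < n -> M i j -> [/\ true, h i j = None & v i j = None].
Proof. by move=> lin ljn /(clean lin ljn)[]. Qed.

(** The partitions propagate from the boundary of the board to the axes. *)
Lemma part_above_back E :
  (forall i j, i <= n -> j <= n -> vertex i j -> ~~ D i j -> part_above E (shape_at i j)) ->
  forall i j, i <= n -> j <= n -> vertex i j -> part_above E (shape_at i j).
Proof.
move=> bd i j; have [m] := ubnP ((n - i) + (n - j)).
elim: m i j => // m IH i j lm lin ljn rij.
case dij: (D i j); last by apply: bd; rewrite ?dij.
have [ltin ltjn] := Dn dij.
have r1 : vertex i.+1 j by rewrite /vertex /=; case: j dij {lm ljn rij ltjn} => // j dij; rewrite (Dd dij) ?orbT.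
have r2 : vertex i j.+1 by rewrite /vertex /=; case: i dij {lm lin rij ltin r1} => // i dij; rewrite (Dd dij) ?orbT.
have r3 : vertex i.+1 j.+1 by rewrite /vertex /= dij.
apply: (part_above_cell (m := M i j) (x := h i j) (y := v i j)); first exact: clean'.
- by apply: part_above_eq (IH i.+1 j _ ltin ljn r1) => [r|]; [rewrite shape_right|lia].
- by apply: part_above_eq (IH i j.+1 _ lin ltjn r2) => [r|]; [rewrite shape_up|lia].
- by apply: part_above_eq (IH i.+1 j.+1 _ ltin ltjn r3) => [r|]; [rewrite shape_cell|lia].
Qed.

Lemma part_forward : (forall i, i < n -> h i 0 = None) -> (forall j, j < n -> v 0 j = None) ->
  forall i j, i <= n -> j <= n -> vertex i j -> is_part (shape_at i j).
Proof.
move=> h0 v0 i j; have [m] := ubnP (i + j).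
elim: m i j => // m IH [|i] [|j] lm lin ljn rij.
- by move=> r; rewrite !shape_origin.
- suff E q : shape_at 0 j.+1 q = 0 by move=> r; rewrite !E.
  rewrite /shape_at [X in X + _]big_geq // big_nat big1 // => j' /andP[_ lj].
  by rewrite v0 //; lia.
- suff E q : shape_at i.+1 0 q = 0 by move=> r; rewrite !E.
  rewrite /shape_at [X in _ + X]big_geq // big_nat big1 // => i' /andP[_ li].
  by rewrite h0 //; lia.
have dij : D i j by case/or3P: rij.
have ok0 : is_part (shape_at i j).
  apply: IH; [lia|exact: ltnW|exact: ltnW|].
  rewrite /vertex; case: i j dij {lm lin ljn rij} => [|i] [|j] //= dij.
  by rewrite (Dd dij).
have ok1 : is_part (shape_at i.+1 j).
  apply: IH; [lia|by []|exact: ltnW|].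
  by rewrite /vertex /=; case: j dij {lm ljn rij ok0} => // j dij; rewrite (Dd dij) ?orbT.
have ok2 : is_part (shape_at i j.+1).
  apply: IH; [lia|exact: ltnW|by []|].
  by rewrite /vertex /=; case: i dij {lm lin rij ok0 ok1} => // i dij; rewrite (Dd dij) ?orbT.
have ok1' : is_part (add_label (shape_at i j) (h i j)).
  by move=> q; have := ok1 q; rewrite !shape_right.
have ok2' : is_part (add_label (shape_at i j) (v i j)).
  by move=> q; have := ok2 q; rewrite !shape_up ?(ltnW lin).
have := part_cell (clean' lin ljn) ok0 ok1' ok2' => H r.
by rewrite !shape_cell //; apply: H.
Qed.

Lemma h_trans i j : i < n -> j <= n -> (forall j', j <= j' -> j' < n -> ~~ D i j') ->
  h i n = h i j.
Proof.
move=> lin ljn; have [m] := ubnP (n - j); elim: m j ljn => // m IH j ljn lm H.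
case: (ltngtP j n) ljn => // [ltjn _|-> //].
rewrite (IH j.+1) //; [|lia|by move=> j' lj; apply: H; apply: ltnW].
by rewrite lab_h // /local_rule H.
Qed.

Lemma v_trans i j : i <= n -> j < n -> (forall i', i <= i' -> i' < n -> ~~ D i' j) ->
  v n j = v i j.
Proof.
move=> lin ljn; have [m] := ubnP (n - i); elim: m i lin => // m IH i lin lm H.
case: (ltngtP i n) lin => // [ltin _|-> //].
rewrite (IH i.+1) //; [|lia|by move=> i' li; apply: H; apply: ltnW].
by rewrite lab_v // /local_rule H.
Qed.
End Labels.

(** One half of the boundary of a symmetric board, from the top left corner of
    the square down to the diagonal. *)
Fixpoint path t : nat * nat :=
  if t is t'.+1 then
    let: (i, j) := path t' in if D i j.-1 then (i.+1, j) else (i, j.-1)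
  else (0, n).
Definition path_x t := (path t).1.
Definition path_y t := (path t).2.
Definition goes_right t := D (path_x t) (path_y t).-1.
(** The column whose top edge is step [t], or else the row whose right edge it
    is. By symmetry this row stands for the column of the same index in the
    other half, so every column is met once. *)
Definition crossed t := if goes_right t then path_x t else (path_y t).-1.

Lemma path_xS t : path_x t.+1 = if goes_right t then (path_x t).+1 else path_x t.
Proof. by rewrite /goes_right /path_x /path_y /=; case: (path t) => i j /=; case: ifP. Qed.
Lemma path_yS t : path_y t.+1 = if goes_right t then path_y t else (path_y t).-1.
Proof. by rewrite /goes_right /path_x /path_y /=; case: (path t) => i j /=; case: ifP. Qed.

Lemma path_sum t : t <= n -> path_x t + n = path_y t + t /\ path_y t <= n.
Proof.
elim: t => [_|t IH ltn]; first by rewrite /path_x /path_y /=; lia.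
have [E le] := IH (ltnW ltn); rewrite path_xS path_yS; case: ifP => H; last lia.
by lia.
Qed.

Lemma path_lt t : t < n -> path_x t < path_y t.
Proof. by move=> ltn; have [] := path_sum (ltnW ltn); lia. Qed.

Lemma path_bd t : t <= n -> vertex (path_x t) (path_y t) && ~~ D (path_x t) (path_y t).
Proof.
elim: t => [_|t IH ltn].
  by rewrite /vertex /path_x /path_y /=; apply/negP => /Dn[]; rewrite ltnn.
have /andP[r d] := IH (ltnW ltn); have lt := path_lt ltn.
rewrite path_xS path_yS; case tyt: (goes_right t).
  move: tyt; rewrite /goes_right /vertex => ->; rewrite orbT /=.
  by apply: contra d => /Dd; apply.
rewrite -/(goes_right t) tyt andbT; move: r; rewrite /vertex.
case: (path_x t) => //= i; case: (path_y t) lt => //= j _ dij.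
by rewrite (Dd dij) ?orbT // leq_pred.
Qed.

(** A diagonal contains at most one boundary vertex, and the path crosses
    every diagonal up to the main one. *)
Lemma path_all i j : i <= j -> j <= n -> vertex i j -> ~~ D i j ->
  exists2 t, t <= n & (path_x t = i /\ path_y t = j).
Proof.
move=> ij jn r d; have [t tE] : exists t, t + j = n + i.
  by exists (n - (j - i)); lia.
have tn : t <= n by lia.
exists t => //; have [E _] := path_sum tn; have /andP[r' d'] := path_bd tn.
suff : path_x t = i by lia.
case: (ltngtP (path_x t) i) => // lt.
- have i0 : (i == 0) = false by lia.
  have j0 : (j == 0) = false by lia.
  move: r; rewrite /vertex i0 j0 /= => H; case/negP: d'.
  by apply: (Dd H); lia.
- have i0 : (path_x t == 0) = false by lia.
  have j0 : (path_y t == 0) = false by lia.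
  move: r'; rewrite /vertex i0 j0 /= => H; case/negP: d.
  by apply: (Dd H); lia.
Qed.

Hypothesis Ds : forall i j, D i j = D j i.

Lemma path_mono t t' : t <= t' -> path_x t <= path_x t' /\ path_y t' <= path_y t.
Proof.
move=> /subnK <-; elim: (t' - t) => [//|d [IH1 IH2]].
by rewrite addSn path_xS path_yS; case: ifP => _; lia.
Qed.

Lemma crossed_lt t : t < n -> crossed t < n.
Proof.
move=> tn; have := path_lt tn; have := path_sum (ltnW tn); rewrite /crossed; case: ifP; lia.
Qed.

Lemma crossed_side t : t < n -> if goes_right t then crossed t < path_x n else path_x n <= crossed t.
Proof.
move=> tn; have [E _] := path_sum (leqnn n).
have [] := path_mono tn; rewrite path_xS path_yS /crossed; have := path_lt tn.
by case: ifP => _; lia.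
Qed.

Lemma crossed_inj t t' : t < n -> t' < n -> crossed t = crossed t' -> t = t'.
Proof.
wlog le : t t' / t <= t'.
  by move=> W tn t'n; case: (leqP t t') => [|/ltnW] H E; [|symmetry]; apply: W.
move=> tn t'n E; case: (ltngtP t t') le => // lt _; exfalso.
have [] := path_mono lt; rewrite path_xS path_yS; have := path_lt tn; have := path_lt t'n.
have := crossed_side tn; have := crossed_side t'n; rewrite E.
have [EE _] := path_sum (leqnn n).
move: E; rewrite /crossed; case: ifP => _; case: ifP => _; lia.
Qed.

Lemma crossed_perm : perm_eq [seq crossed t | t <- iota 0 n] (iota 0 n).
Proof.
have u : uniq [seq crossed t | t <- iota 0 n].
  rewrite map_inj_in_uniq ?iota_uniq // => x y; rewrite !mem_iota /=.
  exact: crossed_inj.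
apply: uniq_perm; rewrite ?iota_uniq //.
apply: (uniq_min_size u _ _).2; last by rewrite size_map.
by move=> x /mapP[t]; rewrite !mem_iota /= => tn ->; apply: crossed_lt.
Qed.

Lemma crossed_surj c : c < n -> exists2 t, t < n & crossed t = c.
Proof.
move=> cn; have := perm_mem crossed_perm c; rewrite mem_iota /= cn => /mapP[t].
by rewrite mem_iota /= => tn ->; exists t.
Qed.

(** The boundary of a symmetric board turns at the diagonal, so that two
    columns of equal height never lie on different sides of it. *)
Lemma crossed_adjacent c : c.+1 < n -> (forall j, D c j = D c.+1 j) ->
  exists2 t, t.+1 < n & goes_right t.+1 = goes_right t /\
    if goes_right t then crossed t = c /\ crossed t.+1 = c.+1 else crossed t = c.+1 /\ crossed t.+1 = c.
Proof.
move=> cn H; have [t tn Et] := crossed_surj (ltnW cn).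
have lt := path_lt tn; have [Es _] := path_sum (ltnW tn).
have /andP[r d] := path_bd (ltnW tn).
case tyt: (goes_right t).
  have Ec : path_x t = c by rewrite -Et /crossed tyt.
  have d1 : D (path_x t) (path_y t).-1 by [].
  have lt2 : t.+1 < n.
    case: (ltngtP t.+1 n) => // [|E]; first lia.
    have EJ : path_y t = c.+1 by lia.
    by case/negP: d; move: d1; rewrite EJ Ec /= [D c c.+1]Ds -H.
  exists t => //; rewrite tyt; have tyt1 : goes_right t.+1.
    by rewrite /goes_right path_xS path_yS tyt Ec -H -Ec.
  by rewrite tyt1 /crossed tyt tyt1 path_xS tyt Ec.
have [t' tn' Et'] := crossed_surj cn.
have lt' := path_lt tn'; have [Es' _] := path_sum (ltnW tn').
have /andP[r' d'] := path_bd (ltnW tn').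
have tyt' : goes_right t' = false.
  apply/negP => tyt'; have := crossed_side tn'; have := crossed_side tn; rewrite tyt tyt' Et Et'; lia.
have EJ : path_y t' = c.+2 by move: Et'; rewrite /crossed tyt'; lia.
have lt2 : t'.+1 < n.
  case: (ltngtP t'.+1 n) => // [|E]; first lia.
  have EI : path_x t' = c.+1 by lia.
  have : goes_right t' by rewrite /goes_right EI EJ /= -H Ds; move: r'; rewrite /vertex EI EJ /= Ds -H.
  by rewrite tyt'.
exists t' => //; rewrite tyt'; have tyt1 : goes_right t'.+1 = false.
  by rewrite /goes_right path_xS path_yS tyt' EJ /= Ds H -Ds; move: tyt'; rewrite /goes_right EJ.
by rewrite tyt1 /crossed tyt' tyt1 path_yS tyt' EJ.
Qed.
End Board.

(** * Boundary words *)

Lemma isSome_local_rule (d m : bool) (x y : option nat) : (m -> d) ->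
  isSome (local_rule d m x y).1 = m || isSome x /\ isSome (local_rule d m x y).2 = m || isSome y.
Proof.
rewrite /local_rule; case: m => [-> //|_] /=; case: d => //=.
by case: x => [r|] //=; case: eqP => [->|].
Qed.

Section Walk.
Variables (n : nat) (D : nat -> nat -> bool).
Hypothesis Dn : forall i j, D i j -> i < n /\ j < n.
Hypothesis Dd : forall i j i' j', D i j -> i' <= i -> j' <= j -> D i' j'.
Hypothesis Ds : forall i j, D i j = D j i.
Variables (wh cut : nat -> bool).

Notation path_x := (path_x n D).
Notation path_y := (path_y n D).
Notation goes_right := (goes_right n D).
Notation crossed := (crossed n D).

Definition step_kind t := if wh (crossed t) then Some (goes_right t) else None.
(** [cut c] separates the columns [c.-1] and [c]. *)
Definition step_linked t := if t is t'.+1 then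
  [&& goes_right t' == goes_right t, wh (crossed t'), wh (crossed t) & ~~ cut (maxn (crossed t') (crossed t))]
  else false.
Definition steps t m : seq step := [seq (step_kind u, step_linked u) | u <- iota t m].
Definition path_word (b : nat -> option nat) t m := [seq odflt 0 (b (crossed u)) | u <- iota t m].

Lemma steps_wf t m : links_ok (steps t m).
Proof.
elim: m t => [//|[//|m] IH] t.
rewrite -[links_ok _]/(_ && links_ok (steps t.+1 m.+1)) IH andbT /=.
apply/implyP => /and4P[/eqP E w1 w2 _].
by rewrite /step_kind w1 w2 E eqxx.
Qed.

Section Diag.
Variables (M : nat -> nat -> bool) (h v : nat -> nat -> option nat).
Hypothesis lab : forall i j, i < n -> j < n ->
  (h i j.+1, v i.+1 j) = local_rule (D i j) (M i j) (h i j) (v i j).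
Hypothesis clean : forall i j, i < n -> j < n -> M i j ->
  [/\ D i j, h i j = None & v i j = None].
Hypothesis sym : forall i j, i < n -> j <= n -> h i j = v j i.
Notation Sh := (shape_at h v).
Variable b : nat -> option nat.
Hypothesis h_top : forall i, i < n -> h i n = b i.
Hypothesis bw : forall i, i < n -> isSome (b i) = wh i.

Lemma shape_path t r : t < n ->
  if goes_right t then Sh (path_x t.+1) (path_y t.+1) r = Sh (path_x t) (path_y t) r + (b (crossed t) == Some r)
  else Sh (path_x t) (path_y t) r = Sh (path_x t.+1) (path_y t.+1) r + (b (crossed t) == Some r).
Proof.
move=> tn; have lt := path_lt D tn; have [Es le] := path_sum D (ltnW tn).
have /andP[_ d] := path_bd Dn Dd (ltnW tn).
have pen := crossed_lt D tn; move: pen; rewrite path_xS path_yS /crossed; case: ifP => tyt pen.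
  rewrite shape_right -h_top // (@h_trans n D M h v lab _ (path_y t)) // => j' lj _.
  by apply: contra d => /Dd; apply.
rewrite -[in LHS](ltn_predK lt) (shape_up lab clean); [|lia|lia].
rewrite -h_top // sym // (@v_trans n D M h v lab (path_x t)) //; first lia.
by move=> i' li _; apply: contraFN tyt => /Dd; rewrite /goes_right; apply.
Qed.

Definition step_allowed (q : rel nat) u :=
  wh (crossed u) ==> goes_right u ==> let r := odflt 0 (b (crossed u)) in q r (Sh (path_x u) (path_y u) r).

Lemma valid_fwd q t m : (forall u, u <= n -> is_part (Sh (path_x u) (path_y u))) -> t + m = n ->
  valid q (Sh (path_x t) (path_y t)) (steps t m) (path_word b t m) = all (step_allowed q) (iota t m).
Proof.
move=> pT; elim: m t => [//|m IH] t tm.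
have tn : t < n by lia.
rewrite -[RHS]/(step_allowed q t && all (step_allowed q) (iota t.+1 m)) -IH; last by lia.
rewrite -[LHS]/(step_ok q (step_kind t) _ _ && valid q (step_shape (step_kind t) _ _) (steps t.+1 m) (path_word b t.+1 m)).
have pt := pT _ (ltnW tn); have pt1 := pT _ tn.
have := bw (crossed_lt D tn); rewrite /step_allowed /step_kind.
have := shape_path _ tn; case E: (b (crossed t)) => [r|] /= H <- /=; last first.
  congr (valid _ _ _ _); apply: functional_extensionality => x.
  by move: (H x); case: (goes_right t); rewrite addn0.
case tyt: (goes_right t) H => H /=.
  have Ei : add_box (Sh (path_x t) (path_y t)) r = Sh (path_x t.+1) (path_y t.+1).
    by apply: functional_extensionality => x; rewrite H /add_box Some_eq eq_sym.
  rewrite Ei; congr (_ && _); rewrite andb_idl // => _.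
  by apply/can_addP => //; rewrite Ei.
have Ei : remove_box (Sh (path_x t) (path_y t)) r = Sh (path_x t.+1) (path_y t.+1).
  apply: functional_extensionality => x; rewrite /remove_box H Some_eq (eq_sym x).
  by rewrite addnK.
rewrite Ei andb_idl // => _; apply/can_removeP => //; rewrite Ei; split=> //.
by rewrite H eqxx addn1.
Qed.

Lemma valid_back q E (l : nat -> nat) t m : t + m = n -> is_part l ->
  (forall r, l r + E r = Sh (path_x t) (path_y t) r) ->
  valid q l (steps t m) (path_word b t m) ->
  forall u, t <= u <= n -> part_above E (Sh (path_x u) (path_y u)).
Proof.
elim: m t l => [|m IH] t l tm pl El V u /andP[tu un].
  have -> : u = t by lia.
  by move=> r; rewrite -!El; split; [lia|have := pl r; lia].
case: (ltngtP t u) tu => // [tu _|<- _]; last first.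
  by move=> r; rewrite -!El; split; [lia|have := pl r; lia].
have tn : t < n by lia.
move: V; rewrite -[valid _ _ _ _]/(step_ok q (step_kind t) _ _ && valid q (step_shape (step_kind t) _ _) (steps t.+1 m) (path_word b t.+1 m)).
case/andP=> ok V; have ps := step_shape_part pl ok.
apply: (IH t.+1 _ _ ps _ V); [lia| |lia] => r.
have := shape_path r tn; have := bw (crossed_lt D tn); move: ok; rewrite /step_kind.
case Eb: (b (crossed t)) => [s|] ok <- /=; last by rewrite El; case: (goes_right t); rewrite ?addn0.
move: ok; rewrite -(bw (crossed_lt D tn)) Eb /=; case tyt: (goes_right t) => /= ok H.
  by rewrite H -El /add_box Some_eq (eq_sym s); lia.
have [l_gt0 _] := (can_removeP s pl).1 ok.
move: H; rewrite -El /remove_box Some_eq (eq_sym s).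
by case: (eqVneq r s) => [->|_]; lia.
Qed.

Lemma step_allowed_row K : Sh (path_x 0) (path_y 0) K = 0 ->
  reflect (forall u, u <= n -> Sh (path_x u) (path_y u) K = 0)
          (all (step_allowed (fun r _ => r != K)) (iota 0 n)).
Proof.
move=> T0; apply: (iffP allP) => [H|H u].
  elim=> [//|u IH un]; have := shape_path K un; have Tu := IH (ltnW un).
  case tyu: (goes_right u) => E; last by move: E; rewrite Tu; lia.
  have /(_ u) := H; rewrite mem_iota /= un /step_allowed tyu => /(_ isT).
  rewrite -bw ?(crossed_lt D) // E Tu; case: (b (crossed u)) => //= r.
  by rewrite Some_eq => /negPf ->.
rewrite mem_iota /= => un; rewrite /step_allowed; apply/implyP => w; apply/implyP => tyu.
have := shape_path K un; rewrite tyu !H ?(ltnW un) // add0n.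
move: w; rewrite -bw ?(crossed_lt D) //; case: (b (crossed u)) => //= r _.
by rewrite Some_eq; case: eqP.
Qed.

Lemma step_allowed_col K : (forall u, u <= n -> is_part (Sh (path_x u) (path_y u))) ->
  Sh (path_x 0) (path_y 0) 0 = 0 ->
  reflect (forall u, u <= n -> Sh (path_x u) (path_y u) 0 <= K)
          (all (step_allowed (fun _ c => c != K)) (iota 0 n)).
Proof.
move=> pT T0; apply: (iffP allP) => [H|H u].
  elim=> [|u IH un]; first by rewrite T0.
  have := shape_path 0 un; have Tu := IH (ltnW un).
  case tyu: (goes_right u) => E; last by lia.
  have /(_ u) := H; rewrite mem_iota /= un /step_allowed tyu => /(_ isT).
  rewrite -bw ?(crossed_lt D) // E; case: (b (crossed u)) => [r|] //=; last by rewrite addn0.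
  by rewrite Some_eq; case: (eqVneq r 0) => [->|_] /= ?; lia.
rewrite mem_iota /= => un; rewrite /step_allowed; apply/implyP => w; apply/implyP => tyu.
move: w; rewrite -bw ?(crossed_lt D) //; case Eb: (b (crossed u)) => [r|] //= _.
have := shape_path r un; rewrite tyu Eb eqxx => E.
have := part_le (pT _ un) (leq0n r); have := H _ un; rewrite E.
by move=> ? ?; apply/eqP; lia.
Qed.

Lemma shape_sym i j r : i <= n -> j <= n -> Sh i j r = Sh j i r.
Proof.
move=> lin ljn; have col k : k <= n ->
    Sh i k r = Sh i 0 r + \sum_(0 <= j' < k) (v i j' == Some r).
  elim: k => [_|k IH ltk]; first by rewrite big_geq // addn0.
  by rewrite (shape_up lab clean) // IH ?(ltnW ltk) // big_nat_recr //= addnA.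
rewrite col // /shape_at [X in _ + X + _]big_geq // addn0 addnC; congr (_ + _); rewrite !big_nat.
  by apply: eq_bigr => j' /andP[_ lj]; rewrite -sym //; apply: leq_trans lj ljn.
by apply: eq_bigr => i' /andP[_ li]; rewrite sym //; apply: leq_trans li lin.
Qed.

(** The other half of the boundary is the reflection of the path. *)
Lemma bd_half E : (forall u, u <= n -> part_above E (Sh (path_x u) (path_y u))) ->
  forall i j, i <= n -> j <= n -> vertex D i j -> ~~ D i j -> part_above E (Sh i j).
Proof.
move=> H i j; wlog ij : i j / i <= j.
  move=> W lin ljn rij dij; case: (leqP i j) => [|/ltnW] ij; first exact: W.
  have : part_above E (Sh j i).
    by apply: W => //; [move: rij; rewrite /vertex orbCA Ds|rewrite Ds].
  by apply: part_above_eq => r; apply: shape_sym.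
move=> lin ljn rij dij; have [t tn [<- <-]] := path_all Dn Dd ij ljn rij dij.
exact: H.
Qed.
End Diag.
End Walk.

(** * Fillings of a board *)

Section Fill.
Variables (n : nat) (D : nat -> nat -> bool).
Hypothesis Dn : forall i j, D i j -> i < n /\ j < n.
Hypothesis Dd : forall i j i' j', D i j -> i' <= i -> j' <= j -> D i' j'.
Hypothesis Ds : forall i j, D i j = D j i.
Variables (wh cut : nat -> bool).

Definition involution_on (p : nat -> nat) := forall i, i < n -> p i < n /\ p (p i) = i.
Definition fills (p : nat -> nat) := involution_on p /\ forall i, i < n -> D i (p i) = wh i.

Definition dot (p : nat -> nat) i j := D i j && (p i == j).

Lemma involution_on_inj p i j : involution_on p -> i < n -> j < n -> p i = p j -> i = j.
Proof. by move=> ip lin ljn E; rewrite -(ip i lin).2 E (ip j ljn).2. Qed.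

Lemma dot_sym p i j : involution_on p -> i < n -> j < n -> dot p i j = dot p j i.
Proof.
move=> ip lin ljn; rewrite /dot Ds; congr (_ && _).
by apply/eqP/eqP => <-; [apply: (ip i lin).2|apply: (ip j ljn).2].
Qed.

Definition fill_loc p i j := local_rule (D i j) (dot p i j).
Definition hlabel p i j : option nat := grid_h (fill_loc p) (fun=> None) (fun=> None) i j.
Definition vlabel p i j : option nat := grid_v (fill_loc p) (fun=> None) (fun=> None) i j.
Definition top_label p i := hlabel p i n.
Arguments hlabel : simpl never.
Arguments vlabel : simpl never.

Lemma label_rule p i j : (hlabel p i j.+1, vlabel p i.+1 j) = local_rule (D i j) (dot p i j) (hlabel p i j) (vlabel p i j).
Proof. exact: gridE. Qed.

Lemma hlabel_bound p i j r : hlabel p i j = Some r -> r < j.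
Proof.
elim: j r => [//|j IH] r.
have -> : hlabel p i j.+1 = (local_rule (D i j) (dot p i j) (hlabel p i j) (vlabel p i j)).1.
  by rewrite -label_rule.
rewrite /local_rule; case: (D i j) => /=; last by move/IH/leqW.
case: (dot p i j) => /=; first by case=> <-.
case E: (hlabel p i j) => [x|] //=; have lt := IH _ E.
by case: eqP => _ /= [<-]; [|exact: leqW].
Qed.

Lemma dotD p i j : dot p i j -> D i j. Proof. by case/andP. Qed.

Lemma hlabel_some p i j : isSome (hlabel p i j) = has (dot p i) (iota 0 j).
Proof.
elim: j => [//|j IH]; rewrite -[j.+1]addn1 iotaD has_cat -IH /= orbF addn1.
have [E _] := isSome_local_rule (hlabel p i j) (vlabel p i j) (@dotD p i j).
by move: E; rewrite -label_rule /= orbC.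
Qed.

Lemma vlabel_some p i j : isSome (vlabel p i j) = has (fun i' => dot p i' j) (iota 0 i).
Proof.
elim: i => [//|i IH]; rewrite -[i.+1]addn1 iotaD has_cat -IH /= orbF addn1.
have [_ E] := isSome_local_rule (hlabel p i j) (vlabel p i j) (@dotD p i j).
by move: E; rewrite -label_rule /= orbC.
Qed.

(** Labels start at the dot of their row or column, and there is only one dot
    in each. *)
Lemma label_clean p : involution_on p -> forall i j, i < n -> j < n -> dot p i j ->
  [/\ D i j, hlabel p i j = None & vlabel p i j = None].
Proof.
move=> ip i j lin ljn /andP[dij /eqP pij]; split=> //.
  case E: (hlabel p i j) => [r|] //; have := hlabel_some p i j; rewrite E /=.
  case/esym/hasP => j'; rewrite mem_iota /= => lj /andP[_ /eqP pij'].
  by move: lj; rewrite -pij' pij ltnn.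
case E: (vlabel p i j) => [r|] //; have := vlabel_some p i j; rewrite E /=.
case/esym/hasP => i'; rewrite mem_iota /= => li /andP[_ /eqP pij'].
by have := involution_on_inj ip (ltn_trans li lin) lin (etrans pij' (esym pij)); lia.
Qed.

Lemma label_sym p : involution_on p -> forall i j, i < n -> j <= n -> hlabel p i j = vlabel p j i.
Proof.
move=> ip; apply: (proj1 (@grid_uniq _ _ (fill_loc p) n (hlabel p) (fun i j => vlabel p j i)
   (vlabel p) (fun i j => hlabel p j i) _ _ _ _)) => // i j lin ljn; first exact: label_rule.
by rewrite /fill_loc local_rule_swap Ds (dot_sym ip) // -label_rule.
Qed.

Lemma top_label_white p : fills p -> forall i, i < n -> isSome (top_label p i) = wh i.
Proof.
move=> [ip fp] i lin; rewrite /top_label hlabel_some -fp //; apply/hasP/idP => [[j _]|d].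
  by case/andP=> d /eqP ->.
by exists (p i); rewrite ?mem_iota /= ?(ip i lin).1 // /dot d eqxx.
Qed.

Notation Tp p := (shape_at (hlabel p) (vlabel p)).
Notation path_x := (path_x n D).
Notation path_y := (path_y n D).

Lemma fill_part p : involution_on p -> forall i j, i <= n -> j <= n -> vertex D i j -> is_part (Tp p i j).
Proof. by move=> ip; apply: (part_forward Dd (fun i j _ _ => label_rule p i j) (label_clean ip)). Qed.

Lemma fill_part_path p : involution_on p -> forall u, u <= n -> is_part (Tp p (path_x u) (path_y u)).
Proof.
move=> ip u un; have /andP[r _] := path_bd Dn Dd un.
have [E le] := path_sum D un; apply: fill_part => //; lia.
Qed.

Lemma fill_shape0 p r : Tp p (path_x 0) (path_y 0) r = 0.
Proof. by rewrite /shape_at big_geq // big1. Qed.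

Lemma fill_valid q p : fills p ->
  valid q empty_shape (steps n D wh cut 0 n) (path_word n D (top_label p) 0 n) =
  all (step_allowed n D wh (hlabel p) (vlabel p) (top_label p) q) (iota 0 n).
Proof.
move=> fp; have ip := fp.1.
rewrite -(valid_fwd Dn Dd cut (fun i j _ _ => label_rule p i j) (label_clean ip) (label_sym ip)
  (fun i _ => erefl) (top_label_white fp) q (fill_part_path ip)) //.
by congr valid; apply: functional_extensionality => r; rewrite fill_shape0.
Qed.

Lemma fill_row K p : fills p ->
  reflect (forall u, u <= n -> Tp p (path_x u) (path_y u) K = 0)
    (valid (fun r _ => r != K) empty_shape (steps n D wh cut 0 n) (path_word n D (top_label p) 0 n)).
Proof.
move=> fp; have ip := fp.1; rewrite fill_valid //.
by apply: (step_allowed_row Dn Dd (fun i j _ _ => label_rule p i j) (label_clean ip) (label_sym ip)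
  (fun i _ => erefl) (top_label_white fp)); apply: fill_shape0.
Qed.

Lemma fill_col K p : fills p ->
  reflect (forall u, u <= n -> Tp p (path_x u) (path_y u) 0 <= K)
    (valid (fun _ c => c != K) empty_shape (steps n D wh cut 0 n) (path_word n D (top_label p) 0 n)).
Proof.
move=> fp; have ip := fp.1; rewrite fill_valid //.
apply: (step_allowed_col Dn Dd (fun i j _ _ => label_rule p i j) (label_clean ip) (label_sym ip)
  (fun i _ => erefl) (top_label_white fp)); last exact: fill_shape0.
exact: fill_part_path.
Qed.

Section Back.
Variable b : nat -> option nat.
(** The diagram is rebuilt from the top right corner of the square, whence the
    reversed indices. *)
Definition back_loc a c x y := (inverse_rule (D (n.-1 - a) (n.-1 - c)) x y).2.
Definition back_grid_h := grid_h back_loc (fun a => b (n.-1 - a)) (fun c => b (n.-1 - c)).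
Definition back_grid_v := grid_v back_loc (fun a => b (n.-1 - a)) (fun c => b (n.-1 - c)).
Definition back_h i j := back_grid_h (n.-1 - i) (n - j).
Definition back_v i j := back_grid_v (n - i) (n.-1 - j).
Definition back_dot i j := (inverse_rule (D i j) (back_h i j.+1) (back_v i.+1 j)).1.

Lemma back_inverse_rule i j : i < n -> j < n ->
  inverse_rule (D i j) (back_h i j.+1) (back_v i.+1 j) = (back_dot i j, (back_h i j, back_v i j)).
Proof.
move=> lin ljn; rewrite /back_dot; set r := inverse_rule _ _ _.
suff -> : (back_h i j, back_v i j) = r.2 by case: r.
have Ei : n - i = (n.-1 - i).+1 by lia.
have Ej : n - j = (n.-1 - j).+1 by lia.
rewrite /back_h /back_v Ei Ej /back_grid_h /back_grid_v gridE /back_loc /r.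
by congr ((inverse_rule (D _ _) _ _).2); rewrite /back_h /back_v; try congr (grid_h _ _ _ _ _); try congr (grid_v _ _ _ _ _); lia.
Qed.

Lemma back_lab i j : i < n -> j < n ->
  (back_h i j.+1, back_v i.+1 j) = local_rule (D i j) (back_dot i j) (back_h i j) (back_v i j).
Proof.
move=> lin ljn; have /= := inverse_ruleK (D i j) (back_h i j.+1) (back_v i.+1 j).
by rewrite back_inverse_rule.
Qed.

Lemma back_clean i j : i < n -> j < n -> back_dot i j ->
  [/\ D i j, back_h i j = None & back_v i j = None].
Proof.
move=> lin ljn m; have := @inverse_rule_dot (D i j) (back_h i j.+1) (back_v i.+1 j).
by rewrite back_inverse_rule // => /(_ m).
Qed.

Lemma back_h_top i : i < n -> back_h i n = b i.
Proof. by move=> lin; rewrite /back_h subnn /back_grid_h /grid_h /=; congr b; lia. Qed.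

Lemma back_sym i j : i < n -> j <= n -> back_h i j = back_v j i.
Proof.
move=> lin ljn; rewrite /back_h /back_v.
apply: (proj1 (@grid_uniq _ _ back_loc n back_grid_h (fun i j => back_grid_v j i)
   back_grid_v (fun i j => back_grid_h j i) _ _ _ _)) => //; try lia.
  by move=> a c _ _; exact: gridE.
move=> a c _ _; rewrite /= (_ : (back_grid_v c.+1 a, back_grid_h c a.+1) = ((back_grid_h c a.+1, back_grid_v c.+1 a).2, (back_grid_h c a.+1, back_grid_v c.+1 a).1)) //.
by rewrite /back_grid_h /back_grid_v gridE /back_loc Ds [in RHS]inverse_rule_swap.
Qed.

Lemma back_dot_sym i j : i < n -> j < n -> back_dot i j = back_dot j i.
Proof.
by move=> lin ljn; rewrite /back_dot inverse_rule_swap Ds -back_sym ?(ltnW ljn) // -back_sym ?(ltnW lin).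
Qed.
End Back.

(** The inverse rule recovers all labels and dots from the labels on the
    boundary. *)
Lemma fill_inj p p' : fills p -> fills p' ->
  (forall i, i < n -> top_label p i = top_label p' i) -> forall i, i < n -> wh i -> p i = p' i.
Proof.
move=> fp fp' Eb.
have back q : fills q -> forall i j, i < n -> j < n ->
  inverse_rule (D i j) (hlabel q i j.+1) (vlabel q i.+1 j) = (dot q i j, (hlabel q i j, vlabel q i j)).
  move=> fq i j lin ljn.
  have /= := local_ruleK (label_clean fq.1 lin ljn); by rewrite -label_rule.
pose H q a c := hlabel q (n.-1 - a) (n - c).
pose V q a c := vlabel q (n - a) (n.-1 - c).
have E q : fills q -> forall a c, a < n -> c < n ->
    (H q a c.+1, V q a.+1 c) = back_loc a c (H q a c) (V q a c).
  move=> fq a c lan lcn; rewrite /H /V /back_loc.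
  have Ea : n - a = (n.-1 - a).+1 by lia.
  have Ec : n - c = (n.-1 - c).+1 by lia.
  rewrite Ea Ec back //; [|lia|lia].
  by rewrite /=; congr (hlabel _ _ _, vlabel _ _ _); lia.
have H0 a : a < n -> H p a 0 = H p' a 0.
  by move=> lan; rewrite /H subn0; apply: Eb; lia.
have V0 c : c < n -> V p 0 c = V p' 0 c.
  move=> lcn; have lt : n.-1 - c < n by lia.
  by rewrite /V subn0 -(label_sym fp.1 lt (leqnn n)) -(label_sym fp'.1 lt (leqnn n)); apply: Eb.
have [EH EV] := grid_uniq H0 V0 (E p fp) (E p' fp').
move=> i lin wi; have [ljn _] := fp.1 i lin; set j := p i in ljn.
have ei : n.-1 - (n.-1 - i) = i by lia.
have ej : n.-1 - (n.-1 - j) = j by lia.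
have ei' : n - (n.-1 - i) = i.+1 by lia.
have ej' : n - (n.-1 - j) = j.+1 by lia.
have li : n.-1 - i < n by lia.
have lj : n.-1 - j < n by lia.
have Eh : hlabel p i j.+1 = hlabel p' i j.+1.
  by have := EH _ _ li (ltnW lj); rewrite /H ei ej'.
have Ev : vlabel p i.+1 j = vlabel p' i.+1 j.
  by have := EV _ _ (ltnW li) lj; rewrite /V ei' ej.
have := back p fp i j lin ljn; rewrite Eh Ev back // => -[E' _].
have : dot p i j by rewrite /dot eqxx andbT fp.2.
by rewrite -E' => /andP[_ /eqP].
Qed.

(** The inverse rule yields labels whose shapes exceed the content [E] of the
    left side by partitions. The shape at the origin is zero, hence [E] is
    zero, and every labelled column starts at a dot. *)
Lemma fill_surj q p0 w : fills p0 -> size w = n ->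
  valid q empty_shape (steps n D wh cut 0 n) w ->
  exists p, [/\ fills p, forall i, ~~ wh i -> p i = p0 i
               & path_word n D (top_label p) 0 n = w].
Proof.
move=> [ip0 fp0] sw V.
pose es := [seq crossed n D t | t <- iota 0 n].
(* The labels that the letters of [w] prescribe on the boundary. *)
pose b c := if wh c then Some (nth 0 w (index c es)) else None.
have bw i : i < n -> isSome (b i) = wh i by rewrite /b; case: (wh i).
have bpe t : t < n -> b (crossed n D t) = if wh (crossed n D t) then Some (nth 0 w t) else None.
  move=> tn; rewrite /b; case: (wh _) => //.
  have -> : crossed n D t = nth 0 es t by rewrite (nth_map 0) ?size_iota // nth_iota.
  rewrite index_uniq ?size_map ?size_iota //.
  by rewrite (perm_uniq (crossed_perm n D)) iota_uniq.
have Ew : path_word n D b 0 n = w.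
  have bit t m u : size u = m -> (forall k, k < m -> nth 0 u k = nth 0 w (t + k)) ->
      t + m = n -> forall l, valid q l (steps n D wh cut t m) u -> path_word n D b t m = u.
    elim: m t u => [|m IH] t [|x u] // [su] Hu tm l.
    rewrite -[valid _ _ _ _]/(step_ok q (step_kind n D wh t) l x && _) => /andP[ok V'].
    rewrite -[path_word _ _ _ _ _]/(_ :: path_word n D b t.+1 m) (IH t.+1 u su _ _ _ V'); [|..|lia].
      congr (_ :: _); rewrite bpe; last lia.
      have /= := Hu 0; rewrite addn0 => <- //; move: ok; rewrite /step_kind.
      by case: (wh _) => //= /eqP ->.
    by move=> k km; have := Hu k.+1; rewrite addnS => /= ->.
  by apply: (bit 0 n w sw _ _ empty_shape).
have Vw : valid q empty_shape (steps n D wh cut 0 n) (path_word n D b 0 n) by rewrite Ew.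
pose E := shape_at (back_h b) (back_v b) 0 n.
have lab i j (lin : i < n) (ljn : j < n) := back_lab b lin ljn.
have clean i j (lin : i < n) (ljn : j < n) := @back_clean b i j lin ljn.
have sym i j (lin : i < n) (ljn : j <= n) := back_sym b lin ljn.
have okp : forall u, u <= n -> part_above E (shape_at (back_h b) (back_v b) (path_x u) (path_y u)).
  move=> u un; apply: (valid_back Dn Dd lab clean sym (back_h_top b) bw _ _ _ Vw) => //.
have okr := part_above_back Dn Dd lab clean (bd_half Dn Dd Ds lab clean sym okp).
have E0 r : E r = 0.
  by have := (okr 0 0 (leq0n _) (leq0n _) isT r).1; rewrite shape_origin; lia.
have v0 j : j < n -> back_v b 0 j = None.
  move=> ljn; case Ev: (back_v b 0 j) => [r|] //; have := E0 r; rewrite /E /shape_at big_geq // add0n.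
  by rewrite (bigD1_seq j) ?iota_uniq ?mem_index_iota //= Ev eqxx.
have h0 i : i < n -> back_h b i 0 = None by move=> lin; rewrite back_sym ?v0.
have hs i j : i < n -> j <= n -> isSome (back_h b i j) = has (back_dot b i) (iota 0 j).
  move=> lin; elim: j => [_|j IH ljn]; first by rewrite h0.
  rewrite -[j.+1]addn1 iotaD has_cat -IH ?(ltnW ljn) //= orbF addn1.
  have cl : back_dot b i j -> D i j by case/(clean _ _ lin ljn).
  have [Ex _] := isSome_local_rule (back_h b i j) (back_v b i j) cl.
  by move: Ex; rewrite -lab //= orbC.
have uniq i j j' : i < n -> j < n -> j' < n -> back_dot b i j -> back_dot b i j' -> j = j'.
  move=> lin; wlog lt : j j' / j <= j'.
    by move=> W ljn ljn' m m'; case: (leqP j j') => [|/ltnW] l; [|symmetry]; apply: W.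
  move=> ljn ljn' m m'; case: (ltngtP j j') lt => // lt _.
  have [_ hN _] := clean _ _ lin ljn' m'.
  have := hs i j' lin (ltnW ljn'); rewrite hN => /esym/hasP; case.
  by exists j; rewrite ?mem_iota.
pose p i := if wh i then find (back_dot b i) (iota 0 n) else p0 i.
have pM i : i < n -> wh i -> p i < n /\ back_dot b i (p i).
  move=> lin wi; have := hs i n lin (leqnn n); rewrite back_h_top // bw // wi => hi.
  have lt : find (back_dot b i) (iota 0 n) < n by rewrite -[X in _ < X](size_iota 0 n) -has_find -hi.
  rewrite /p wi; split=> //; have := nth_find 0 (esym hi).
  by rewrite nth_iota.
have Mw i j : i < n -> j < n -> back_dot b i j -> wh i.
  move=> lin ljn m; rewrite -bw // -back_h_top // hs //.
  by apply/hasP; exists j; rewrite ?mem_iota.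
have wp0 i : i < n -> wh (p0 i) = wh i.
  by move=> lin; have [l E'] := ip0 i lin; rewrite -(fp0 (p0 i)) // E' Ds fp0.
have ip : involution_on p.
  move=> i lin; case wi: (wh i); last first.
    by have [l E'] := ip0 i lin; rewrite /p wi wp0 // wi.
  have [ljn m] := pM i lin wi; split=> //.
  have m' : back_dot b (p i) i by rewrite -back_dot_sym.
  have [l m2] := pM _ ljn (Mw _ _ ljn lin m').
  exact: (uniq (p i)).
have fp : fills p.
  split=> // i lin; case wi: (wh i); last by rewrite /p wi fp0.
  by have [ljn m] := pM i lin wi; have [-> _ _] := clean _ _ lin ljn m.
have Ed i j : i < n -> j < n -> dot p i j = back_dot b i j.
  move=> lin ljn; apply/idP/idP => [/andP[d /eqP E']|m].
    have wi : wh i by rewrite -fp.2 // E'.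
    by rewrite -E'; case: (pM i lin wi).
  have wi := Mw _ _ lin ljn m; have [l m'] := pM i lin wi.
  by rewrite /dot (uniq i (p i) j) // eqxx andbT; case: (clean _ _ lin ljn m).
exists p; split=> // [i /negPf wi|]; first by rewrite /p wi.
rewrite -Ew; apply/eq_in_map => t; rewrite mem_iota /= => tn; congr (odflt _ _).
have lab' i j : i < n -> j < n ->
    (back_h b i j.+1, back_v b i.+1 j) = fill_loc p i j (back_h b i j) (back_v b i j).
  by move=> lin ljn; rewrite lab // /fill_loc Ed.
have h0' i : i < n -> hlabel p i 0 = back_h b i 0 by move=> lin; rewrite h0.
have v0' j : j < n -> vlabel p 0 j = back_v b 0 j by move=> ljn; rewrite v0.
have [Eh _] := grid_uniq h0' v0' (fun i j _ _ => label_rule p i j) lab'.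
by rewrite /top_label Eh ?back_h_top ?crossed_lt.
Qed.
End Fill.

(** * Longest increasing label sequences *)

(** Missing labels and labels below [m] are skipped; the threshold makes the
    definition recursive. *)
Fixpoint longest_inc (y : seq (option nat)) (m : nat) : nat :=
  match y with
  | [::] => 0
  | None :: y' => longest_inc y' m
  | Some c :: y' => maxn (longest_inc y' m) (if m <= c then (longest_inc y' c.+1).+1 else 0)
  end.

(** Row insertion, seen on the rows of the entries larger than the inserted
    one: [x] is the row into which an entry is being inserted. *)
Fixpoint bump_labels (x : nat) (y : seq (option nat)) : seq (option nat) :=
  if y is o :: y' then
    if o == Some x then Some x.+1 :: bump_labels x.+1 y' else o :: bump_labels x y'
  else [::].

Lemma longest_inc_anti y m m' : m <= m' -> longest_inc y m' <= longest_inc y m.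
Proof.
move=> mm; elim: y => [//|[c|] y IH] //=.
by case: ifP => H1; case: ifP => H2; lia.
Qed.

Lemma longest_incS y m : longest_inc y m <= (longest_inc y m.+1).+1.
Proof.
elim: y => [//|[c|] y IH] //=.
case: (eqVneq m c) IH => [->|ne] IH; first by rewrite leqnn ltnn; lia.
by case: ifP => H1; case: ifP => H2; lia.
Qed.

(** Bumping may lengthen the subsequences above a threshold [m > x], but only
    if there is a subsequence starting from [x] that is longer by the number
    of rows in between. *)
Lemma longest_inc_bump y x :
  [/\ forall m, m <= x -> longest_inc (bump_labels x y) m = longest_inc y m,
      longest_inc y x <= longest_inc (bump_labels x y) x.+1 &
      forall m, x < m -> longest_inc y m <= longest_inc (bump_labels x y) m /\
        longest_inc (bump_labels x y) m + (m - x.+1) <= maxn (longest_inc y m + (m - x.+1)) (longest_inc y x)].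
Proof.
elim: y x => [|[c|] y IH] x /=; first by split=> // m _; lia.
  rewrite Some_eq; case: (eqVneq c x) => [->|cx] /=.
    have [A1 B1 C1] := IH x.+1.
    have EB : longest_inc (bump_labels x.+1 y) x.+2 = longest_inc y x.+1.
      have [c1 c2] := C1 _ (ltnSn x.+1); have := longest_inc_anti y (leqnSn x.+1); lia.
    have a1 := longest_incS y x; have a2 := longest_inc_anti y (leqnSn x).
    split=> [m mx||m mx].
    - by rewrite EB A1 ?mx ?(leqW mx).
    - by rewrite EB !leqnn A1 //; lia.
    - have -> : (m <= x) = false by lia.
      case: (ltngtP m x.+1) mx => // mx _; last by rewrite mx leqnn EB A1 //; lia.
      have [c1 c2] := C1 m mx; rewrite leqnn; lia.
  have [A1 B1 C1] := IH x; split=> [m mx||m mx].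
  - rewrite A1 //; case: (ltngtP c x) cx => // cx _.
      by rewrite A1.
    have [c1 c2] := C1 c.+1 (ltnW cx); have := longest_inc_anti y mx.
    by case: ifP; lia.
  - case: ifP => H1; case: ifP => H2; try lia.
    have [d1 d2] := C1 c.+1 (leqW H2); lia.
  - have [c1 c2] := C1 _ mx; case: ifP => mc; last lia.
    have xc : x < c.+1 by lia.
    have [d1 d2] := C1 _ xc; have -> : x <= c by lia.
    by lia.
by have [A1 B1 C1] := IH x; split.
Qed.

(** Here [y2] lists the rows of the entries larger than the inserted one. A
    decreasing chain behaves in the same way: one that consists of larger
    entries can be extended by the inserted one. *)
Lemma longest_inc_insert y1 y2 :
  longest_inc (y1 ++ Some 0 :: bump_labels 0 y2) 0 = maxn (longest_inc (y1 ++ None :: y2) 0) (longest_inc y2 0).+1.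
Proof.
set z := Some 0 :: bump_labels 0 y2; have [A1 B1 C1] := longest_inc_bump y2 0.
have base m : longest_inc y2 m <= longest_inc z m /\ longest_inc z m + m <= maxn (longest_inc y2 m + m) (longest_inc y2 0).+1.
  rewrite /z /=; case: m => [|m].
    by have := C1 1 isT; have := longest_inc_anti y2 (leq0n 1); rewrite (A1 0) //=; lia.
  by rewrite ltn0; have := C1 m.+1 isT; lia.
have up m : longest_inc (y1 ++ None :: y2) m <= longest_inc (y1 ++ z) m /\
    longest_inc (y1 ++ z) m + m <= maxn (longest_inc (y1 ++ None :: y2) m + m) (longest_inc y2 0).+1.
  elim: y1 m => [|[c|] y1 IH] m; [exact: base| |exact: IH].
  rewrite !cat_cons /=; have [a1 a2] := IH m; have [b1 b2] := IH c.+1.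
  by case: ifP; lia.
have low : (longest_inc y2 0).+1 <= longest_inc (y1 ++ z) 0.
  elim: y1 {up} => [|[c|] y1 IH] //=; last by lia.
  by rewrite /z /=; lia.
by have [a1 a2] := up 0; lia.
Qed.

Lemma longest_inc_label y m : 0 < longest_inc y m ->
  exists2 r, Some r \in y & m + longest_inc y m <= r.+1.
Proof.
elim: y m => [//|[c|] y IH] m /=; last first.
  by move=> /IH[r ry le]; exists r; rewrite ?inE ?ry.
case: (posnP (longest_inc y m)) => [E|pos _]; last first.
  case: (leqP m c) => mc; last first.
    by have [r ry le] := IH m pos; exists r; rewrite ?inE ?ry ?orbT //; lia.
  case: (posnP (longest_inc y c.+1)) => [E1|pos1].
    have [r ry le] := IH m pos; exists r; rewrite ?inE ?ry ?orbT //; rewrite E1; lia.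
  have [r1 ry1 le1] := IH _ pos1; have [r ry le] := IH _ pos.
  case: (leqP (longest_inc y m) (longest_inc y c.+1).+1) => ?.
    by exists r1; rewrite ?inE ?ry1 ?orbT //; lia.
  by exists r; rewrite ?inE ?ry ?orbT //; lia.
rewrite E; case: (leqP m c) => // mc _; case: (posnP (longest_inc y c.+1)) => [E1|pos1].
  by exists c; rewrite ?inE ?eqxx //; rewrite E1; lia.
by have [r1 ry1 le1] := IH _ pos1; exists r1; rewrite ?inE ?ry1 ?orbT //; lia.
Qed.

Lemma longest_inc_drop y a m : longest_inc (drop a y) m <= longest_inc y m.
Proof.
elim: y a => [|o y IH] [|a] //; apply: leq_trans (IH a) _.
by case: o => [c|] /=; lia.
Qed.

Lemma longest_inc_nth y a c : nth None y a = Some c -> (longest_inc (drop a.+1 y) c.+1).+1 <= longest_inc (drop a y) c.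
Proof.
elim: y a => [|o y IH] [|a] //=; last exact: IH.
by move=> ->; rewrite drop0 leqnn; lia.
Qed.

(** * Chains in a filling *)

Arguments hlabel : simpl never.
Arguments vlabel : simpl never.

Section Chains.
Variables (n : nat) (D : nat -> nat -> bool).
Hypothesis Dn : forall i j, D i j -> i < n /\ j < n.
Hypothesis Dd : forall i j i' j', D i j -> i' <= i -> j' <= j -> D i' j'.
Hypothesis Ds : forall i j, D i j = D j i.
Variable p : nat -> nat.
Hypothesis ip : involution_on n p.

Notation h := (hlabel D p).
Notation v := (vlabel D p).
Notation Tp := (shape_at h v).

Definition chain (r : rel nat) k i a b :=
  exists c : seq nat, [/\ size c = k, sorted (fun x y => (x < y) && r (p x) (p y)) c
                        & all (fun x => (x < i) && (a <= p x < b)) c].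

Lemma chain0 r i a b : chain r 0 i a b.
Proof. by exists [::]. Qed.

Lemma chain_le r k i a b i' a' b' : i <= i' -> a' <= a -> b <= b' ->
  chain r k i a b -> chain r k i' a' b'.
Proof.
move=> li la lb [c [sc so ac]]; exists c; split=> //; apply: sub_all ac => x.
by case/and3P=> xi xa xb; rewrite (leq_trans xi) // (leq_trans la) // (leq_trans xb).
Qed.

Lemma chain_rcons r k i a b : transitive r -> chain r k.+1 i a b ->
  exists c x, [/\ size c = k, sorted (fun x y => (x < y) && r (p x) (p y)) c,
    all (fun y => [&& y < i, a <= p y < b, y < x & r (p y) (p x)]) c,
    x < i & a <= p x < b].
Proof.
move=> tr [c [sc so ac]]; case: (lastP c) sc so ac => [//|c' y].
rewrite size_rcons all_rcons => -[sc] so /andP[/andP[yi yab] ac].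
exists c', y; split=> //.
  by move: so; rewrite -cats1 => /cat_sorted2[].
have tr2 : transitive (fun x y => (x < y) && r (p x) (p y)).
  by move=> u t w /andP[tu rtu] /andP[uw ruw]; rewrite (ltn_trans tu uw) (tr _ _ _ rtu ruw).
move: so; rewrite (sorted_pairwise tr2) pairwise_rcons => /andP[al _].
apply/allP => z zc; have /andP[-> ->] := allP al z zc.
by have /andP[-> ->] := allP ac z zc.
Qed.

Lemma chain_add r k i a b x : transitive r -> x < i -> a <= p x < b ->
  (exists c : seq nat, [/\ size c = k, sorted (fun x y => (x < y) && r (p x) (p y)) c
     & all (fun y => [&& y < i, a <= p y < b, y < x & r (p y) (p x)]) c]) ->
  chain r k.+1 i a b.
Proof.
move=> tr xi xab [c [sc so ac]]; exists (rcons c x); split.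
- by rewrite size_rcons sc.
- have tr2 : transitive (fun x y => (x < y) && r (p x) (p y)).
    by move=> u t w /andP[tu rtu] /andP[uw ruw]; rewrite (ltn_trans tu uw) (tr _ _ _ rtu ruw).
  rewrite (sorted_pairwise tr2) pairwise_rcons -(sorted_pairwise tr2) so andbT.
  by apply: sub_all ac => y /and4P[_ _ -> ->].
- rewrite all_rcons xi xab /=; apply: sub_all ac => y.
  by case/and4P=> -> -> _ _.
Qed.

Let lab i j (_ : i < n) (_ : j < n) := label_rule D p i j.
Let clean := @label_clean n D p ip.

(** Across a cell with a dot the first row grows by one, across any other cell
    it is the larger one of the first rows at two corners: this is the
    recursion for increasing chains. *)
Lemma inc_chain k i j : i <= n -> j <= n -> vertex D i j ->
  chain ltn k i 0 j <-> k <= Tp i j 0.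
Proof.
have T0j j' : Tp 0 j' 0 = 0 by rewrite /shape_at big_geq // big1.
have [m] := ubnP (i + j); elim: m i j k => // m IH [|i] [|j] k lm lin ljn rij.
- rewrite T0j; split=> [[[|x c] [<- _ //]]|]; last by rewrite leqn0 => /eqP ->; exact: chain0.
- rewrite T0j; split=> [[[|x c] [<- _ //]]|]; last by rewrite leqn0 => /eqP ->; exact: chain0.
- have -> : Tp i.+1 0 0 = 0 by rewrite /shape_at [X in _ + X]big_geq // big1.
  split=> [[[|x c] [<- _ //]]|]; first by rewrite /= andbF.
  by rewrite leqn0 => /eqP ->; exact: chain0.
have dij : D i j by case/or3P: rij.
have r0 : vertex D i j.
  rewrite /vertex; case: i j dij {lm lin ljn rij} => [|i] [|j] //= dij.
  by rewrite (Dd dij).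
have r1 : vertex D i.+1 j.
  by rewrite /vertex /=; case: j dij {lm ljn rij r0} => // j dij; rewrite (Dd dij) ?orbT.
have r2 : vertex D i j.+1.
  by rewrite /vertex /=; case: i dij {lm lin rij r0 r1} => // i dij; rewrite (Dd dij) ?orbT.
have IH0 := IH i j _ (ltac:(lia)) (ltnW lin) (ltnW ljn) r0.
have IH1 := IH i.+1 j _ (ltac:(lia)) lin (ltnW ljn) r1.
have IH2 := IH i j.+1 _ (ltac:(lia)) (ltnW lin) ljn r2.
have ltr : transitive ltn by exact: ltn_trans.
have Tc := shape_cell lab clean 0 lin ljn dij.
case dt: (dot D p i j).
  have /eqP pij : p i == j by case/andP: dt.
  have [_ hN vN] := clean lin ljn dt.
  have -> : Tp i.+1 j.+1 0 = (Tp i j 0).+1.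
    by rewrite Tc dt hN vN /= addn0 addn1.
  case: k => [|k]; first by split=> // _; exact: chain0.
  rewrite ltnS; split.
    case/(chain_rcons ltr)=> c [x [sc so ac xi xj]]; apply/IH0.
    exists c; split=> //; apply: sub_all ac => y /and4P[_ _ yx /= pyx].
    by rewrite (leq_trans yx) //= (leq_trans pyx) // -ltnS; case/andP: xj.
  move=> /(IH0 k).2 [c [sc so ac]]; apply: (chain_add (x := i)); rewrite ?pij ?ltnSn //.
  exists c; split=> //; apply: sub_all ac => y /andP[yi /= pyj].
  by rewrite yi pyj (leqW yi) /= (leqW pyj).
have Tm : Tp i.+1 j.+1 0 = maxn (Tp i.+1 j 0) (Tp i j.+1 0).
  rewrite Tc shape_right (shape_up lab clean) ?(ltnW lin) // dt /local_rule /=.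
  case: (h i j) (v i j) => [r|] [s|] //=; try lia.
  by rewrite !Some_eq; case: (eqVneq s r) => [->|] //=; rewrite ?Some_eq /=; lia.
rewrite Tm leq_max; split; last first.
  case/orP=> [/(IH1 k).2|/(IH2 k).2]; exact: chain_le.
case: k => [|k] //; case/(chain_rcons ltr)=> c [x [sc so ac xi /= xj]].
have ex y : y \in rcons c x -> (y <= x) && (p y <= p x).
  rewrite mem_rcons inE => /orP[/eqP ->|/(allP ac)]; first by rewrite !leqnn.
  by case/and4P=> _ _ /ltnW -> /ltnW ->.
have ch i' j' : x < i' -> p x < j' -> chain ltn k.+1 i' 0 j'.
  move=> xi' pj; apply: (chain_add (x := x)) => //.
  exists c; split=> //; apply: sub_all ac => y /and4P[_ _ yx pyx].
  by rewrite yx pyx (ltn_trans yx) //= (ltn_trans pyx).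
move: xi; rewrite ltnS leq_eqVlt => /orP[/eqP E|xi].
  apply/orP; left; apply/IH1; apply: ch; first by rewrite E.
  move: xj; rewrite ltnS leq_eqVlt E => /orP[/eqP pj|//].
  by move: dt; rewrite /dot dij pj eqxx.
by apply/orP; right; apply/IH2; apply: ch.
Qed.

Definition edge_labels i a m := [seq v i j | j <- iota a m].

Lemma edge_labels_nodot i a m : (forall j, a <= j < a + m -> D i j /\ p i != j) ->
  edge_labels i.+1 a m = if h i a is Some x then bump_labels x (edge_labels i a m) else edge_labels i a m.
Proof.
elim: m a => [|m IH] a H; first by case: (h i a).
have [d nd] := H a (ltac:(lia)); have := IH a.+1 (fun j lj => H j (ltac:(lia))).
have := label_rule D p i a; rewrite /dot d (negPf nd) /local_rule /=.
rewrite /edge_labels [iota _ _]/= !map_cons -/(edge_labels i.+1 a.+1 m) -/(edge_labels i a.+1 m).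
case: (h i a) => [x|]; last by move=> [-> ->] ->.
rewrite /=; case: (v i a) => [y|]; last by move=> [-> ->] ->.
by rewrite Some_eq; case: (eqVneq y x) => [_|_] [-> ->] ->.
Qed.

Lemma edge_labels_dot i a m1 m2 : i < n -> a + m1 + m2.+1 <= n -> p i = a + m1 ->
  (forall j, a <= j < a + m1 + m2.+1 -> D i j) ->
  edge_labels i a (m1 + m2.+1) = edge_labels i a m1 ++ None :: edge_labels i (a + m1).+1 m2 /\
  edge_labels i.+1 a (m1 + m2.+1) = edge_labels i a m1 ++ Some 0 :: bump_labels 0 (edge_labels i (a + m1).+1 m2).
Proof.
move=> lin le pi H.
have d : D i (a + m1) by apply: H; lia.
have dt : dot D p i (a + m1) by rewrite /dot d pi eqxx.
have ljn : a + m1 < n by lia.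
have [_ hN vN] := clean lin ljn dt.
have catE i' : edge_labels i' a (m1 + m2.+1) = edge_labels i' a m1 ++ v i' (a + m1) :: edge_labels i' (a + m1).+1 m2.
  by rewrite /edge_labels iotaD map_cat.
rewrite !catE vN; split=> //.
have := label_rule D p i (a + m1); rewrite dt d hN vN /local_rule /= => -[h1 v1].
rewrite v1 !edge_labels_nodot ?h1 //; last 2 first.
- by move=> j lj; split; [apply: H; lia|rewrite pi; apply/eqP; lia].
- by move=> j lj; split; [apply: H; lia|rewrite pi; apply/eqP; lia].
have -> // : h i a = None.
case E: (h i a) => [x|] //; have := hlabel_some D p i a; rewrite E /=.
case/esym/hasP => j; rewrite mem_iota /dot => lj /andP[_ /eqP]; lia.
Qed.

(** Adding a column has the same effect on both sides: a chain that ends at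
    the new dot extends one in the rows above the dot ([longest_inc_insert]). *)
Lemma dec_chain k i a m : i <= n -> a + m <= n -> (i == 0) || (m == 0) || D i.-1 (a + m).-1 ->
  chain gtn k i a (a + m) <-> k <= longest_inc (edge_labels i a m) 0.
Proof.
have gtr : transitive gtn by move=> y x z /= yx zy; apply: ltn_trans zy yx.
elim: i a m k => [|i IH] a m k lin lem rg.
  have -> : longest_inc (edge_labels 0 a m) 0 = 0 by rewrite /edge_labels; elim: m a {lem rg} => [|m IHm] a //=.
  split=> [[[|x c] [<- _ //]]|]; last by rewrite leqn0 => /eqP ->; exact: chain0.
case: (posnP m) => [m0|m_gt0].
  rewrite m0 addn0 /edge_labels /=; split=> [[[|x c] [<- _ //=]]|]; first by lia.
  by rewrite leqn0 => /eqP ->; exact: chain0.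
have dij j : j < a + m -> D i j.
  move=> lj; move: rg; rewrite orFb (gtn_eqF m_gt0) /= => d; apply: Dd d _ _ => //; lia.
have rg' a' m' : a' + m' <= a + m -> (i == 0) || (m' == 0) || D i.-1 (a' + m').-1.
  move=> le; case: (posnP m') => [->|m'_gt0]; first by rewrite orbT.
  by rewrite (Dd (dij (a + m).-1 _)) ?orbT //; lia.
case: (boolP (a <= p i < a + m)) => [/andP[pa pb]|np]; last first.
  have -> : longest_inc (edge_labels i.+1 a m) 0 = longest_inc (edge_labels i a m) 0.
    rewrite edge_labels_nodot; last first.
      move=> j lj; split; first by apply: dij; lia.
      by apply: contra np => /eqP ->.
    by case: (h i a) => [x|//]; have [A1 _ _] := longest_inc_bump (edge_labels i a m) x; rewrite A1.
  rewrite -(IH a m k) ?(ltnW lin) ?rg' //; split; last exact: chain_le.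
  case=> c [sc so ac]; exists c; split=> //; apply: sub_all ac => x /andP[xi xab].
  rewrite xab andbT; move: xi; rewrite ltnS leq_eqVlt => /orP[/eqP E|//].
  by case/negP: np; rewrite -E.
pose m1 := p i - a; pose m2 := (a + m) - (p i).+1.
have Em : m = m1 + m2.+1 by rewrite /m1 /m2; lia.
have pE : p i = a + m1 by rewrite /m1; lia.
have [E1 E2] : edge_labels i a m = edge_labels i a m1 ++ None :: edge_labels i (p i).+1 m2 /\
  edge_labels i.+1 a m = edge_labels i a m1 ++ Some 0 :: bump_labels 0 (edge_labels i (p i).+1 m2).
  rewrite Em pE; apply: edge_labels_dot => //; first lia.
  by move=> j lj; apply: dij; lia.
rewrite E2 longest_inc_insert -E1 leq_max.
have IH1 := IH a m _ (ltnW lin) lem (rg' _ _ (leqnn _)).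
have Eb : (p i).+1 + m2 = a + m by rewrite /m2; lia.
have IH2 := IH (p i).+1 m2 _ (ltnW lin).
rewrite Eb in IH2; have {}IH2 := IH2 _ lem; rewrite -Eb in IH2.
have {}IH2 k' := IH2 k' (rg' _ _ (eq_leq Eb)); rewrite Eb in IH2.
split; last first.
  case/orP=> [/(IH1 k).2|]; first exact: chain_le.
  case: k => [|k]; first by move=> _; exact: chain0.
  rewrite ltnS => /(IH2 k).2 [c [sc so ac]].
  apply: (chain_add (x := i)); rewrite ?pa //.
  exists c; split=> //; apply: sub_all ac => y /and3P[yi ya yb].
  by rewrite yi (leqW yi) /= yb ya (leq_trans pa (ltnW ya)).
case: k => [|k] //; case/(chain_rcons gtr)=> c [x [sc so ac xi xab]].
move: xi; rewrite ltnS leq_eqVlt => /orP[/eqP E|xi]; apply/orP; last first.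
  left; apply/IH1; apply: (chain_add (x := x)) => //.
  exists c; split=> //; apply: sub_all ac => y /and4P[_ yab yx pyx].
  by rewrite yab yx pyx (ltn_trans yx).
right; rewrite ltnS; apply/IH2; exists c; split=> //; apply: sub_all ac => y.
rewrite -E; case/and4P=> _ /andP[ya yb] yx /= pyx.
by rewrite yx pyx yb.
Qed.

Lemma shape_edge_labels i j r : i <= n -> j <= n -> Tp i j r = count_mem (Some r) (edge_labels i 0 j).
Proof.
move=> lin; elim: j => [_|j IH ljn].
  by rewrite /shape_at [X in _ + X]big_geq // big1.
rewrite (shape_up lab clean) // IH ?(ltnW ljn) // /edge_labels -[in RHS]addn1 iotaD map_cat count_cat /=.
by rewrite addn0.
Qed.

(** The labels add up to partitions, so the first occurrence of each label
    comes after that of the preceding label; thus there is an increasing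
    subsequence that uses all rows. *)
Lemma row_chain K i j : i <= n -> j <= n -> vertex D i j ->
  chain gtn K.+1 i 0 j <-> 0 < Tp i j K.
Proof.
move=> lin ljn rij; have pt := fill_part Dd ip.
have rg : (i == 0) || (j == 0) || D i.-1 (0 + j).-1 by rewrite -orbA.
rewrite -[j in chain _ _ _ _ j]add0n dec_chain //.
rewrite shape_edge_labels // -has_count has_pred1; split=> [lt|].
  have [r ry le] := longest_inc_label (leq_ltn_trans (leq0n _) lt).
  rewrite -has_pred1 has_count -shape_edge_labels //.
  have : 0 < Tp i j r by rewrite shape_edge_labels // -has_count has_pred1.
  by have := part_le (pt i j lin ljn rij) (_ : K <= r); move/(_ (ltac:(lia))); lia.
have ny a : a < j -> nth None (edge_labels i 0 j) a = v i a.
  by move=> la; rewrite (nth_map 0) ?size_iota // nth_iota.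
have key m : forall a s, a < j -> v i a = Some m ->
    s <= longest_inc (drop a (edge_labels i 0 j)) m -> s + m <= longest_inc (edge_labels i 0 j) 0.
  elim: m => [|m IHm] a s la va le.
    by rewrite addn0; apply: leq_trans le (longest_inc_drop _ _ _).
  have ra : vertex D i a.+1.
    move: rij; rewrite /vertex; case: (i == 0) => //=; case/orP=> [/eqP j0|d]; first by lia.
    by rewrite (Dd d) ?orbT //=; lia.
  have lan : a < n := leq_trans la ljn.
  have : 0 < Tp i a.+1 m.
    apply: leq_trans (pt i a.+1 lin lan ra m).
    by rewrite (shape_up lab clean) // va eqxx; lia.
  rewrite (shape_up lab clean) // va Some_eq (gtn_eqF (ltnSn m)) addn0 shape_edge_labels ?(ltnW lan) //.
  rewrite -has_count has_pred1 => /mapP[a']; rewrite mem_iota /= => la' va'.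
  have la'j : a' < j by lia.
  rewrite addnS -addSn; apply: (IHm a' s.+1 la'j (esym va')).
  apply: leq_trans (longest_inc_nth (_ : nth None (edge_labels i 0 j) a' = Some m)); last by rewrite ny.
  rewrite ltnS; apply: leq_trans le _.
  have la'a : a'.+1 <= a by lia.
  by rewrite -(subnK la'a) -drop_drop; apply: longest_inc_drop.
case/mapP=> a; rewrite mem_iota /= => la va; rewrite -add1n.
apply: (key K a) => //; rewrite (drop_nth None) ?size_map ?size_iota // ny // -va /=.
by rewrite leqnn; lia.
Qed.

(** The order of the two labels is settled at the upper one of the two dots.
    No cell above changes it, since the two columns are crossed by the same
    labels and a label bumped in the first column enters the second one
    increased. *)
Lemma asc_label c : c.+1 < n -> (forall j, D c j = D c.+1 j) ->
  D c (p c) -> D c.+1 (p c.+1) ->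
  (p c < p c.+1) = (odflt 0 (top_label n D p c.+1) <= odflt 0 (top_label n D p c)).
Proof.
move=> cn Dc d1 d2; have cn' := ltnW cn.
have hs i j : i < n -> D i (p i) -> isSome (h i j) = (p i < j).
  move=> lin d; rewrite hlabel_some; apply/hasP/idP => [[j']|lt].
    by rewrite mem_iota /= => lj /andP[_ /eqP ->].
  by exists (p i); rewrite ?mem_iota // /dot d eqxx.
have ne : p c != p c.+1.
  by apply/eqP => /(involution_on_inj ip cn' cn); lia.
have step j : j < n -> D c j -> p c != j -> p c.+1 != j ->
   exists y y', [/\ (h c j.+1, y') = local_rule true false (h c j) y &
     h c.+1 j.+1 = (local_rule true false (h c.+1 j) y').1].
  move=> ljn dj n1 n2; exists (v c j), (v c.+1 j).
  have := label_rule D p c j; have := label_rule D p c.+1 j.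
  by rewrite /dot -Dc dj (negPf n1) (negPf n2) => <- <-.
case: (ltngtP (p c) (p c.+1)) ne => // lt _.
- have A j : j <= n -> (if h c.+1 j is Some s then if h c j is Some r then s <= r else false else true).
    elim: j => [//|j IH ljn]; have {}IH := IH (ltnW ljn).
    case dj: (D c j); last first.
      have := label_rule D p c j; have := label_rule D p c.+1 j; rewrite /local_rule -Dc dj /=.
      by move=> [-> _] [-> _].
    case: (eqVneq (p c) j) => [E|n1].
      by have := hs c.+1 j.+1 cn d2; rewrite -E; case: (h c.+1 (p c).+1) => [s|] //=; lia.
    case: (eqVneq (p c.+1) j) => [E|n2].
      have dt : dot D p c.+1 j by rewrite /dot -Dc dj E eqxx.
      have := label_rule D p c.+1 j; rewrite dt -Dc dj /local_rule /= => -[-> _].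
      by have := hs c j.+1 cn' d1; case: (h c j.+1) => [s|] //=; lia.
    have [y [y' [E1 E2]]] := step j ljn dj n1 n2; move: E1 E2; rewrite /local_rule /=.
    case: (h c j) IH => [r|]; case: (h c.+1 j) => [s|] //.
    - case: y => [y|] /=; last by move=> ? [-> ->] ->.
      rewrite Some_eq; case: (eqVneq y r) => [_|nyr] le [-> ->].
        by rewrite Some_eq; case: eqP => _ -> /=; lia.
      by rewrite Some_eq; case: (eqVneq y s) => [Es|_] -> /=; lia.
    - by move=> _ _ ->.
    - by move=> _ _ ->.
  have := A n (leqnn n); rewrite /top_label; have := hs c.+1 n cn d2; have := hs c n cn' d1.
  rewrite (ip cn').1 (ip cn).1; case: (h c n) => // r _; case: (h c.+1 n) => // s _ /= -> //.
- have A j : j <= n -> (if h c j is Some r then if h c.+1 j is Some s then r < s else false else true).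
    elim: j => [//|j IH ljn]; have {}IH := IH (ltnW ljn).
    case dj: (D c j); last first.
      have := label_rule D p c j; have := label_rule D p c.+1 j; rewrite /local_rule -Dc dj /=.
      by move=> [-> _] [-> _].
    case: (eqVneq (p c.+1) j) => [E|n2].
      by have := hs c j.+1 cn' d1; rewrite -E; case: (h c (p c.+1).+1) => [s|] //=; lia.
    case: (eqVneq (p c) j) => [E|n1].
      have dt : dot D p c j by rewrite /dot dj E eqxx.
      have := label_rule D p c j; rewrite dt dj /local_rule /= => -[-> v1].
      have := hs c.+1 j cn d2; have := label_rule D p c.+1 j.
      rewrite /dot -Dc dj (negPf n2) /local_rule /= v1; case: (h c.+1 j) => [s|] /=; last by lia.
      by rewrite Some_eq; case: s => [|s] [-> _].
    have [y [y' [E1 E2]]] := step j ljn dj n1 n2; move: E1 E2; rewrite /local_rule /=.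
    case: (h c j) IH => [r|]; case: (h c.+1 j) => [s|] //; last first.
    - by move=> _ [-> _] _.
    - by move=> _ [-> _] _.
    case: y => [y|] /=; last by move=> ? [-> ->] ->.
    rewrite Some_eq; case: (eqVneq y r) => [_|nyr] le [-> ->].
      by rewrite Some_eq; case: eqP => Es -> /=; lia.
    by rewrite Some_eq; case: (eqVneq y s) => [_|_] -> /=; lia.
  have := A n (leqnn n); rewrite /top_label; have := hs c.+1 n cn d2; have := hs c n cn' d1.
  rewrite (ip cn').1 (ip cn).1; case: (h c n) => // r _; case: (h c.+1 n) => // s _ /= lt'.
  by rewrite leqNgt lt'.
Qed.
End Chains.

(** * Pattern avoidance and peaks on the boundary word *)

Section ClassWords.
Variables (n : nat) (D : nat -> nat -> bool).
Hypothesis Dn : forall i j, D i j -> i < n /\ j < n.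
Hypothesis Dd : forall i j i' j', D i j -> i' <= i -> j' <= j -> D i' j'.
Hypothesis Ds : forall i j, D i j = D j i.
Variables (wh cut : nat -> bool).
Hypothesis white_adjacent : forall c, c.+1 < n -> wh c -> wh c.+1 -> forall j, D c j = D c.+1 j.

Notation path_x := (path_x n D).
Notation path_y := (path_y n D).
Notation goes_right := (goes_right n D).
Notation crossed := (crossed n D).
Notation st := (steps n D wh cut 0 n).
Notation word p := (path_word n D (top_label n D p) 0 n).
Notation Tp p := (shape_at (hlabel D p) (vlabel D p)).

(** Going up a diagonal, one reaches the boundary. *)
Lemma vertex_slide (P : nat -> nat -> Prop) :
  (forall i j, D i j -> P i j -> P i.+1 j.+1) ->
  forall i j, i <= n -> j <= n -> vertex D i j -> P i j ->
  exists i' j', [/\ i' <= n, j' <= n, vertex D i' j', ~~ D i' j' & P i' j'].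
Proof.
move=> HP i j; have [m] := ubnP (n - i); elim: m i j => // m IH i j lm lin ljn rij Pij.
case dij: (D i j); last by exists i, j; split=> //; apply: negbT.
have [li lj] := Dn dij; apply: (IH i.+1 j.+1) => //; [lia|exact: HP].
Qed.

Lemma path_sym p (P : pred nat) r i j : involution_on n p -> i <= n -> j <= n ->
  vertex D i j -> ~~ D i j -> P (Tp p i j r) ->
  exists2 u, u <= n & P (Tp p (path_x u) (path_y u) r).
Proof.
move=> ip lin ljn; wlog le : i j lin ljn / i <= j.
  move=> W rij dij Pij; case: (leqP i j) => [|/ltnW] le; first exact: W le rij dij Pij.
  apply: (W j i ljn lin le); rewrite ?[D j i]Ds //.
    by move: rij; rewrite /vertex orbCA Ds.
  rewrite (shape_sym (fun i j _ _ => label_rule D p i j) (label_clean ip)) //.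
  exact: label_sym.
move=> rij dij Pij; have [u un [Ei Ej]] := path_all Dn Dd le ljn rij dij.
by exists u; rewrite ?Ei ?Ej.
Qed.

Lemma path_reg u : u <= n -> [/\ path_x u <= n, path_y u <= n & vertex D (path_x u) (path_y u)].
Proof.
move=> un; have /andP[r1 _] := path_bd Dn Dd un; have [E le] := path_sum D un.
by split=> //; lia.
Qed.

Lemma chain_path (r : rel nat) k (row : nat) (P : pred nat) p : involution_on n p ->
  (forall i j, i <= n -> j <= n -> vertex D i j -> chain p r k i 0 j <-> P (Tp p i j row)) ->
  (exists i j, [/\ i <= n, j <= n, vertex D i j & chain p r k i 0 j]) <->
  (exists2 u, u <= n & P (Tp p (path_x u) (path_y u) row)).
Proof.
move=> ip HC; split=> [[i [j [lin ljn rij ch]]]|[u un ch]]; last first.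
  have [r1 r2 r3] := path_reg un.
  by exists (path_x u), (path_y u); split=> //; apply: (HC _ _ r1 r2 r3).2.
have HP i0 j0 : D i0 j0 -> chain p r k i0 0 j0 -> chain p r k i0.+1 0 j0.+1.
  by move=> _; apply: chain_le.
have [i' [j' [lin' ljn' rij' dij' ch']]] := vertex_slide HP lin ljn rij ch.
exact: (path_sym ip lin' ljn' rij' dij' ((HC _ _ lin' ljn' rij').1 ch')).
Qed.

Lemma avoid_inc K p : fills n D wh p ->
  (~ exists i j, [/\ i <= n, j <= n, vertex D i j & chain p ltn K.+1 i 0 j]) <->
  valid (fun _ c => c != K) empty_shape st (word p).
Proof.
move=> fp; have ip := fp.1.
rewrite (@chain_path ltn K.+1 0 (fun x => K < x)) //; last first.
  by move=> i j lin ljn rij; exact: (inc_chain Dd ip).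
split=> [H|/(fill_col Dn Dd Ds cut K fp) H [u un]]; last by rewrite ltnNge H.
by apply/(fill_col Dn Dd Ds cut K fp) => u un; rewrite leqNgt; apply/negP => lt; case: H; exists u.
Qed.

Lemma avoid_dec K p : fills n D wh p ->
  (~ exists i j, [/\ i <= n, j <= n, vertex D i j & chain p gtn K.+1 i 0 j]) <->
  valid (fun r _ => r != K) empty_shape st (word p).
Proof.
move=> fp; have ip := fp.1.
rewrite (@chain_path gtn K.+1 K (fun x => 0 < x)) //; last first.
  by move=> i j lin ljn rij; exact: (row_chain Dd ip).
split=> [H|/(fill_row Dn Dd Ds cut K fp) H [u un]]; last by rewrite H.
apply/(fill_row Dn Dd Ds cut K fp) => u un; apply/eqP; rewrite -leqn0 leqNgt.
by apply/negP => lt; case: H; exists u.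
Qed.

(** The peaks which are not common to a class and are not allowed by a cut. *)
Definition free_peak (p : nat -> nat) c :=
  [&& c.+2 < n, wh c, wh c.+1, wh c.+2, ~~ cut c.+1, ~~ cut c.+2,
      p c < p c.+1 & p c.+2 < p c.+1].

Lemma no_linked_turn_steps b t m : no_linked_turn true (steps n D wh cut t m) (path_word n D b t m) =
  all (fun u => ~~ [&& step_linked n D wh cut u.+1, step_linked n D wh cut u.+2,
     bit (step_kind n D wh u.+1) (odflt 0 (b (crossed u))) (odflt 0 (b (crossed u.+1))) &
     ~~ bit (step_kind n D wh u.+2) (odflt 0 (b (crossed u.+1))) (odflt 0 (b (crossed u.+2)))])
   (iota t (m - 2)).
Proof.
elim: m t => [//|[//|[//|m]] IH] t.
have -> : m.+3 - 2 = (m.+2 - 2).+1 by lia.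
rewrite -[RHS]/(_ && all _ (iota t.+1 (m.+2 - 2))) -IH.
rewrite -[LHS]/(_ && no_linked_turn true (steps n D wh cut t.+1 m.+2) (path_word n D b t.+1 m.+2)).
by congr (~~ _ && _); rewrite eqb_id eqbF_neg.
Qed.

Lemma asc_bit p c : fills n D wh p -> c.+1 < n -> wh c -> wh c.+1 ->
  (p c < p c.+1) = (odflt 0 (top_label n D p c.+1) <= odflt 0 (top_label n D p c)).
Proof.
move=> fp cn w1 w2; apply: (asc_label fp.1) => //; first exact: white_adjacent.
  by rewrite fp.2 // ltnW.
by rewrite fp.2.
Qed.

Lemma crossed_next u : u.+1 < n -> goes_right u = goes_right u.+1 ->
  if goes_right u then crossed u.+1 = (crossed u).+1 else crossed u = (crossed u.+1).+1.
Proof.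
move=> un E; have := path_lt D un; have := path_lt D (ltnW un).
rewrite /crossed -E; case tyu: (goes_right u); rewrite ?path_xS ?path_yS tyu //; lia.
Qed.

Lemma desc_neg p a b : involution_on n p -> a < n -> b < n -> a != b -> (p b < p a) = ~~ (p a < p b).
Proof.
move=> ip an bn ne; rewrite -leqNgt [RHS]leq_eqVlt.
by case: eqP => [E|//]; rewrite (involution_on_inj ip bn an E) eqxx in ne.
Qed.

Lemma no_linked_turn_free p : fills n D wh p ->
  no_linked_turn true st (word p) <-> (forall c, ~~ free_peak p c).
Proof.
have mx a : maxn a.+1 a = a.+1 by apply/maxn_idPl.
move=> fp; have ip := fp.1; rewrite no_linked_turn_steps; split=> [/allP H c|H].
  apply/negP => /and5P[cn w0 w1 w2 /and4P[c1 c2 p1 p2]].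
  have cn1 : c.+1 < n by lia.
  have [t1 t1n [E1 B1]] := crossed_adjacent Dn Dd Ds cn1 (white_adjacent cn1 w0 w1).
  have [t2 t2n [E2 B2]] := crossed_adjacent Dn Dd Ds cn (white_adjacent cn w1 w2).
  have a1 : odflt 0 (top_label n D p c.+1) <= odflt 0 (top_label n D p c) by rewrite -asc_bit.
  have a2 : ~~ (odflt 0 (top_label n D p c.+2) <= odflt 0 (top_label n D p c.+1)).
    by rewrite -asc_bit // -leqNgt ltnW.
  have key u : u.+2 < n -> goes_right u.+1 = goes_right u -> goes_right u.+2 = goes_right u.+1 ->
      (if goes_right u then [/\ crossed u = c, crossed u.+1 = c.+1 & crossed u.+2 = c.+2]
       else [/\ crossed u = c.+2, crossed u.+1 = c.+1 & crossed u.+2 = c]) -> False.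
    move=> un F1 F2 F3; have /negP := H u (ltac:(rewrite mem_iota; lia)); apply.
    rewrite /step_linked /step_kind F2 F1 eqxx; case: (goes_right u) F3 => -[-> -> ->]; rewrite w0 w1 w2 /=.
      by rewrite /maxn !ltnSn c1 c2 a1 a2.
    by rewrite !mx c1 c2 -leqNgt a1 ltnNge (negPf a2).
  case T1: (goes_right t1) B1; case T2: (goes_right t2) B2 => -[B2 B2'] [B1 B1'].
  - have E : t2 = t1.+1 by apply: (@crossed_inj n D) => //; [lia|rewrite B2 B1'].
    by subst t2; apply: (key t1) => //; rewrite T1.
  - have E : t1.+1 = t2.+1 by apply: (@crossed_inj n D) => //; rewrite B2' B1'.
    by move: B2; case: E => <-; rewrite B1; lia.
  - have E : t1 = t2 by apply: (@crossed_inj n D) => //; [lia|lia|rewrite B1 B2].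
    by rewrite E T2 in T1.
  - have E : t1 = t2.+1 by apply: (@crossed_inj n D) => //; [lia|rewrite B1 B2'].
    by subst t1; apply: (key t2) => //; rewrite T2.
apply/allP => u; rewrite mem_iota => un; have {}un : u.+2 < n by lia.
apply/negP => /and4P[/and4P[/eqP E1 w0 w1 c1] /and4P[/eqP E2 _ w2 c2]].
have N1 := crossed_next (ltnW un) E1; have N2 := crossed_next un E2.
rewrite /step_kind w1 w2 -E2 -E1 /bit; rewrite -E1 in N2.
case T1: (goes_right u) N1 N2 => N1 N2 b1 b2.
  move: c1 c2 w1 w2 b1 b2; rewrite N2 N1 /maxn !ltnSn => c1 c2 w1 w2 b1 b2.
  have l2 : (crossed u).+2 < n by rewrite -N1 -N2 crossed_lt.
  have l1 : (crossed u).+1 < n by apply: ltnW.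
  case/negP: (H (crossed u)); rewrite /free_peak l2 w0 w1 w2 c1 c2 asc_bit // b1 /=.
  by rewrite desc_neg // ?asc_bit // neq_ltn ltnSn.
set c := crossed u.+2 in N2 w2 c2 b1 b2 *; move: c1 c2 w0 w1 b1 b2.
have l2 : c.+2 < n by rewrite -N2 -N1 crossed_lt //; lia.
have l1 : c.+1 < n by apply: ltnW.
rewrite N1 N2 !mx => c1 c2 w0 w1 b1 b2.
case/negP: (H c); rewrite /free_peak l2 w0 w1 w2 c1 c2 asc_bit // leqNgt b2 /=.
have ne : c.+1 != c.+2 by rewrite neq_ltn ltnSn.
by rewrite (desc_neg ip l1 l2 ne) (asc_bit fp l2 w1 w0) -ltnNge.
Qed.
End ClassWords.

(** * The board of an involution *)

Definition word_of (n : nat) (s : 'S_n) (i : nat) : nat :=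
  oapp (fun a : 'I_n => val (s a)) 0 (insub i).

Lemma word_ofE n (s : 'S_n) (a : 'I_n) : word_of s a = s a.
Proof. by rewrite /word_of valK. Qed.

Definition occurs_at m n (p : 'S_m) (s : 'S_n) (f : {ffun 'I_m -> 'I_n}) : bool :=
  [forall i : 'I_m, forall j : 'I_m, (i < j) ==> (f i < f j)] &&
  [forall i : 'I_m, forall j : 'I_m, (p i < p j) == (s (f i) < s (f j))].

Lemma occurs_atP m n (p : 'S_m) (s : 'S_n) (f : {ffun 'I_m -> 'I_n}) :
  reflect ((forall i j : 'I_m, i < j -> f i < f j) /\
           (forall i j, (p i < p j) = (s (f i) < s (f j)))) (occurs_at p s f).
Proof.
apply: (iffP andP) => [[/'forall_'forall_implyP H1 /'forall_'forall_eqP H2]|[H1 H2]].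
  by split.
by split; [apply/'forall_'forall_implyP|apply/'forall_'forall_eqP].
Qed.

Lemma eq_occurs_at m n (p : 'S_m) (s s' : 'S_n) (f : {ffun 'I_m -> 'I_n}) :
  (forall a, s (f a) = s' (f a)) -> occurs_at p s f = occurs_at p s' f.
Proof.
move=> E; congr (_ && _); apply: eq_forallb => i; apply: eq_forallb => j.
by rewrite !E.
Qed.

Lemma involutive_permK n (s : 'S_n) : involutive_perm s -> forall a, s (s a) = a.
Proof. by move/eqP => E a; rewrite {1}E permK. Qed.

Section Coloring.
Variables (n m : nat) (tau : 'S_m).
Implicit Type s : 'S_n.

Definition above s (i j : nat) : bool :=
  [&& i < n, j < n & [exists f : {ffun 'I_m -> 'I_n},
     occurs_at tau s f && [forall a, (i < f a) && (j < s (f a))]]].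

(** The reflected cells make the board symmetric; for an involution they lie
    below an occurrence of the inverse of [tau]. *)
Definition board s (i j : nat) : bool := above s i j || above s j i.

Lemma aboveP s i j : reflect (exists f : {ffun 'I_m -> 'I_n},
    [/\ i < n, j < n, occurs_at tau s f & forall a, i < f a /\ j < s (f a)]) (above s i j).
Proof.
apply: (iffP and3P) => [[lin ljn /existsP[f /andP[of1 /forallP H]]]|[f [lin ljn of1 H]]].
  by exists f; split=> // a; apply/andP.
by split=> //; apply/existsP; exists f; rewrite of1; apply/forallP => a; apply/andP.
Qed.

Lemma above_down s i j i' j' : above s i j -> i' <= i -> j' <= j -> above s i' j'.
Proof.
move=> /aboveP[f [lin ljn of1 H]] li lj; apply/aboveP; exists f; split=> //.
- exact: leq_ltn_trans li lin.
- exact: leq_ltn_trans lj ljn.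
- by move=> a; have [h1 h2] := H a; split; [exact: leq_ltn_trans h1|exact: leq_ltn_trans h2].
Qed.

Lemma board_n s i j : board s i j -> i < n /\ j < n.
Proof. by case/orP=> /aboveP[f []]. Qed.

Lemma board_down s i j i' j' : board s i j -> i' <= i -> j' <= j -> board s i' j'.
Proof.
by case/orP=> H li lj; apply/orP; [left|right]; apply: above_down H _ _.
Qed.

Lemma board_sym s i j : board s i j = board s j i.
Proof. by rewrite /board orbC. Qed.

(** A witness for the cell (i, j) that does not use column [i.+1],
    respectively row [i.+1] in the reflected case, would also be one for the
    cell (i.+1, j). *)
Lemma board_drop s i j : involutive_perm s -> board s i j -> i.+1 < n ->
  ~~ board s i.+1 j -> j < word_of s i.+1.
Proof.
move=> is1 bij lin nb; have [_ ljn] := board_n bij.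
have sK := involutive_permK is1; pose i1 := Ordinal lin.
rewrite -[i.+1]/(val i1) word_ofE ltnNge; apply/negP => le; case/negP: nb.
case/orP: bij => /aboveP[f [_ _ of1 H]]; apply/orP; [left|right]; apply/aboveP;
  exists f; split=> // a; have [h1 h2] := H a; split=> //.
  rewrite ltn_neqAle h1 andbT; apply/eqP => E.
  by move: h2; rewrite (_ : f a = i1); [rewrite ltnNge le|apply: val_inj].
rewrite ltn_neqAle h2 andbT; apply/eqP => E.
have Es : s (f a) = i1 by apply: val_inj.
by move: h1; rewrite -[f a]sK Es ltnNge le.
Qed.

Definition white s (i : nat) : bool := board s i (word_of s i).

Lemma white_col s c : involutive_perm s -> c.+1 < n -> white s c.+1 ->
  forall j, board s c j = board s c.+1 j.
Proof.
move=> is1 cn w j; apply/idP/idP => [b|b]; last exact: board_down b (leqnSn c) (leqnn j).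
case nb: (board s c.+1 j) => //; have lt := board_drop is1 b cn (negbT nb).
by move: nb; rewrite (board_down w (leqnn _) (ltnW lt)).
Qed.

Lemma white_grey s c : involutive_perm s -> c.+1 < n -> white s c -> ~~ white s c.+1 ->
  word_of s c < word_of s c.+1.
Proof.
move=> is1 cn w nw; case b: (board s c.+1 (word_of s c)); last first.
  by apply: board_drop w cn _; rewrite ?b.
by rewrite ltnNge; apply: contra nw => le; apply: board_down b (leqnn _) le.
Qed.

Lemma grey_white s c : ~~ white s c -> white s c.+1 -> word_of s c.+1 < word_of s c.
Proof.
move=> nw w; rewrite ltnNge; apply: contra nw => le.
exact: board_down w (leqnSn c) le.
Qed.

(** The witnesses of a maximal cell lie outside of the board. *)
Lemma board_grey s0 s : involutive_perm s0 -> involutive_perm s ->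
  (forall a : 'I_n, board s0 a (s a) = board s0 a (s0 a)) ->
  (forall a : 'I_n, ~~ board s0 a (s0 a) -> s a = s0 a) ->
  forall i j, board s i j = board s0 i j.
Proof.
move=> is0 is1 Ew Eg.
have sub i j : above s i j -> board s0 i j.
  move=> /aboveP[f [lin ljn of1 H]]; case nb: (board s0 i j) => //.
  have E a : s (f a) = s0 (f a).
    apply: Eg; rewrite -Ew; apply: contraFN nb => b; have [h1 h2] := H a.
    exact: board_down b (ltnW h1) (ltnW h2).
  move: nb; rewrite /board => /norP[]; case/negP; apply/aboveP; exists f; split=> //.
    by rewrite -(eq_occurs_at _ E).
  by move=> a; rewrite -E.
have sup i j : board s0 i j -> board s i j.
  have [k] := ubnP (n - i); elim: k i j => // k IH i j lk b; have [lin ljn] := board_n b.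
  case b1: (board s0 i.+1 j.+1).
    by apply: board_down (IH i.+1 j.+1 _ b1) _ _ => //; lia.
  have tr i' j' : above s0 i' j' -> (forall i2 j2, i' < i2 -> j' < j2 -> ~~ board s0 i2 j2) ->
      above s i' j'.
    move=> /aboveP[f [lin' ljn' of1 H]] nb; apply/aboveP; exists f.
    have E a : s (f a) = s0 (f a) by apply: Eg; have [h1 h2] := H a; apply: nb.
    by split=> //; [rewrite (eq_occurs_at _ E)|move=> a; rewrite E].
  case/orP: b => b; apply/orP; [left|right]; apply: tr => // i2 j2 l1 l2.
    by apply: contraFN b1 => b2; apply: board_down b2 l1 l2.
  by apply: contraFN b1 => b2; rewrite board_sym; apply: board_down b2 l1 l2.
move=> i j; apply/idP/idP => [|/sup //].
by case/orP=> /sub //; rewrite board_sym.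
Qed.

Definition key s := ([set x : 'I_n * 'I_n | board s x.1 x.2],
  [ffun a : 'I_n => if board s a (s a) then None else Some (s a)]).

Lemma key_inj s0 s : key s = key s0 ->
  [/\ forall i j, board s i j = board s0 i j,
      forall a : 'I_n, board s0 a (s a) = board s0 a (s0 a) &
      forall a : 'I_n, ~~ board s0 a (s0 a) -> s a = s0 a].
Proof.
case=> /setP Eb /ffunP Eg.
have Ebn i j : board s i j = board s0 i j.
  case: (ltnP i n) => [li|li]; last first.
    by apply/idP/idP => /board_n[]; rewrite ltnNge li.
  case: (ltnP j n) => [lj|lj]; last first.
    by apply/idP/idP => /board_n[_]; rewrite ltnNge lj.
  by have := Eb (Ordinal li, Ordinal lj); rewrite !inE.
split=> // a.
  by have := Eg a; rewrite !ffunE -!Ebn; case: ifP; case: ifP.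
by have := Eg a; rewrite !ffunE -!Ebn => + /negPf nb; rewrite nb; case: ifP => // _ [].
Qed.

Lemma key_closed s0 s : involutive_perm s0 -> involutive_perm s ->
  (forall a : 'I_n, board s0 a (s a) = board s0 a (s0 a)) ->
  (forall a : 'I_n, ~~ board s0 a (s0 a) -> s a = s0 a) -> key s = key s0.
Proof.
move=> is0 is1 Ew Eg; have Eb := board_grey is0 is1 Ew Eg.
congr pair; first by apply/setP => x; rewrite !inE Eb.
apply/ffunP => a; rewrite !ffunE Eb Ew; case: ifP => // /negbT nb.
by rewrite Eg.
Qed.

Section Front.
Variables (k : nat) (P : 'S_k).
Hypothesis k_gt0 : 0 < k.

Definition front s (g : 'I_k -> 'I_n) :=
  (forall a b : 'I_k, a < b -> g a < g b) /\ (forall a b, (P a < P b) = (s (g a) < s (g b))).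

(** The cell (i, j) separates the two summands of an occurrence. *)
Lemma contains_dsum s : contains (dsum P tau) s <->
  exists g i j, [/\ front s g, forall a, g a <= i /\ s (g a) <= j & above s i j].
Proof.
have dl a : dsum P tau (lshift m a) = lshift m (P a).
  by rewrite permE /dsum_fun -[lshift m a]/(unsplit (inl a)) unsplitK.
have dr b : dsum P tau (rshift k b) = rshift k (tau b).
  by rewrite permE /dsum_fun -[rshift k b]/(unsplit (inr b)) unsplitK.
split=> [/existsP[f /occurs_atP[H1 H2]]|[g [i [j [[g1 g2] gij /aboveP[t [lin ljn /occurs_atP[t1 t2] ht]]]]]]].
  pose g a := f (lshift m a); pose t := [ffun b => f (rshift k b)].
  pose a0 := Ordinal k_gt0.
  have [ai _ Hi] := @arg_maxnP _ a0 xpredT (fun a => val (g a)) isT.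
  have [aj _ Hj] := @arg_maxnP _ a0 xpredT (fun a => val (s (g a))) isT.
  exists g, (g ai), (s (g aj)); split.
  - split=> a b; first by move=> ab; apply: H1.
    by rewrite -H2 !dl.
  - by move=> a; split; [exact: Hi|exact: Hj].
  - apply/aboveP; exists t; split=> //.
      apply/occurs_atP; split=> a b; rewrite !ffunE; first by move=> ab; apply: H1; rewrite ltn_add2l.
      by rewrite -H2 !dr ltn_add2l.
    move=> b; rewrite ffunE; split.
      by apply: H1; rewrite /= (leq_trans (ltn_ord _)) ?leq_addr.
    by rewrite -H2 dl dr /= (leq_trans (ltn_ord _)) ?leq_addr.
pose f := [ffun x => match split x with inl a => g a | inr b => t b end].
have fl a : f (lshift m a) = g a by rewrite ffunE -[lshift m a]/(unsplit (inl a)) unsplitK.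
have fr b : f (rshift k b) = t b by rewrite ffunE -[rshift k b]/(unsplit (inr b)) unsplitK.
apply/existsP; exists f; apply/occurs_atP; split=> x y.
  rewrite -[x]splitK -[y]splitK; case: (split x) => a; case: (split y) => b /=; rewrite ?fl ?fr.
  - exact: g1.
  - by move=> _; have [h1 _] := gij a; have [h2 _] := ht b; apply: leq_ltn_trans h1 h2.
  - by move=> lt; have := ltn_ord b; lia.
  - by rewrite ltn_add2l; apply: t1.
rewrite -[x]splitK -[y]splitK; case: (split x) => a; case: (split y) => b /=; rewrite ?fl ?fr ?dl ?dr /=.
- exact: g2.
- have [_ h1] := gij a; have [_ h2] := ht b; rewrite (leq_ltn_trans h1 h2).
  by rewrite (leq_trans (ltn_ord _)) ?leq_addr.
- have [_ h1] := gij b; have [_ h2] := ht a.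
  by have := ltn_ord (P b); lia.
- by rewrite ltn_add2l.
Qed.

(** The reflection of an occurrence of the involution [P] in the diagonal is
    another one. *)
Lemma contains_board s : involutive_perm s -> (forall a, P (P a) = a) ->
  contains (dsum P tau) s <->
  exists g i j, [/\ front s g, forall a, g a <= i /\ s (g a) <= j & board s i j].
Proof.
move=> is1 PK; have sK := involutive_permK is1.
rewrite contains_dsum; split=> [[g [i [j [fg gij ab]]]]|[g [i [j [[g1 g2] gij]]]]].
  by exists g, i, j; split=> //; rewrite /board ab.
case/orP=> ab; first by exists g, i, j.
exists (fun a => s (g (P a))), j, i; split=> //; last first.
  by move=> a; rewrite sK; have [] := gij (P a).
split=> a b; first by move=> lt; rewrite -g2 !PK.
rewrite !sK; case: (ltngtP (P a) (P b)) => [lt|lt|E].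
- by rewrite g1.
- by have := g1 _ _ lt; case: ltngtP.
- by rewrite (val_inj E) ltnn.
Qed.
End Front.

Lemma front_chain k s i j (P : 'S_k) (r : rel nat) :
  (P = Idp k /\ r = ltn) \/ (P = Jdp k /\ r = gtn) -> i <= n ->
  (exists g, front P s g /\ forall a, g a < i /\ s (g a) < j) <-> chain (word_of s) r k i 0 j.
Proof.
move=> HPr lin.
have Pr (a b : 'I_k) : (P a < P b) = r a b.
  by case: HPr => -[-> ->]; rewrite ?perm1 // !permE /= ltn_sub2lE // ltnS.
have [up rs] : exists up : bool, forall x y, r x y = (if up then x < y else y < x).
  by case: HPr => -[_ ->]; [exists true|exists false].
have rtr : transitive r.
  by case: HPr => -[_ ->]; [exact: ltn_trans|move=> y x z /= h1 h2; apply: ltn_trans h2 h1].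
split=> [[g [[g1 g2] gij]]|[c [sc so ac]]].
  exists [seq val (g a) | a <- enum 'I_k]; split.
  - by rewrite size_map size_enum_ord.
  - rewrite sorted_map; apply: (@sub_sorted _ (fun a b : 'I_k => a < b)).
      move=> a b /= lt; rewrite g1 //= !word_ofE.
      have := g2 a b; have := g2 b a; rewrite !Pr !rs; case: (up) => /= h1 h2.
        by rewrite -h2.
      by rewrite -h1.
    have : sorted ltn (map val (enum 'I_k)) by rewrite val_enum_ord iota_ltn_sorted.
    by rewrite sorted_map.
  - by rewrite all_map; apply/allP => a _ /=; rewrite word_ofE; have [-> ->] := gij a.
have hc (a : 'I_k) : nth 0 c a < i /\ word_of s (nth 0 c a) < j.
  have := all_nthP 0 ac a; rewrite sc => /(_ (ltn_ord a)) /and3P[h1 _ h2].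
  by split.
pose g a := Ordinal (leq_trans (hc a).1 lin).
have tr2 : transitive (fun x y => (x < y) && r (word_of s x) (word_of s y)).
  by move=> y x z /andP[xy rxy] /andP[yz ryz]; rewrite (ltn_trans xy yz) (rtr _ _ _ rxy ryz).
have mono (a b : 'I_k) : a < b -> (g a < g b) && r (s (g a)) (s (g b)).
  move=> lt; rewrite -!word_ofE /=.
  move: so; rewrite (sorted_pairwise tr2) => /(pairwiseP 0) /(_ a b).
  by rewrite !inE sc !ltn_ord => /(_ isT isT lt).
exists g; split; last first.
  by move=> a; have [h1 h2] := hc a; split=> //; rewrite -word_ofE.
split=> a b; first by case/mono/andP.
rewrite Pr rs; case: (ltngtP a b) => [lt|lt|E].
- by have /andP[_] := mono _ _ lt; rewrite rs; case: (up) => h; rewrite ?h //; case: ltngtP h.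
- by have /andP[_] := mono _ _ lt; rewrite rs; case: (up) => h; rewrite ?h //; case: ltngtP h.
- by rewrite (val_inj E) ltnn; case: (up).
Qed.

Lemma contains_chain k s (P : 'S_k) (r : rel nat) : 0 < k -> involutive_perm s ->
  (P = Idp k /\ r = ltn) \/ (P = Jdp k /\ r = gtn) ->
  contains (dsum P tau) s <->
  (exists i j, [/\ i <= n, j <= n, vertex (board s) i j & chain (word_of s) r k i 0 j]).
Proof.
move=> k_gt0 is1 HPr; have PK a : P (P a) = a.
  by case: HPr => -[-> _]; rewrite ?perm1 // !permE rev_ordK.
rewrite contains_board //; split=> [[g [i [j [fg gij b]]]]|[i [j [lin ljn rij ch]]]].
  have [lin ljn] := board_n b; exists i.+1, j.+1; split=> //.
  by apply/(front_chain s j.+1 HPr lin); exists g.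
have [g [fg gij]] := (front_chain s j HPr lin).2 ch.
exists g, i.-1, j.-1; have [h1 h2] := gij (Ordinal k_gt0); split=> //.
  by move=> a; have [h3 h4] := gij a; lia.
by move: rij; rewrite /vertex; case/or3P=> [/eqP E|/eqP E|//]; lia.
Qed.
End Coloring.

(** * Counting involutions by their peaks *)

Lemma eq_word_of n (s t : 'S_n) (a : 'I_n) : word_of s a = word_of t a -> s a = t a.
Proof. by rewrite !word_ofE => /val_inj. Qed.

Lemma word_lt n (s : 'S_n) i : i < n -> word_of s i < n.
Proof. by move=> lin; rewrite -[i]/(val (Ordinal lin)) word_ofE ltn_ord. Qed.

Lemma word_involution_on n (s : 'S_n) : involutive_perm s -> involution_on n (word_of s).
Proof.
move=> is1 i lin; split; first exact: word_lt.
by rewrite -[i]/(val (Ordinal lin)) !word_ofE (involutive_permK is1).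
Qed.

Definition peakat n (p : nat -> nat) c := [&& c.+2 < n, p c < p c.+1 & p c.+2 < p c.+1].

Lemma PeakP n (s : 'S_n) (i : 'I_n) :
  reflect (exists2 c, i = c.+1 :> nat & peakat n (word_of s) c) (i \in Peak s).
Proof.
rewrite inE; apply: (iffP existsP) => [[h /existsP[j /and4P[/eqP hi /eqP ij s1 s2]]]|[c ic]].
  exists h; first by rewrite hi.
  by rewrite /peakat hi -ij !word_ofE s1 s2 ltn_ord.
case/and3P=> lt; have l1 : c < n by lia.
have E0 : word_of s c = s (Ordinal l1) by rewrite -word_ofE.
have E2 : word_of s c.+2 = s (Ordinal lt) by rewrite -word_ofE.
have E1 : word_of s c.+1 = s i by rewrite -ic word_ofE.
rewrite E0 E1 E2 => s1 s2.
by exists (Ordinal l1); apply/existsP; exists (Ordinal lt); rewrite s1 s2 /= ic !eqxx.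
Qed.

Section Classes.
Variables (n m : nat) (tau : 'S_m).
Implicit Type s : 'S_n.
Variable S : {set 'I_n}.

(** With a cut before each element of [S], the peaks that are not near [S] are
    those in the interior of a block. *)
Definition cutat (c : nat) := [exists x : 'I_n, (x \in S) && (val x == c)].
Definition peaks_near s := [forall i in Peak s, cutat i || cutat i.+1].

Lemma peaks_nearP s :
  reflect (forall c, peakat n (word_of s) c -> cutat c.+1 || cutat c.+2) (peaks_near s).
Proof.
apply: (iffP forall_inP) => [H c pc|H i /PeakP[c -> /H //]].
have lt : c.+1 < n by case/and3P: pc => ? _ _; lia.
by apply: (H (Ordinal lt)); apply/PeakP; exists c.
Qed.

Section OneClass.
Variable s0 : 'S_n.
Hypothesis is0 : involutive_perm s0.
Let D := board tau s0.
Let wh := white tau s0.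
Definition grey_class : {set 'S_n} := [set s | involutive_perm s && (key tau s == key tau s0)].
Let st := steps n D wh cutat 0 n.
Let class_word s := path_word n D (top_label n D (word_of s)) 0 n.

Lemma grey_classP s : reflect [/\ involutive_perm s,
    forall i j, board tau s i j = D i j,
    forall i, i < n -> white tau s i = wh i &
    forall i, i < n -> ~~ wh i -> word_of s i = word_of s0 i] (s \in grey_class).
Proof.
rewrite inE; apply: (iffP andP) => [[is1 /eqP/key_inj[Eb Ew Eg]]|[is1 Eb Ew Eg]].
  split=> // i lin; pose a := Ordinal lin.
    rewrite /wh /white Eb -[i]/(val a) !word_ofE; exact: Ew.
  by rewrite /wh /white -[i]/(val a) !word_ofE => /Eg ->.
split=> //; apply/eqP/key_closed => // a.
  by have := Ew a (ltn_ord a); rewrite /wh /white !word_ofE Eb.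
move=> nb; apply: eq_word_of; apply: Eg => //.
by rewrite /wh /white word_ofE.
Qed.

Lemma grey_class_fills s : s \in grey_class -> fills n D wh (word_of s).
Proof.
case/grey_classP=> is1 Eb Ew Eg; split; first exact: word_involution_on.
by move=> i lin; rewrite -Eb -Ew.
Qed.

Let Dn := @board_n n m tau s0.
Let Dd := @board_down n m tau s0.
Let Ds := @board_sym n m tau s0.
Lemma white_adjacent c : c.+1 < n -> wh c -> wh c.+1 -> forall j, D c j = D c.+1 j.
Proof. by move=> cn _ w; apply: white_col. Qed.

(** Between a letter on the board and one outside of it, an ascent or a
    descent is forced, and the letters outside of the board are common to the
    class. *)
Lemma peak_fixed s s' c : s \in grey_class -> s' \in grey_class ->
  ~~ [&& wh c, wh c.+1 & wh c.+2] -> peakat n (word_of s) c -> peakat n (word_of s') c.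
Proof.
case/grey_classP=> is1 Eb Ew Eg; case/grey_classP=> is2 Eb' Ew' Eg' nw /and3P[cn p1 p2].
have l1 : c.+1 < n by lia.
have l0 : c < n by lia.
case w1: (wh c.+1) nw.
  case w0: (wh c); last first.
    have : word_of s c.+1 < word_of s c by apply: (@grey_white n m tau); rewrite Ew ?w0 ?w1.
    by lia.
  case w2: (wh c.+2) => // _.
  have : word_of s c.+1 < word_of s c.+2.
    by apply: (@white_grey n m tau) => //; rewrite Ew ?w1 ?w2.
  by lia.
move=> _; rewrite /peakat cn /=; apply/andP; split.
  case w0: (wh c); first by apply: (@white_grey n m tau) => //; rewrite Ew' ?w0 ?w1.
  by rewrite Eg' ?w0 // Eg' ?w1 // -Eg ?w0 // -Eg ?w1.
case w2: (wh c.+2); first by apply: (@grey_white n m tau) => //; rewrite Ew' ?w2 ?w1.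
by rewrite Eg' ?w2 // Eg' ?w1 // -Eg ?w2 // -Eg ?w1.
Qed.

Definition fixed_ok := [forall c : 'I_n, peakat n (word_of s0) c ==>
  ~~ [&& wh c, wh c.+1 & wh c.+2] ==> cutat c.+1 || cutat c.+2].

Lemma s0_grey_class : s0 \in grey_class.
Proof. by rewrite inE is0 eqxx. Qed.

Lemma peaks_near_grey_class s : s \in grey_class -> peaks_near s = fixed_ok && no_linked_turn true st (class_word s).
Proof.
move=> sC; have fs := grey_class_fills sC.
have nf := no_linked_turn_free Dn Dd Ds cutat white_adjacent fs.
apply/peaks_nearP/andP => [H|[/forallP F N] c pc].
  split; last first.
    apply/nf => c; apply/negP => /and5P[cn w0 w1 w2 /and4P[c1 c2 p1 p2]].
    have : cutat c.+1 || cutat c.+2 by apply: H; rewrite /peakat cn p1.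
    by rewrite (negPf c1) (negPf c2).
  apply/forallP => c; apply/implyP => p0; apply/implyP => nw.
  by apply: H; apply: peak_fixed nw p0 => //; exact: s0_grey_class.
case nw: [&& wh c, wh c.+1 & wh c.+2].
  have /negP := (nf.1 N) c; apply: contra_notT => /norP[c1 c2].
  by case/and3P: nw => w0 w1 w2; case/and3P: pc => cn p1 p2; rewrite /free_peak cn w0 w1 w2 c1 c2 p1 p2.
have cn : c < n by case/and3P: pc => cn _ _; lia.
have /implyP := F (Ordinal cn); rewrite /= nw /=; apply.
by apply: peak_fixed pc; rewrite ?nw //; exact: s0_grey_class.
Qed.

Lemma class_word_inj : {in grey_class &, injective class_word}.
Proof.
move=> s s' sC sC' E; have fs := grey_class_fills sC; have fs' := grey_class_fills sC'.
have Eb i : i < n -> top_label n D (word_of s) i = top_label n D (word_of s') i.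
  move=> lin; have [t tn <-] := @crossed_surj n D i lin.
  have := congr1 (fun w => nth 0 w t) E.
  rewrite /class_word /path_word !(nth_map 0) ?size_iota // nth_iota // add0n.
  have ln := @crossed_lt n D t tn.
  have := top_label_white fs ln; rewrite -(top_label_white fs' ln).
  by case: (top_label _ _ _ _) => [x|]; case: (top_label _ _ _ _) => [y|] //= _ ->.
have H := fill_inj Ds fs fs' Eb.
apply/permP => a; apply: eq_word_of.
case w: (wh a); first by rewrite H.
have [_ _ _ Eg] := grey_classP _ sC; have [_ _ _ Eg'] := grey_classP _ sC'.
by rewrite Eg ?w // Eg' ?w.
Qed.

Lemma class_word_words s : class_word s \in words n n.
Proof.
rewrite mem_words size_map size_iota eqxx /=; apply/allP => x /mapP[t].
rewrite mem_iota /= => tn ->; case E: (top_label _ _ _ _) => [r|] /=; last by lia.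
by apply: hlabel_bound E.
Qed.

Lemma class_word_surj q w : w \in words n n -> valid q empty_shape st w -> exists2 s, s \in grey_class & class_word s = w.
Proof.
rewrite mem_words => /andP[/eqP sw _] V.
have [p [[ip fp] Eg Ew]] := fill_surj Dn Dd Ds (grey_class_fills s0_grey_class) sw V.
pose g (a : 'I_n) := insubd a (p a).
have gE (a : 'I_n) : g a = p a :> nat by rewrite val_insubd (ip a (ltn_ord a)).1.
have gK a : g (g a) = a by apply: val_inj; rewrite /= !gE (ip a (ltn_ord a)).2.
pose s : 'S_n := perm (can_inj gK).
have Es : word_of s = p.
  apply: functional_extensionality => i; case: (ltnP i n) => [lin|lin].
    by rewrite -[i]/(val (Ordinal lin)) word_ofE permE gE.
  have out (t : 'S_n) : word_of t i = 0.
    by rewrite /word_of; case: insubP => // a lt; rewrite leqNgt lt in lin.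
  rewrite out Eg ?out //; apply/negP => /Dn[lt _].
  by rewrite leqNgt lt in lin.
have is1 : involutive_perm s.
  by apply/eqP/permP => a; apply: (@perm_inj _ s); rewrite permKV !permE gK.
exists s; last by rewrite /class_word Es.
rewrite inE is1; apply/eqP/key_closed => // a.
  by rewrite -!word_ofE Es fp.
by move=> nb; apply: eq_word_of; rewrite Es Eg // /wh /white word_ofE.
Qed.

Lemma card_grey_class (A : pred 'S_n) q : {in grey_class, forall s, A s = valid q empty_shape st (class_word s)} ->
  #|[set s in grey_class | A s && peaks_near s]| =
  fixed_ok * \sum_(w <- words n n) (valid q empty_shape st w && no_linked_turn true st w).
Proof.
move=> HA; pose V w := valid q empty_shape st w && no_linked_turn true st w.
have -> : [set s in grey_class | A s && peaks_near s] = [set s in grey_class | fixed_ok && V (class_word s)].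
  apply/setP => s; rewrite [LHS]in_set [RHS]in_set; apply: andb_id2l => sC.
  by rewrite HA // peaks_near_grey_class // andbCA.
case: fixed_ok; last first.
  by rewrite mul0n; apply: eq_card0 => s; rewrite in_set andbF.
rewrite mul1n cardE -(size_map class_word) /=.
have -> : \sum_(w <- words n n) V w = size [seq w <- words n n | V w].
  by rewrite size_filter -sum1_count [RHS]big_mkcond; apply: eq_bigr => w _; case: (V w).
apply/perm_size/uniq_perm.
- rewrite map_inj_in_uniq ?enum_uniq // => s s'; rewrite !mem_enum [s \in _]in_set [s' \in _]in_set => /andP[sC _] /andP[sC' _].
  exact: class_word_inj.
- by rewrite filter_uniq ?words_uniq.
move=> w; rewrite mem_filter; apply/mapP/andP => [[s]|[Vw wW]].
  by rewrite mem_enum in_set => /andP[_ Vs] ->; rewrite class_word_words.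
have [s sC E] := class_word_surj wW (proj1 (andP Vw)).
by exists s; rewrite // mem_enum in_set sC E.
Qed.

Lemma avoid_col k s : 0 < k -> s \in grey_class ->
  avoids (dsum (Idp k) tau) s = valid (fun _ c => c != k.-1) empty_shape st (class_word s).
Proof.
move=> k_gt0 sC; have [is1 Eb _ _] := grey_classP _ sC.
have H := @contains_chain n m tau k s (Idp k) ltn k_gt0 is1 (or_introl (conj erefl erefl)).
have H2 := avoid_inc Dn Dd Ds cutat k.-1 (grey_class_fills sC); rewrite prednK // in H2.
have Er i j : vertex (board tau s) i j = vertex D i j by rewrite /vertex Eb.
apply/negP/idP => [nc|/H2 nc /H [i [j [h1 h2 h3 h4]]]].
  apply/H2 => -[i [j [h1 h2 h3 h4]]]; apply: nc; apply/H; exists i, j.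
  by rewrite Er.
by apply: nc; exists i, j; rewrite -Er.
Qed.

Lemma avoid_row k s : 0 < k -> s \in grey_class ->
  avoids (dsum (Jdp k) tau) s = valid (fun r _ => r != k.-1) empty_shape st (class_word s).
Proof.
move=> k_gt0 sC; have [is1 Eb _ _] := grey_classP _ sC.
have H := @contains_chain n m tau k s (Jdp k) gtn k_gt0 is1 (or_intror (conj erefl erefl)).
have H2 := avoid_dec Dn Dd Ds cutat k.-1 (grey_class_fills sC); rewrite prednK // in H2.
have Er i j : vertex (board tau s) i j = vertex D i j by rewrite /vertex Eb.
apply/negP/idP => [nc|/H2 nc /H [i [j [h1 h2 h3 h4]]]].
  apply/H2 => -[i [j [h1 h2 h3 h4]]]; apply: nc; apply/H; exists i, j.
  by rewrite Er.
by apply: nc; exists i, j; rewrite -Er.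
Qed.

Lemma grey_class_equal k : 0 < k ->
  #|[set s in grey_class | avoids (dsum (Idp k) tau) s && peaks_near s]| =
  #|[set s in grey_class | avoids (dsum (Jdp k) tau) s && peaks_near s]|.
Proof.
move=> k_gt0; rewrite (card_grey_class (q := fun _ c => c != k.-1)); last by move=> s; exact: avoid_col.
rewrite (card_grey_class (q := fun r _ => r != k.-1)); last by move=> s; exact: avoid_row.
have sst : size st = n by rewrite size_map size_iota.
congr (_ * _); rewrite -[X in words X X]sst; symmetry; apply: walks_equinumerous.
exact: steps_wf.
Qed.
End OneClass.

Lemma near_equal k : 0 < k ->
  #|[set s in Inv_avoiding n (dsum (Idp k) tau) | peaks_near s]| =
  #|[set s in Inv_avoiding n (dsum (Jdp k) tau) | peaks_near s]|.
Proof.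
move=> k_gt0; rewrite -!sum1_card.
rewrite (partition_big (key tau) xpredT) // [RHS](partition_big (key tau) xpredT) //=.
apply: eq_bigr => z _; rewrite !sum1_card.
case: (pickP (fun s : 'S_n => involutive_perm s && (key tau s == z))) => [s0 /andP[is0 /eqP <-]|none].
  have E (p : 'S_(k + m)) : #|[pred s in [set s in Inv_avoiding n p | peaks_near s] | key tau s == key tau s0]| =
      #|[set s in grey_class s0 | avoids p s && peaks_near s]|.
    by apply: eq_card => s; rewrite !inE; case: involutive_perm; rewrite //= andbC -andbA.
  by rewrite !E; apply: grey_class_equal.
have N (p : 'S_(k + m)) :
    #|[pred s in [set s in Inv_avoiding n p | peaks_near s] | key tau s == z]| = 0.
  apply: eq_card0 => s; have := none s; rewrite [s \in [pred _ in _ | _]]inE.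
  case: (key tau s == z); rewrite ?andbF // !andbT => is_s.
  by rewrite in_set [s \in Inv_avoiding _ _]in_set is_s.
by rewrite !N.
Qed.
End Classes.

Section Sparse.
Variable n : nat.
Implicit Type L : {set 'I_n}.

Definition sparse L := [forall i in L, (0 < i) && [forall j in L, j != i.+1 :> nat]].
Definition weight L := \sum_(i in L) (i : nat).

Lemma sparseP L : reflect (forall i, i \in L -> 0 < i /\ (forall j, j \in L -> j <> i.+1 :> nat)) (sparse L).
Proof.
apply: (iffP forall_inP) => H i iL.
  by have /andP[i0 /forall_inP H2] := H i iL; split=> // j jL; apply/eqP/H2.
have [i0 H2] := H i iL; rewrite i0; apply/forall_inP => j jL; apply/eqP; exact: H2.
Qed.

Lemma Peak_sparse (s : 'S_n) : sparse (Peak s).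
Proof.
apply/sparseP => i /PeakP[c ic /and3P[_ _ p2]]; split; first by rewrite ic.
move=> j /PeakP[d jd /and3P[_ p1 _]]; rewrite jd ic => -[E].
by move: p1; rewrite E; lia.
Qed.

(** Moving the elements of [T] outside of [L] up by one maps [T] into [L], and
    is injective because [T] is sparse. *)
Lemma weight_lt L T : sparse L -> sparse T -> T != L ->
  (forall i, i \in T -> cutat L i || cutat L i.+1) -> weight T < weight L.
Proof.
move=> /sparseP sL /sparseP sT neq near.
(* The default value of [insubd] does not occur for [i] in [T]. *)
pose f (i : 'I_n) := if i \in L then i else insubd i i.+1.
have fT i : i \in T -> f i \in L /\ (i \notin L -> f i = i.+1 :> nat).
  move=> iT; rewrite /f; case iL: (i \in L) => //; have := near i iT.
  case/orP=> /existsP[x /andP[xL /eqP xi]].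
    by rewrite -(val_inj xi) xL in iL.
  have -> : insubd i i.+1 = x by apply: val_inj; rewrite val_insubd -xi ltn_ord.
  by split.
have vlabel i : i \in T -> f i = i + (i \notin L) :> nat.
  move=> iT; case iL: (i \in L); first by rewrite /f iL addn0.
  by rewrite (fT i iT).2 ?iL // addn1.
have finj : {in T &, injective f}.
  move=> i j iT jT E; apply: val_inj => /=.
  have := vlabel i iT; rewrite E (vlabel j jT) => E2.
  have [_ Hi] := sT i iT; have [_ Hj] := sT j jT; have := Hi j jT; have := Hj i iT.
  by move: E2; case: (i \in L); case: (j \in L) => /=; lia.
have sub : f @: T \subset L by apply/subsetP => _ /imsetP[i iT ->]; have [] := fT i iT.
have E1 : \sum_(i in T) (f i : nat) = weight (f @: T) by rewrite /weight big_imset.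
have E2 : weight L = weight (f @: T) + weight (L :\: f @: T).
  by rewrite /weight (big_setID (f @: T)) /= (setIidPr sub).
have E3 : \sum_(i in T) (f i : nat) = weight T + \sum_(i in T) (i \notin L).
  by rewrite -big_split; apply: eq_bigr => i iT; rewrite vlabel.
rewrite E2 -E1 E3 -addnA -[X in X < _]addn0 ltn_add2l addn_gt0.
case: (boolP (T \subset L)) => [TL|]; last first.
  by case/subsetPn => i iT iL; rewrite (bigD1 i) //= iL.
have fid i : i \in T -> f i = i by move=> iT; rewrite /f (subsetP TL).
have fTE : f @: T = T.
  apply/setP => x; apply/imsetP/idP => [[i iT ->]|xT]; first by rewrite fid.
  by exists x; rewrite ?fid.
have /subsetPn[x xL xT] : ~~ (L \subset T) by move: neq; rewrite eqEsubset TL.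
apply/orP; right; rewrite fTE /weight (bigD1 x) ?inE ?xT //= addn_gt0.
by rewrite (sL x xL).1.
Qed.
End Sparse.

Section Counting.
Variables (n m : nat) (p p' : 'S_m).
Hypothesis near : forall S : {set 'I_n},
  #|[set s in Inv_avoiding n p | peaks_near S s]| =
  #|[set s in Inv_avoiding n p' | peaks_near S s]|.

(** By induction on the weight: [L] is the heaviest sparse set near [L], so
    its count is the only new unknown. *)
Lemma exact_equal (L : {set 'I_n}) :
  #|[set s in Inv_avoiding n p | Peak s == L]| =
  #|[set s in Inv_avoiding n p' | Peak s == L]|.
Proof.
have [w] := ubnP (weight L); elim: w L => // w IH L lw.
case: (boolP (sparse L)) => [sL|nsL]; last first.
  by rewrite !eq_card0 // => s; rewrite !inE; apply/negP => /andP[_ /eqP E];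
    rewrite -E Peak_sparse in nsL.
pose ok (T : {set 'I_n}) := [forall i in T, cutat L i || cutat L i.+1].
have E (q : 'S_m) : #|[set s in Inv_avoiding n q | peaks_near L s]| =
    \sum_(T | ok T) #|[set s in Inv_avoiding n q | Peak s == T]|.
  rewrite -sum1_card (partition_big (@Peak n) ok) /=.
    apply: eq_bigr => T oT; rewrite -sum1_card; apply: eq_bigl => s; rewrite !inE.
    case: eqP => [Es|_]; rewrite ?andbF // !andbT.
    by rewrite -Es in oT; rewrite [peaks_near L s]oT andbT.
  by move=> s; rewrite inE => /andP[].
have okL : ok L.
  by apply/forall_inP => i iL; apply/orP; left; apply/existsP; exists i; rewrite iL eqxx.
have := near L; rewrite !E (bigD1 L) // [RHS](bigD1 L) //=.
have -> : \sum_(T | ok T && (T != L)) #|[set s in Inv_avoiding n p | Peak s == T]| =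
          \sum_(T | ok T && (T != L)) #|[set s in Inv_avoiding n p' | Peak s == T]|.
  apply: eq_bigr => T /andP[/forall_inP oT neq].
  case: (boolP (sparse T)) => [sT|nsT]; first by apply: IH; have := weight_lt sL sT neq oT; lia.
  by rewrite !eq_card0 // => s; rewrite !inE; apply/negP => /andP[_ /eqP E'];
    rewrite -E' Peak_sparse in nsT.
by move/addIn.
Qed.
End Counting.

Theorem corollary1p7 (n k : nat) (hn : 1 <= n) (hk : 1 <= k)
    (m : nat) (tau : 'S_m) :
  (\sum_(s in Inv_avoiding n (dsum (Idp k) tau)) tmon (Peak s) =
   \sum_(s in Inv_avoiding n (dsum (Jdp k) tau)) tmon (Peak s))%R.
Proof.
have E (p : 'S_(k + m)) : (\sum_(s in Inv_avoiding n p) tmon (Peak s) =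
    \sum_(L : {set 'I_n}) tmon L *+ #|[set s in Inv_avoiding n p | Peak s == L]|)%R.
  rewrite (partition_big (@Peak n) xpredT) //=; apply: eq_bigr => L _.
  rewrite (eq_bigr (fun=> tmon L)) => [|s /andP[_ /eqP -> //]].
  rewrite GRing.sumr_const; congr (_ *+ _)%R; apply: eq_card => s.
  by rewrite [RHS]in_set.
rewrite !E; apply: eq_bigr => L _; congr (_ *+ _)%R; apply: exact_equal => S.
exact: near_equal.
Qed.
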